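(* Let $G=(V,E,S_{\mathrm{src}},T_{\mathrm{sink}},\tau)$ be a computational DP DAG on $T$ vertices with frontier width $\omega$, satisfying the locality assumption and the max-type semiring assumption with deterministic witnesses, and let $t\in T_{\mathrm{sink}}$. Then there is a deterministic algorithm in the machine model below which, given $G$ and $t$, outputs the canonical optimal witness path to $t$ (i.e. solves the traceback problem for $t$) using work-tape space \[ O(\omega \log T + (\log T)^{O(1)}) \] tape cells over a fixed finite alphabet.
   Context: A computational DP DAG consists of a vertex set $V=\{1,\dots,T\}$, an edge set $E\subseteq V\times V$ such that $(u,v)\in E$ implies $u<v$ (so the identity map is the fixed topological order $\tau$), a nonempty set $S_{\mathrm{src}}\subseteq V$ of source vertices (each of in-degree $0$), and a nonempty set $T_{\mathrm{sink}}\subseteq V$ of sink vertices. For $0\le \ell\le T$ the frontier is $\mathrm{Front}(\ell)=\{v\in V: v\le \ell \text{ and } \exists w>\ell \text{ with } (v,w)\in E\}$, and the frontier width is $\omega=\max_{0\le\ell\le T}|\mathrm{Front}(\ell)|$. Locality assumption: every vertex has in-degree at most a universal constant $\Delta_{\max}$. Max-type semiring assumption: $(\mathcal S,\preceq)$ is a totally ordered set with operations $\oplus,\otimes$, where $\oplus$ of a finite set is its $\preceq$-maximum (so $a\oplus b=\max_\preceq\{a,b\}$), there is a bottom element $\mathbf 0$ with $\mathbf 0\oplus a=a$, $\otimes$ is associative, distributes over $\oplus$, and is monotone in each argument. Given source values $a_v\in\mathcal S$ ($v\in S_{\mathrm{src}}$) and edge weights $w_{u,v}\in\mathcal S$, the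 DP values are $x_v=a_v$ for $v\in S_{\mathrm{src}}$ and $x_v=\bigoplus_{(u,v)\in E}(x_u\otimes w_{u,v})$ otherwise. Every element of $\mathcal S$ (weight or value) is encoded with $O(\log T)$ tape cells (a ''machine word''), and comparison, $\oplus$, $\otimes$ and index arithmetic on $\{1,\dots,T\}$ take time and space polynomial in $\log T$. A fixed total order $\prec$ on $E$ gives deterministic tie-breaking: for $v\notin S_{\mathrm{src}}$, the witness predecessor $\mathsf{pred}(v)$ is the $u$ such that $(u,v)$ is $\prec$-minimal among edges $(u,v)\in E$ with $x_u\otimes w_{u,v}=x_v$; for $v\in S_{\mathrm{src}}$, $\mathsf{pred}(v)=\bot$. Traceback problem for $t$: output the sequence $(v_0,\dots,v_k)$ with $v_k=t$, $v_0\in S_{\mathrm{src}}$ and $v_{i-1}=\mathsf{pred}(v_i)$ for $1\le i\le k$ (the canonical optimal witness path). Machine model: deterministic multitape Turing machine; the instance (adjacency lists, weights, source values) is on a read-only input tape with random access (the head can move to any vertex or edge description in time polynomial in $\log T$); the output is written on a write-only output tape; space is the number of work-tape cells used over a fixed finite alphabet, input and output tapes not counted.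
   Formalization: A non-source vertex of in-degree 0 has no witness predecessor, so the path to t may not exist; the output is claimed to be the canonical path whenever one exists (halting and the space bound hold always). Adjacency lists are in-lists written in the tie-breaking order. *)

(* Defs.v *)
From HB Require Import structures.
From mathcomp Require Import all_boot all_order.

Set Implicit Arguments.
Unset Strict Implicit.
Unset Printing Implicit Defensive.

Import Order.TTheory.

(* Number of binary digits of n: lg n = floor (log2 n) + 1 for n > 0. This is
   the reading of log T throughout; it stays positive at T = 1. *)
Definition lg (n : nat) : nat := (trunc_log 2 n).+1.

(* Binary expansion, least significant bit first; bits 0 = [:: false]. *)
Definition bits (n : nat) : seq bool :=
  mkseq (fun i => odd (n %/ 2 ^ i)) (lg n).

(* Symbols of the input and output tapes: binary digits, the characters of the
   finite alphabet A in which semiring elements are encoded, and a separator. *)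
Definition sym (A : finType) : Type := option (bool + A).

Definition sep {A : finType} : sym A := None.
Definition bitsym {A : finType} (b : bool) : sym A := Some (inl b).
Definition charsym {A : finType} (a : A) : sym A := Some (inr a).

Definition symbits (A : finType) (n : nat) : seq (sym A) :=
  map bitsym (bits n).

Inductive move : Type := MoveL | MoveS | MoveR.

(* Jump is the random access to the input tape, see input_head below. *)
Inductive input_move : Type := Walk of move | Jump.

(* A cell of a work tape: blank (None), an input/output symbol, or one of the
   finitely many private symbols X of the machine. *)
Definition cell (A X : finType) : Type := option (sym A + X).

(* Deterministic machine with tm_aux.+1 work tapes; tape ord0 is also the
   address tape for random access. The transition function reads the state,
   the input symbol (None past the end of the input) and the scanned work
   cells; it returns None to halt, and otherwise the next state, a symbol to
   write and a move for every work tape, the input head action and an optional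
   symbol appended to the output tape. *)
Record machine (A : finType) : Type := Machine {
  tm_state : finType;
  tm_priv : finType;
  tm_aux : nat;
  tm_start : tm_state;
  tm_delta : tm_state -> option (sym A) ->
    {ffun 'I_tm_aux.+1 -> cell A tm_priv} ->
    option (tm_state * {ffun 'I_tm_aux.+1 -> cell A tm_priv * move} *
            input_move * option (sym A))
}.

(* A one-way infinite tape: a finite prefix of its cells (blank beyond), which
   contains all the cells written so far, and the head position. *)
Definition tape (A X : finType) : Type := (seq (cell A X) * nat)%type.

Definition move_head (m : move) (h : nat) : nat :=
  match m with MoveL => h.-1 | MoveS => h | MoveR => h.+1 end.

Definition scanned (A X : finType) (tp : tape A X) : cell A X :=
  nth None tp.1 tp.2.

Definition tape_step (A X : finType) (tp : tape A X) (wm : cell A X * move) :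
    tape A X :=
  (set_nth None tp.1 tp.2 wm.1, move_head wm.2 tp.2).

Definition tape_cells (A X : finType) (tp : tape A X) : nat :=
  maxn (size tp.1) tp.2.+1.

(* The number whose binary digits (least significant first) fill the tape from
   its left end up to the first cell that is not a digit. *)
Fixpoint address (A X : finType) (s : seq (cell A X)) : nat :=
  match s with
  | Some (inl (Some (inl b))) :: s' => (b : nat) + (address s').*2
  | _ => 0
  end.

(* The read-only input tape carries the concatenation of a list of blocks. Its
   head stays in [0, size of the input]. Jump moves it to the beginning of the
   block whose number is on the address tape. *)
Definition input_head (A X : finType) (blocks : seq (seq (sym A)))
    (s : seq (cell A X)) (m : input_move) (pos : nat) : nat :=
  match m with
  | Walk mv => minn (move_head mv pos) (size (flatten blocks))
  | Jump => size (flatten (take (address s) blocks))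
  end.

Section Runs.
Variables (A : finType) (M : machine A).

Record config : Type := Config {
  cf_state : tm_state M;
  cf_input : nat;
  cf_tapes : {ffun 'I_(tm_aux M).+1 -> tape A (tm_priv M)};
  cf_output : seq (sym A)
}.

Variables (blocks : seq (seq (sym A))) (args : seq (seq (sym A))).

(* Work tape i initially carries the i-th entry of args. *)
Definition init_config : config :=
  Config (tm_start M) 0
    [ffun i : 'I_(tm_aux M).+1 =>
       ([seq Some (inl a) | a <- nth [::] args i], 0) : tape A (tm_priv M)]
    [::].

Definition step (c : config) : option config :=
  match tm_delta (cf_state c) (onth (flatten blocks) (cf_input c))
          [ffun i => scanned (cf_tapes c i)] with
  | None => None
  | Some (q, acts, im, o) =>
      Some (Config q
        (input_head blocks (cf_tapes c ord0).1 im (cf_input c))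
        [ffun i => tape_step (cf_tapes c i) (acts i)]
        (if o is Some a then rcons (cf_output c) a else cf_output c))
  end.

Fixpoint run (n : nat) (c : config) : config :=
  if n is n'.+1 then
    if step c is Some c' then run n' c' else c
  else c.

Definition space (c : config) : nat := \sum_i tape_cells (cf_tapes c i).

Definition halts_with (out : seq (sym A)) (n : nat) : Prop :=
  step (run n init_config) = None /\ cf_output (run n init_config) = out.

Definition space_within (s : nat) : Prop :=
  forall n, space (run n init_config) <= s.

End Runs.

(* Operations on machine words: the operands stand on the work tapes, there is
   no input, and the result goes to the output tape, in time and space b. *)
Definition evaluates (A : finType) (M : machine A) (args : seq (seq (sym A)))
    (out : seq (sym A)) (b : nat) : Prop :=
  (exists2 n, n <= b & halts_with M [::] args out n) /\
  space_within M [::] args b.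

Record max_semiring (disp : Order.disp_t) : Type := MaxSemiring {
  ms_sort :> orderType disp;
  ms_zero : ms_sort;
  ms_mul : ms_sort -> ms_sort -> ms_sort;
  ms_zeroP : forall a : ms_sort, Order.max ms_zero a = a;
  ms_mulA : associative ms_mul;
  ms_mulDl : left_distributive ms_mul Order.max;
  ms_mulDr : right_distributive ms_mul Order.max;
  ms_mul_monol : forall a b c : ms_sort,
    (a <= b)%O -> (ms_mul a c <= ms_mul b c)%O;
  ms_mul_monor : forall a b c : ms_sort,
    (a <= b)%O -> (ms_mul c a <= ms_mul c b)%O
}.

(* Machines for the empty sum, for comparison (which also yields the binary
   sum, a maximum) and for the product. *)
Record word_ops (A : finType) : Type := WordOps {
  wo_zero : machine A;
  wo_le : machine A;
  wo_mul : machine A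
}.

Definition is_word (A : finType) (S : Type) (enc : S -> seq A) (cw T : nat)
    (a : S) : Prop := size (enc a) <= cw * lg T.

(* The machines in ops realise the operations of S on elements encoded with at
   most cw * lg T cells, in time and space at most c * lg T ^ e. Each of them
   also receives T. *)
Definition implements (A : finType) (ops : word_ops A) (disp : Order.disp_t)
    (S : max_semiring disp) (enc : S -> seq A) (cw c e T : nat) : Prop :=
  let wd a := map charsym (enc a) in
  let bound := c * lg T ^ e in
  [/\ evaluates (wo_zero ops) [:: symbits A T] (wd (ms_zero S)) bound,
      forall a b : S, is_word enc cw T a -> is_word enc cw T b ->
        evaluates (wo_le ops) [:: symbits A T; wd a; wd b]
          [:: bitsym (a <= b)%O] bound
    & forall a b : S, is_word enc cw T a -> is_word enc cw T b ->
        evaluates (wo_mul ops) [:: symbits A T; wd a; wd b]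
          (wd (ms_mul a b)) bound].

(* The vertex v of {1, ..., T} is the ordinal of value v - 1, so that the
   number of v : 'I_T is v.+1. *)
Record dp_dag (T : nat) : Type := DPDag {
  dd_edge : rel 'I_T;
  dd_src : {set 'I_T};
  dd_sink : {set 'I_T};
  dd_edge_lt : forall u v, dd_edge u v -> u < v;
  dd_src_neq0 : dd_src != set0;
  dd_sink_neq0 : dd_sink != set0;
  dd_src_indeg0 : forall u v, v \in dd_src -> ~~ dd_edge u v
}.

Definition front (T : nat) (G : dp_dag T) (l : nat) : {set 'I_T} :=
  [set v : 'I_T | (v.+1 <= l) && [exists w : 'I_T, (l < w.+1) && dd_edge G v w]].

Definition frontier_width (T : nat) (G : dp_dag T) : nat :=
  \max_(l < T.+1) #|front G l|.

Definition indegree_le (T : nat) (G : dp_dag T) (Delta : nat) : Prop :=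
  forall v, #|[set u | dd_edge G u v]| <= Delta.

(* Only the values of di_val on sources and of di_weight on edges matter;
   di_ord e e' means that e = e' or e precedes e' in the tie-breaking order. *)
Record dp_instance (disp : Order.disp_t) (S : max_semiring disp) (T : nat) :
    Type := DPInstance {
  di_dag :> dp_dag T;
  di_val : 'I_T -> S;
  di_weight : 'I_T -> 'I_T -> S;
  di_ord : rel ('I_T * 'I_T);
  di_ord_total :
    {in [pred e | dd_edge di_dag e.1 e.2] &, total di_ord};
  di_ord_anti :
    {in [pred e | dd_edge di_dag e.1 e.2] &, antisymmetric di_ord};
  di_ord_trans :
    {in [pred e | dd_edge di_dag e.1 e.2] & &, transitive di_ord}
}.

Section DP.
Variables (disp : Order.disp_t) (S : max_semiring disp) (T : nat).
Variable (I : dp_instance S T).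
Implicit Types (u v t : 'I_T) (p : seq 'I_T).

Definition dp_rhs (x : 'I_T -> S) v : S :=
  if v \in dd_src I then di_val I v
  else \big[Order.max/ms_zero S]_(u | dd_edge I u v)
         ms_mul (x u) (di_weight I u v).

(* The recursion is acyclic, so T rounds reach its unique solution: dp_valE. *)
Definition dp_val : 'I_T -> S := iter T dp_rhs (fun=> ms_zero S).

Definition tight u v : bool :=
  dd_edge I u v && (ms_mul (dp_val u) (di_weight I u v) == dp_val v).

Definition witness v : option 'I_T :=
  if v \in dd_src I then None
  else [pick u | tight u v &&
                 [forall u', tight u' v ==> di_ord I (u, v) (u', v)]].

Definition is_traceback t p : Prop :=
  exists v0 s, [/\ p = v0 :: s, last v0 s = t, v0 \in dd_src I
                 & path (fun u v => witness v == Some u) v0 s].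

Definition words_ok (A : finType) (enc : S -> seq A) (cw : nat) : Prop :=
  [/\ forall v, v \in dd_src I -> is_word enc cw T (di_val I v),
      forall v, is_word enc cw T (dp_val v),
      forall u v, dd_edge I u v -> is_word enc cw T (di_weight I u v)
    & forall u v, dd_edge I u v ->
        is_word enc cw T (ms_mul (dp_val u) (di_weight I u v))].

(* In-neighbours of v, listed in the tie-breaking order of the edges. *)
Definition adj v : seq 'I_T :=
  sort (fun u u' => di_ord I (u, v) (u', v)) (enum [pred u | dd_edge I u v]).

Variables (A : finType) (enc : S -> seq A).

Definition encode_edge v u : seq (sym A) :=
  symbits A u.+1 ++ sep :: map charsym (enc (di_weight I u v)) ++ [:: sep].

(* Source and sink flags, source value if any, adjacency list with weights;
   the list is closed by an extra separator. *)
Definition encode_vertex v : seq (sym A) :=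
  [:: bitsym (v \in dd_src I); bitsym (v \in dd_sink I)]
  ++ (if v \in dd_src I then map charsym (enc (di_val I v)) else [::])
  ++ sep :: flatten [seq encode_edge v u | u <- adj v] ++ [:: sep].

(* Block 0 holds T and t; block v.+1 describes the vertex of number v.+1. *)
Definition encode_instance t : seq (seq (sym A)) :=
  (symbits A T ++ sep :: symbits A t.+1 ++ [:: sep])
  :: [seq encode_vertex v | v <- enum 'I_T].

End DP.

Definition encode_path (A : finType) (T : nat) (p : seq 'I_T) : seq (sym A) :=
  flatten [seq symbits A v.+1 ++ [:: sep] | v : 'I_T <- p].

Section Facts.
Variables (disp : Order.disp_t) (S : max_semiring disp) (T : nat).
Variable (I : dp_instance S T).

Lemma dp_rhs_local (x y : 'I_T -> S) (v : 'I_T) :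
  (forall u : 'I_T, u < v -> x u = y u) -> dp_rhs I x v = dp_rhs I y v.
Proof.
move=> xy; rewrite /dp_rhs; case: ifP => // _.
by apply: eq_bigr => u /dd_edge_lt /xy ->.
Qed.

Lemma dp_valE v : dp_val I v = dp_rhs I (dp_val I) v.
Proof.
pose z (_ : 'I_T) := ms_zero S.
have stab n : forall (v : 'I_T) m, v < n -> n <= m ->
    iter m (dp_rhs I) z v = iter n (dp_rhs I) z v.
  elim: n => [//|n IH] w [//|m] wn nm /=.
  apply: dp_rhs_local => u uw; apply: IH => //.
  exact: leq_trans uw wn.
by rewrite -[RHS]/(iter T.+1 (dp_rhs I) z v) (stab T).
Qed.

Lemma traceback_unique t p p' :
  is_traceback I t p -> is_traceback I t p' -> p = p'.
Proof.
move=> [v0 [s [-> <- {t} v0s ps]]] [v1 [s' [-> + v1s ps']]].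
elim/last_ind: s s' ps ps' => [|s x IH] s'.
  move=> _; case/lastP: s' => [_ /= -> //|s' y].
  rewrite last_rcons rcons_path => /andP[_ /eqP wy] /= yv.
  by move: wy; rewrite yv /witness v0s.
rewrite rcons_path last_rcons => /andP[ps /eqP wx].
case/lastP: s' => [_ /= v1x|s' y].
  by move: wx; rewrite -v1x /witness v1s.
rewrite rcons_path last_rcons => /andP[ps' /eqP wy] yx.
move: wy; rewrite yx wx => -[e].
by have /= [-> ->] := IH _ ps ps' (esym e).
Qed.

Lemma bigmax_attained (J : finType) (P : pred J) (F : J -> S) j0 :
  P j0 -> exists2 j, P j & F j = \big[Order.max/ms_zero S]_(i | P i) F i.
Proof.
move=> Pj0; rewrite -big_filter.
have : j0 \in [seq i <- index_enum J | P i] by rewrite mem_filter Pj0 mem_index_enum.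
have : all P [seq i <- index_enum J | P i] by rewrite filter_all.
elim: [seq i <- index_enum J | P i] j0 {Pj0} => [//|j r IH] j0 /= /andP[Pj Pr] _.
rewrite big_cons; case: r IH Pr => [|k r] IH Pr.
  by exists j => //; rewrite big_nil maxC ms_zeroP.
have [i Pi <-] := IH k Pr (mem_head _ _).
by rewrite /Order.max; case: ifP => _; [exists i|exists j].
Qed.

Lemma witness_exists (v : 'I_T) u0 :
  v \notin dd_src I -> dd_edge I u0 v -> exists u, witness I v = Some u.
Proof.
move=> vs e0.
have [u1 e1 E1] := bigmax_attained
  (fun u => ms_mul (dp_val I u) (di_weight I u v)) (P := dd_edge I ^~ v) e0.
have t1 : tight I u1 v.
  by rewrite /tight e1 [dp_val I v]dp_valE /dp_rhs (negbTE vs) E1 eqxx.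
pose L := enum [pred u | tight I u v].
pose le u u' := di_ord I (u, v) (u', v).
have tightE w : tight I w v -> (w, v) \in [pred e | dd_edge I e.1 e.2].
  by case/andP.
have [u tu umin] : exists2 u, tight I u v & forall w, w \in L -> le u w.
  have : all (tight I ^~ v) L by apply/allP => w; rewrite mem_enum.
  have : u1 \in L by rewrite mem_enum.
  elim: L u1 {e1 E1 t1} => [//|a r IH] k _ /= /andP[ta tr].
  have lea : le a a.
    by have := di_ord_total (tightE _ ta) (tightE _ ta); rewrite orbb.
  case: r IH tr => [|b r] IH tr.
    by exists a => // w; rewrite mem_seq1 => /eqP ->.
  have [u tu umin] := IH b (mem_head _ _) tr.
  have [au|ua] := orP (di_ord_total (tightE _ ta) (tightE _ tu)).
    exists a => // w; rewrite in_cons => /predU1P[-> //|wr].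
    have tw : tight I w v by exact: (allP tr).
    exact: (di_ord_trans (tightE _ tu) (tightE _ ta) (tightE _ tw) au (umin _ wr)).
  by exists u => // w; rewrite in_cons => /predU1P[-> //|/umin].
exists u; rewrite /witness (negbTE vs); case: pickP => [w|/(_ u)]; last first.
  rewrite tu /= => /forallP[] w; apply/implyP => tw.
  by apply: umin; rewrite mem_enum.
move=> /andP[tw /forallP wmin]; congr Some.
have wu := implyP (wmin u) tu.
have uw : le u w by apply: umin; rewrite mem_enum.
have := @di_ord_anti _ _ _ I (w, v) (u, v) (tightE _ tw) (tightE _ tu).
by rewrite wu [di_ord _ _ _]uw => /(_ isT) [].
Qed.

(* A traceback can only fail to exist because of a non-source vertex of
   in-degree 0, where no witness predecessor is available. *)
Lemma traceback_exists (t : 'I_T) :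
  (forall v, v \notin dd_src I -> exists u, dd_edge I u v) ->
  exists p, is_traceback I t p.
Proof.
move=> H; have [n] := ubnP (t : nat).
elim: n t => // n IH t; rewrite ltnS => tn.
have [ts|ts] := boolP (t \in dd_src I).
  by exists [:: t], t, [::].
have [u0 e0] := H _ ts; have [u wu] := witness_exists ts e0.
have eu : dd_edge I u t.
  move: wu; rewrite /witness (negbTE ts); case: pickP => // w /andP[/andP[ew _] _].
  by move=> [<-].
have [p [v0 [s [_ lu v0s ps]]]] := IH u (leq_trans (dd_edge_lt eu) tn).
exists (v0 :: rcons s t), v0, (rcons s t); split=> //.
  by rewrite last_rcons.
by rewrite rcons_path ps lu wu eqxx.
Qed.

End Facts.

(* Main.v *)
(* The canonical path is recovered by walking back from [t]: writing pred(v) for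
   the witness predecessor, the walk t, pred(t), pred(pred(t)), ... is repeated
   from scratch for every vertex to be output, and stops at the vertex whose
   predecessor is the last vertex already output (or at the source, the first
   time). Only the current vertex and the last output vertex are remembered.

   Each pred(v) is found by a forward sweep over 1, ..., v that keeps a table of
   the values x_u, for u in the current frontier. All in-neighbours of the next
   vertex are in the table; once its value has been computed, an entry u is
   dropped when a scan of the remaining adjacency lists meets no edge from u. The
   table thus has at most omega + 1 entries of O(log T) cells, and everything
   else fits in a polylogarithmic number of cells.

   The algorithm is written in a small imperative language whose registers are
   stacks. Programs are compiled to Turing machines, one work tape per stack, and
   the given machines for the semiring operations are simulated with two stacks
   per tape. Since a tape never shrinks in the space measure, it is enough to
   bound every register by the same [B] throughout an execution. *)

Require Import Defs.
From mathcomp Require Import all_boot all_order.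
From mathcomp Require Import zify.

Set Implicit Arguments.
Unset Strict Implicit.
Unset Printing Implicit Defensive.

Import Order.TTheory.

(** * Stack programs *)

(** The obstacle is one of direction: the path must appear on a write-only tape from its source to
    [t], while witness predecessors lead from [t] back, and storing the path or all predecessors may
    take too much space. As no time bound is asked, everything is recomputed. Comparing with the
    last output vertex is unambiguous because witness edges increase the topological number, so a
    path never repeats a vertex. The tie-break needs no extra storage: adjacency lists come in the
    order of the edges, so replacing the running maximum only on strict improvement selects the
    witness. The machine is fixed before the semiring, the encoding and [T]. Hence its alphabet and
    its registers depend on [A] and [ops] only, and [B] cannot occur in a program: it is a parameter
    of the execution relation [exec], a derivation of which establishes termination and the space
    bound together. The run must halt within the bound even when [t] has no traceback. *)

Fixpoint put (T : Type) (R : seq (seq T)) (r : nat) (s : seq T) :=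
  match R, r with
  | [::], _ => [::]
  | _ :: R', 0 => s :: R'
  | x :: R', r'.+1 => x :: put R' r' s
  end.

Definition num (s : seq bool) : nat := foldr (fun (b : bool) n => b + n.*2) 0 s.

Section StackPrograms.
Variables (A Sg : finType).

(* [inp] is the part of the input from the head on, and [addr] the digits on
   the address tape, least significant first. *)
Record state := State {
  inp : seq (sym A);
  regs : seq (seq Sg);
  addr : seq bool;
  outp : seq (sym A)
}.

(** The address tape is invisible to a program, having no bottom mark to test: whoever pushes digits
    on it must remember how many to delete. *)
Definition view := (option (sym A) * seq (option Sg))%type.

Definition view_of (s : state) : view := (ohead (inp s), map ohead (regs s)).

Inductive op := Keep | Pop | Push of Sg | Subst of Sg.

Definition apply_op (o : op) (s : seq Sg) : seq Sg :=
  match o with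
  | Keep => s
  | Pop => behead s
  | Push x => x :: s
  | Subst x => if s is _ :: s' then x :: s' else [::]
  end.

Inductive prim :=
  | Skip
  | Do of nat & (view -> op)
  | Advance
  | Seek
  | AddrPush of (view -> bool)
  | AddrPop
  | Emit of (view -> sym A).

Inductive prog :=
  | Prim of prim
  | Seq of prog & prog
  | If of (view -> bool) & prog & prog
  | While of (view -> bool) & prog.

Variable blocks : seq (seq (sym A)).

Definition prim_sem (a : prim) (s : state) : state :=
  let: State i R ad o := s in
  match a with
  | Skip => s
  | Do r f => State i (put R r (apply_op (f (view_of s)) (nth [::] R r))) ad o
  | Advance => State (behead i) R ad o
  | Seek => State (flatten (drop (num ad) blocks)) R ad o
  | AddrPush f => State i R (rcons ad (f (view_of s))) o
  | AddrPop => State i R (take (size ad).-1 ad) o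
  | Emit f => State i R ad (rcons o (f (view_of s)))
  end.

Variable B : nat.

(** Apart from the existence of the register, only pushes are checked: no other primitive enlarges a
    stack. *)
Definition prim_safe (a : prim) (s : state) : bool :=
  match a with
  | Do r f => (r < size (regs s)) &&
      (if f (view_of s) is Push _ then size (nth [::] (regs s) r) < B else true)
  | AddrPush _ => size (addr s) < B
  | _ => true
  end.

Inductive exec : prog -> state -> state -> Prop :=
  | ExecPrim a s : prim_safe a s -> exec (Prim a) s (prim_sem a s)
  | ExecSeq p q s1 s2 s3 : exec p s1 s2 -> exec q s2 s3 -> exec (Seq p q) s1 s3
  | ExecIf (c : view -> bool) p q s1 s2 :
      exec (if c (view_of s1) then p else q) s1 s2 -> exec (If c p q) s1 s2
  | ExecDone (c : view -> bool) p s : ~~ c (view_of s) -> exec (While c p) s s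
  | ExecLoop (c : view -> bool) p s1 s2 s3 : c (view_of s1) -> exec p s1 s2 ->
      exec (While c p) s2 s3 -> exec (While c p) s1 s3.

Record graph := Graph {
  gstate : finType;
  gstart : gstate;
  gnext : gstate -> view -> option (prim * gstate)
}.

Definition lift_next (Q Q' : Type) (f : Q -> Q') (x : prim * Q) : prim * Q' :=
  (x.1, f x.2).

(** There are no exit states: a component has finished when its [gnext] gives [None] on the current
    view, and the enclosing graph then inserts a [Skip] that leads to the continuation. *)
Fixpoint compile (p : prog) : graph :=
  match p with
  | Prim a => @Graph bool true (fun q _ => if q then Some (a, false) else None)
  | Seq p1 p2 =>
      let g1 := compile p1 in let g2 := compile p2 in
      @Graph (gstate g1 + gstate g2)%type (inl (gstart g1))
        (fun q v => match q with
         | inl q1 => if gnext q1 v is Some x then Some (lift_next inl x)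
                     else Some (Skip, inr (gstart g2))
         | inr q2 => omap (lift_next inr) (gnext q2 v)
         end)
  | If c p1 p2 =>
      let g1 := compile p1 in let g2 := compile p2 in
      @Graph (option (gstate g1 + gstate g2))%type None
        (fun q v => match q with
         | None => Some (Skip, Some (if c v then inl (gstart g1)
                                     else inr (gstart g2)))
         | Some (inl q1) => omap (lift_next (Some \o inl)) (gnext q1 v)
         | Some (inr q2) => omap (lift_next (Some \o inr)) (gnext q2 v)
         end)
  | While c p1 =>
      let g1 := compile p1 in
      @Graph (option (gstate g1)) None
        (fun q v => match q with
         | None => if c v then Some (Skip, Some (gstart g1)) else None
         | Some q1 => if gnext q1 v is Some x then Some (lift_next Some x)
                      else Some (Skip, None)
         end)
  end.

Inductive reach (g : graph) : gstate g -> state -> gstate g -> state -> Prop :=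
  | ReachRefl q s : reach q s q s
  | ReachStep q s a q1 q2 s2 : gnext q (view_of s) = Some (a, q1) ->
      prim_safe a s -> reach q1 (prim_sem a s) q2 s2 -> reach q s q2 s2.

Lemma reach_trans g (q1 q2 q3 : gstate g) s1 s2 s3 :
  reach q1 s1 q2 s2 -> reach q2 s2 q3 s3 -> reach q1 s1 q3 s3.
Proof.
move=> r; elim: r q3 s3 => {q1 q2 s1 s2} // q s a q1 q2 s2 e sf _ IH q3 s3 r.
by apply: ReachStep e sf _; apply: IH.
Qed.

Lemma reach_lift g g' (f : gstate g -> gstate g') :
  (forall q v x, gnext q v = Some x -> gnext (f q) v = Some (lift_next f x)) ->
  forall q1 s1 q2 s2, reach q1 s1 q2 s2 -> reach (f q1) s1 (f q2) s2.
Proof.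
move=> fP q1 s1 q2 s2 r; elim: r => {q1 q2 s1 s2} [q s|q s a q1 q2 s2 e sf _ IH].
  exact: ReachRefl.
by apply: ReachStep IH => //; rewrite (fP _ _ _ e).
Qed.

(** Induction on the execution rather than on the program, so that a loop is unrolled as often as it
    runs; each body is traversed through the embedding of its graph ([reach_lift]). *)
Lemma compileP p s s' : exec p s s' ->
  exists2 q, reach (gstart (compile p)) s q s' & gnext q (view_of s') = None.
Proof.
have skip (g : graph) (q q' : gstate g) s1 :
    gnext q (view_of s1) = Some (Skip, q') -> reach q s1 q' s1.
  by move=> e; apply: ReachStep e _ _ => //; case: s1 => *; apply: ReachRefl.
elim=> {p s s'} /=.
- move=> a s sf; exists false => //.
  by apply: (@ReachStep (compile (Prim a)) true _ a false) => //; apply: ReachRefl.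
- move=> p q s1 s2 s3 _ [q1 r1 h1] _ [q2 r2 h2].
  exists (inr q2 : gstate (compile (Seq p q))) => /=; last by rewrite h2.
  have R1 := @reach_lift _ (compile (Seq p q)) inl.
  have R2 := @reach_lift _ (compile (Seq p q)) inr.
  apply: (reach_trans (R1 _ _ _ _ _ r1)) => [q' v x /= -> //|].
  apply: (@reach_trans _ _ (inr (gstart (compile q)) : gstate (compile (Seq p q)))).
    by apply: skip; rewrite /= h1.
  by apply: R2 r2 => q' v x /= ->.
- move=> c p q s1 s2; case e: (c _) => _ [q1 r1 h1].
    exists (Some (inl q1) : gstate (compile (If c p q))); last by rewrite /= h1.
    apply: (@reach_trans _ _ (Some (inl (gstart (compile p))) : gstate (compile (If c p q)))).
      by apply: skip; rewrite /= e.
    by apply: (@reach_lift _ (compile (If c p q)) (Some \o inl)) r1 => q' v x /= ->.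
  exists (Some (inr q1) : gstate (compile (If c p q))); last by rewrite /= h1.
  apply: (@reach_trans _ _ (Some (inr (gstart (compile q))) : gstate (compile (If c p q)))).
    by apply: skip; rewrite /= e.
  by apply: (@reach_lift _ (compile (If c p q)) (Some \o inr)) r1 => q' v x /= ->.
- move=> c p s nc; exists None; last by rewrite /= (negbTE nc).
  exact: ReachRefl.
- move=> c p s1 s2 s3 cs _ [q1 r1 h1] _ [q2 r2 h2]; exists q2 => //.
  apply: (@reach_trans (compile (While c p)) _ (Some (gstart (compile p)))).
    by apply: skip; rewrite /= cs.
  apply: reach_trans (r2).
  apply: (@reach_trans (compile (While c p)) _ (Some q1) _ _ s2).
    by apply: (@reach_lift _ (compile (While c p)) Some) r1 => q' v x /= ->.
  by apply: skip; rewrite /= h1.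
Qed.

(** * Compilation to Turing machines *)

Section TuringMachine.
Variables (nreg : nat) (g : graph).

(* Cell 0 of every stack tape holds [mark] and the head scans the top of the
   stack. The address tape cannot be marked, because addresses are read from its
   cell 0: its head stays on the first free cell and its digits are deleted
   blindly. *)
Definition tcell : Type := cell A (option Sg).
Definition mark : tcell := Some (inr None).
Definition scell (x : Sg) : tcell := Some (inr (Some x)).
Definition dcell (b : bool) : tcell := Some (inl (bitsym b)).
Definition stack_sym (c : tcell) : option Sg :=
  if c is Some (inr (Some x)) then Some x else None.

(* [None] is the initial state, [Some (inl q)] a state of the graph; in
   [Some (inr (q, w))] the machine finishes a push, if [w] is the register and
   the symbol, or the deletion of an address digit, before entering [q]. *)
Definition tstate : finType :=
  option (gstate g + gstate g * option ('I_nreg * Sg)).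

Definition tview (i : option (sym A)) (c : {ffun 'I_nreg.+1 -> tcell}) : view :=
  (i, [seq stack_sym (c (lift ord0 r)) | r <- enum 'I_nreg]).

Definition tape_act : Type := (nat * (tcell -> tcell) * (tcell -> move))%type.

Definition idle : tape_act := (0, id, fun=> MoveS).

Definition act_on (c : {ffun 'I_nreg.+1 -> tcell}) (t : tape_act) :
    {ffun 'I_nreg.+1 -> tcell * move} :=
  [ffun i => if nat_of_ord i == t.1.1 then (t.1.2 (c i), t.2 (c i))
             else (c i, MoveS)].

(** Since the head scans the top of the stack, a push first moves right and writes in the following
    step. [insub] bounds the register number, as a finite type of states requires; its failure is
    excluded by [prim_safe]. *)
Definition do_act (r : nat) (o : op) (q : gstate g) : tstate * tape_act :=
  match o with
  | Keep => (Some (inl q), idle)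
  | Pop => (Some (inl q), (r.+1, fun c => if stack_sym c then None else c,
             fun c => if stack_sym c then MoveL else MoveS))
  | Subst x => (Some (inl q), (r.+1,
             fun c => if stack_sym c then scell x else c, fun=> MoveS))
  | Push x => (Some (if insub r is Some r' then inr (q, Some (r', x)) else inl q),
             (r.+1, id, fun=> MoveR))
  end.

Definition prim_act (a : prim) (v : view) (q : gstate g) :
    tstate * tape_act * input_move * option (sym A) :=
  match a with
  | Skip => (Some (inl q), idle, Walk MoveS, None)
  | Do r f => (do_act r (f v) q, Walk MoveS, None)
  | Advance => (Some (inl q), idle, Walk MoveR, None)
  | Seek => (Some (inl q), idle, Jump, None)
  | AddrPush f =>
      (Some (inl q), (0, fun=> dcell (f v), fun=> MoveR), Walk MoveS, None)
  | AddrPop => (Some (inr (q, None)), (0, id, fun=> MoveL), Walk MoveS, None)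
  | Emit f => (Some (inl q), idle, Walk MoveS, Some (f v))
  end.

Definition tdelta (s : tstate) (i : option (sym A))
    (c : {ffun 'I_nreg.+1 -> tcell}) :
    option (tstate * {ffun 'I_nreg.+1 -> tcell * move} * input_move *
            option (sym A)) :=
  match s with
  | None => Some (Some (inl (gstart g)),
              [ffun k : 'I_nreg.+1 => (if nat_of_ord k == 0 then None else mark, MoveS)],
              Walk MoveS, None)
  | Some (inr (q, w)) =>
      Some (Some (inl q),
        act_on c (if w is Some (r, x) then (r.+1, fun=> scell x, fun=> MoveS)
                  else (0, fun=> None, fun=> MoveS)), Walk MoveS, None)
  | Some (inl q) =>
      omap (fun x : prim * gstate g =>
        let: (s', t, m, o) := prim_act x.1 (tview i c) x.2 in
        (s', act_on c t, m, o)) (gnext q (tview i c))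
  end.

Definition tmachine : machine A :=
  @Machine A tstate (option Sg) nreg None tdelta.

End TuringMachine.
End StackPrograms.

(** * Updates of the register file *)

Section Put.
Variable T : Type.
Implicit Types (R : seq (seq T)) (s : seq T).

Lemma size_put R r s : size (put R r s) = size R.
Proof. by elim: R r => [|x R IH] [|r] //=; rewrite IH. Qed.

Lemma nth_put R r s r' : r < size R ->
  nth [::] (put R r s) r' = if r' == r then s else nth [::] R r'.
Proof. by elim: R r r' => [|x R IH] [|r] [|r'] //= /IH ->. Qed.

Lemma put_put R r s s' : put (put R r s) r s' = put R r s'.
Proof. by elim: R r => [|x R IH] [|r] //=; rewrite IH. Qed.

Lemma put_id R r : put R r (nth [::] R r) = R.
Proof. by elim: R r => [|x R IH] [|r] //=; rewrite IH. Qed.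

Lemma putC R r r' s s' :
  r != r' -> put (put R r s) r' s' = put (put R r' s') r s.
Proof.
by elim: R r r' => [|x R IH] [|r] [|r'] //= rr; rewrite IH.
Qed.

End Put.

(** * Runs under a space bound *)

Section BoundedRuns.
Variables (A : finType) (M : machine A) (blocks args : seq (seq (sym A))).
Variable bound : nat.

Inductive bsteps : config M -> config M -> Prop :=
  | BRefl c : space c <= bound -> bsteps c c
  | BStep c c1 c2 : space c <= bound -> step blocks c = Some c1 ->
      bsteps c1 c2 -> bsteps c c2.

Lemma bsteps_trans c1 c2 c3 : bsteps c1 c2 -> bsteps c2 c3 -> bsteps c1 c3.
Proof. by elim=> // c c' c'' b e _ IH /IH; apply: BStep. Qed.

(** A halted configuration is a fixed point of [run], so the bound along the finite path covers
    every later [n]. *)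
Lemma bsteps_run c c' : bsteps c c' -> step blocks c' = None ->
  (exists n, run blocks n c = c') /\ forall n, space (run blocks n c) <= bound.
Proof.
elim=> {c c'} [c b e|c c1 c2 b e _ IH /IH [[n <-] sp]].
  by split=> [|n]; [exists 0|case: n => //= n; rewrite e].
by split=> [|[|k] //=]; [exists n.+1; rewrite /= e|rewrite e].
Qed.

Lemma bsteps_halts c' :
  bsteps (init_config M args) c' -> step blocks c' = None ->
  space_within M blocks args bound /\
  exists n, halts_with M blocks args (cf_output c') n.
Proof.
move=> b e; have [[n rn] sp] := bsteps_run b e; split=> //.
by exists n; rewrite /halts_with rn.
Qed.

End BoundedRuns.

(** * Invariant between program states and tape contents *)

Section MachineCorrect.
Variables (A Sg : finType) (nreg : nat) (g : graph A Sg).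
Variables (blocks : seq (seq (sym A))) (B : nat).

Notation TM := (tmachine nreg g).
Notation tp_t := (tape A (option Sg)).

(** Contents are compared cell by cell with blank as default, because popping leaves blanks in the
    stored prefix; the length of that prefix counts as space and is bounded separately. [B.+2]
    covers [B] symbols, the bottom mark and the head position. *)
Definition tape_stack (s : seq Sg) (tp : tp_t) :=
  [/\ size s <= B,
      forall i, nth None tp.1 i = nth None (mark A Sg :: rev (map (@scell A Sg) s)) i,
      tp.2 = size s & size tp.1 <= B.+2].

Definition tape_addr (a : seq bool) (tp : tp_t) :=
  [/\ size a <= B,
      forall i, nth None tp.1 i = nth None (map (@dcell A Sg) a) i,
      tp.2 = size a & size tp.1 <= B.+2].

Lemma scanned_stack s tp : tape_stack s tp ->
  scanned tp = if s is x :: _ then @scell A Sg x else mark A Sg.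
Proof.
case=> _ e h _; rewrite /scanned e h; case: s {e h} => //= x s.
by rewrite rev_cons nth_rcons size_rev size_map ltnn eqxx.
Qed.

Lemma keep_stack s tp : tape_stack s tp ->
  tape_stack s (tape_step tp (scanned tp, MoveS)).
Proof.
move=> ts; have sc := scanned_stack ts; case: ts => sB e h b; split=> //=; last first.
  by rewrite size_set_nth h; lia.
move=> i; rewrite nth_set_nth /=; case: eqP => // ->.
by rewrite /scanned e.
Qed.

(** An untouched tape is still rewritten at every step; here the blank under the head is written
    back, which may lengthen the stored prefix. *)
Lemma keep_addr a tp : tape_addr a tp ->
  tape_addr a (tape_step tp (scanned tp, MoveS)).
Proof.
case=> sB e h b; split=> //=; last by rewrite size_set_nth h; lia.
move=> i; rewrite nth_set_nth /=; case: eqP => // ->.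
by rewrite /scanned e.
Qed.

Lemma nth_rev_scell (x : Sg) s i :
  nth None (mark A Sg :: rev (map (@scell A Sg) (x :: s))) i =
  if i == (size s).+1 then scell A x
  else nth None (mark A Sg :: rev (map (@scell A Sg) s)) i.
Proof.
case: i => //= i; rewrite rev_cons nth_rcons size_rev size_map eqSS.
case: ltngtP => // si; last by rewrite nth_default // size_rev size_map; lia.
Qed.

Lemma pop_stack s tp : tape_stack s tp ->
  tape_stack (behead s)
    (tape_step tp (if stack_sym (scanned tp) then None else scanned tp,
                   if stack_sym (scanned tp) then MoveL else MoveS)).
Proof.
move=> ts; have := keep_stack ts; rewrite (scanned_stack ts).
case: s ts => //= x s [/= sB e h b] _; split=> //=; last by rewrite size_set_nth h /=; lia.
- by rewrite /= in sB; lia.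
- move=> i; rewrite nth_set_nth /= h /=; case: eqP => [->|ne].
    by rewrite nth_default //= size_rev size_map.
  by rewrite e nth_rev_scell; case: eqP.
- by rewrite h.
Qed.

Lemma subst_stack s tp y : tape_stack s tp ->
  tape_stack (apply_op (Subst y) s)
    (tape_step tp (if stack_sym (scanned tp) then scell A y else scanned tp, MoveS)).
Proof.
move=> ts; have := keep_stack ts; rewrite (scanned_stack ts).
case: s ts => //= x s [/= sB e h b] _; split=> //=; last by rewrite size_set_nth h /=; lia.
move=> i; rewrite nth_set_nth /= h /= e !nth_rev_scell; case: eqP => // _.
Qed.

Lemma push_stack s tp y : tape_stack s tp -> size s < B ->
  tape_stack (y :: s) (tape_step (tape_step tp (scanned tp, MoveR)) (scell A y, MoveS)).
Proof.
move=> ts sB; case: (keep_stack ts) => /= _ e h b; split=> //=; last first.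
- by rewrite size_set_nth h; move: b; rewrite h; lia.
- by rewrite h.
- by move=> i; rewrite nth_set_nth nth_rev_scell /= {1}h; case: eqP => // _; rewrite -e.
Qed.

Lemma push_addr a tp x : tape_addr a tp -> size a < B ->
  tape_addr (rcons a x) (tape_step tp (dcell A Sg x, MoveR)).
Proof.
case=> _ e h b sB; split=> /=; rewrite ?size_rcons ?h //; last first.
  by rewrite size_set_nth; lia.
move=> i; rewrite nth_set_nth /= map_rcons nth_rcons size_map e.
case: ltngtP => // si; rewrite nth_default // size_map; lia.
Qed.

(** Deleting from an empty address is harmless: the head stays on cell 0, which is already blank. *)
Lemma pop_addr a tp : tape_addr a tp ->
  tape_addr (take (size a).-1 a)
    (tape_step (tape_step tp (scanned tp, MoveL)) (None, MoveS)).
Proof.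
move=> ta; case: (keep_addr ta) => /= sB e h b.
have sz : size (take (size a).-1 a) = (size a).-1 by rewrite size_take; case: ltnP; lia.
split=> /=; rewrite ?sz ?h //; first lia; last by rewrite size_set_nth; move: b; rewrite h; lia.
rewrite h in e.
move=> i; rewrite nth_set_nth /= e; case: eqP => [->|ne].
  by rewrite nth_default // size_map sz.
rewrite map_take; have [il|il] := ltnP i (size a).-1; first by rewrite nth_take.
rewrite nth_default ?size_map; last lia.
by rewrite nth_default // size_take size_map; case: ltnP; lia.
Qed.

Lemma address_num a tp : tape_addr a tp -> address tp.1 = num a.
Proof.
case=> _ + _ _; elim: tp.1 a => [|x s IH] [|b a] // e; first by have /= := e 0.
  by have /= -> := e 0.
have /= := e 0 => ->; rewrite /= (IH a) // => i; exact: (e i.+1).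
Qed.

Definition represents (s : state A Sg) (c : config TM) :=
  [/\ size (regs s) = nreg,
      forall r : 'I_nreg, tape_stack (nth [::] (regs s) r) (cf_tapes c (lift ord0 r)),
      tape_addr (addr s) (cf_tapes c ord0),
      cf_input c <= size (flatten blocks) /\
      inp s = drop (cf_input c) (flatten blocks)
    & cf_output c = outp s].

Definition space_bound := nreg.+1 * B.+2.

Lemma space_fits (c : config TM) :
  (forall i, tape_cells (cf_tapes c i) <= B.+2) -> space c <= space_bound.
Proof.
move=> f; rewrite /space /space_bound -[X in X * _]card_ord -sum_nat_const.
by apply: leq_sum => i _; apply: f.
Qed.

Lemma stack_fits s tp : tape_stack s tp -> tape_cells tp <= B.+2.
Proof. by case=> sB _ h b; rewrite /tape_cells h; lia. Qed.

Lemma addr_fits a tp : tape_addr a tp -> tape_cells tp <= B.+2.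
Proof. by case=> sB _ h b; rewrite /tape_cells h; lia. Qed.

Lemma represents_space s c : represents s c -> space c <= space_bound.
Proof.
case=> _ ts ta _ _; apply: space_fits => i.
by case: (unliftP ord0 i) => [r|] ->; [apply: stack_fits (ts r)|apply: addr_fits ta].
Qed.

Lemma tview_represents s c : represents s c ->
  tview (onth (flatten blocks) (cf_input c)) [ffun i => scanned (cf_tapes c i)] =
  view_of s.
Proof.
case=> sz ts _ [_ ei] _; rewrite /tview /view_of ei; congr (_, _).
  by elim: (flatten blocks) (cf_input c) => [|x l IH] [|n] //=.
have se : size [seq stack_sym ([ffun i => scanned (cf_tapes c i)] (lift ord0 r)) | r <- enum
    'I_nreg] = nreg.
  by rewrite size_map size_enum_ord.
apply: (@eq_from_nth _ None); rewrite se ?size_map ?sz // => i il.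
rewrite (nth_map (Ordinal il)) ?size_enum_ord // (nth_map [::]) ?sz //.
rewrite ffunE (nth_ord_enum (Ordinal il) (Ordinal il)) (scanned_stack (ts (Ordinal il))) /=.
by case: nth.
Qed.

Definition tapes_upd (tps : {ffun 'I_nreg.+1 -> tp_t}) (t : tape_act A Sg) :=
  [ffun i => tape_step (tps i) (act_on [ffun i => scanned (tps i)] t i)].

Lemma tapes_updE tps t i : tapes_upd tps t i =
  tape_step (tps i) (if nat_of_ord i == t.1.1
    then (t.1.2 (scanned (tps i)), t.2 (scanned (tps i))) else (scanned (tps i), MoveS)).
Proof. by rewrite !ffunE. Qed.

Lemma tapes_upd_idle tps : tapes_upd tps (idle A Sg) =
  [ffun i => tape_step (tps i) (scanned (tps i), MoveS)].
Proof. by apply/ffunP => i; rewrite tapes_updE ffunE /=; case: ifP. Qed.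

Lemma represents_idle s c : represents s c ->
  (forall r : 'I_nreg,
     tape_stack (nth [::] (regs s) r) (tapes_upd (cf_tapes c) (idle A Sg) (lift ord0 r)))
  /\ tape_addr (addr s) (tapes_upd (cf_tapes c) (idle A Sg) ord0).
Proof.
case=> _ ts ta _ _; rewrite tapes_upd_idle; split=> [r|]; rewrite ffunE.
  exact: keep_stack.
exact: keep_addr.
Qed.

Lemma step_finish (c : config TM) q w :
  cf_state c = Some (inr (q, w)) -> cf_input c <= size (flatten blocks) ->
  step blocks c = Some (@Config _ TM (Some (inl q)) (cf_input c)
    (tapes_upd (cf_tapes c) (if w is Some (r, x) then (r.+1, fun=> scell A x, fun=> MoveS)
                  else (0, fun=> None, fun=> MoveS))) (cf_output c)).
Proof.
by move=> e le; rewrite /step e /= (minn_idPl le).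
Qed.

Lemma step_graph s (c : config TM) q a q' :
  represents s c -> cf_state c = Some (inl q) -> gnext q (view_of s) = Some (a, q') ->
  let: (s', t, m, o) := prim_act nreg a (view_of s) q' in
  step blocks c = Some (@Config _ TM s' (input_head blocks (cf_tapes c ord0).1 m (cf_input c))
     (tapes_upd (cf_tapes c) t) (if o is Some x then rcons (cf_output c) x else cf_output c)).
Proof.
move=> rp e n; rewrite /step e /= (tview_represents rp) n /=.
by case: prim_act => [[[s' t] m] o].
Qed.

(** Meant for the configuration between the two steps of a push, which represents no program state:
    the tape acted on is bounded separately, the others as idle tapes. *)
Lemma upd_fits (c : config TM) (s : state A Sg) t : represents s c ->
  t.1.1 != 0 -> (forall r : 'I_nreg, t.1.1 = r.+1 ->
     tape_cells (tapes_upd (cf_tapes c) t (lift ord0 r)) <= B.+2) ->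
  forall i, tape_cells (tapes_upd (cf_tapes c) t i) <= B.+2.
Proof.
case=> _ ts ta _ _ t0 tr i; case: (unliftP ord0 i) => [r|] -> {i}.
  have [e|ne] := eqVneq t.1.1 r.+1; first exact: tr.
  rewrite tapes_updE lift0 eq_sym (negbTE ne).
  exact: stack_fits (keep_stack (ts r)).
by rewrite tapes_updE eq_sym (negbTE t0); apply: addr_fits (keep_addr ta).
Qed.

(** A primitive takes one machine step, except that a push on a register and the deletion of an
    address digit take two. *)
Lemma step_correct s (c : config TM) q a q' :
  represents s c -> cf_state c = Some (inl q) ->
  gnext q (view_of s) = Some (a, q') -> prim_safe B a s ->
  exists2 c', represents (prim_sem blocks a s) c' /\ cf_state c' = Some (inl q')
    & bsteps blocks space_bound c c'.
Proof.
move=> rp e n sf; have st := step_graph rp e n.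
have [ids ida] := represents_idle rp.
have sp := represents_space rp.
have one c' : step blocks c = Some c' -> represents (prim_sem blocks a s) c' ->
    bsteps blocks space_bound c c'.
  move=> e1 r1; apply: BStep sp e1 _; apply: BRefl.
  exact: represents_space r1.
have [sz ts ta [il ei] eo] := rp.
case: s rp n sf st ids ida one sz ts ta ei eo => i R ad o rp n sf st ids ida one sz ts ta ei eo.
case: a n sf st one => [|r f|||f||f] n sf st one; rewrite /= in sz ts ta ei eo sf ids ida.
- eexists; last (apply: one; first exact: st).
    by split=> //; split=> //=; rewrite ?(minn_idPl il).
  by split=> //=; rewrite ?(minn_idPl il).
- case/andP: sf => rR fB; rewrite sz in rR.
  set v := view_of _ in n st fB *.
  have mk c' snew : step blocks c = Some c' -> cf_input c' = cf_input c ->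
      cf_output c' = cf_output c -> snew = apply_op (f v) (nth [::] R r) ->
      (forall r' : 'I_nreg, tape_stack (if r' == r :> nat then snew else nth [::] R r')
        (cf_tapes c' (lift ord0 r'))) ->
      tape_addr ad (cf_tapes c' ord0) ->
      represents (prim_sem blocks (Do r f) (State i R ad o)) c'.
    move=> _ e2 e3 -> e4 e5; split=> //=; rewrite ?e2 ?e3 //; first by rewrite size_put.
    by move=> r'; rewrite nth_put ?sz.
  rewrite /= -/v in st; case ef: (f v) st => [||x|x] /= st.
  + rewrite (minn_idPl il) in st; set c1 := Config _ _ _ _ in st.
    have rp2 := mk c1 (nth [::] R r) st.
    suff rp3 : represents (prim_sem blocks (Do r f) (State i R ad o)) c1.
      by exists c1 => //; apply: one st rp3.
    by apply: rp2; rewrite ?ef //= => r'; case: eqP => // <-; exact: ids.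
  + rewrite (minn_idPl il) in st; set c1 := Config _ _ _ _ in st.
    have rp2 := mk c1 (behead (nth [::] R r)) st.
    suff rp3 : represents (prim_sem blocks (Do r f) (State i R ad o)) c1.
      by exists c1 => //; apply: one st rp3.
    apply: rp2 => //=; [by rewrite ef|move=> r'|by rewrite tapes_updE /=; apply: keep_addr].
    rewrite tapes_updE lift0 /= eqSS; case: eqP => [<-|_].
      exact: pop_stack.
    exact: keep_stack.
  + rewrite ef in fB; case: insubP st => [r' _ er st|]; last by rewrite rR.
    set c1 := Config _ _ _ _ in st.
    have e1 := @step_finish c1 q' (Some (r', x)) erefl.
    rewrite {1}/c1 /= (minn_idPl il) in e1; have {}e1 := e1 il.
    (* Halfway through the push the head is already above the top of the stack; safety makes the
       stack shorter than [B], so this still fits. *)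
    have fit1 : space c1 <= space_bound.
      apply: space_fits => j; apply: (upd_fits rp) => //= r'' [err].
      rewrite tapes_updE lift0 /= err eqxx.
      have [/= _ _ hh bb] := keep_stack (ts r'').
      by rewrite err in fB; move: bb; rewrite /tape_cells /= hh; lia.
    suff rp2 : represents (prim_sem blocks (Do r f) (State i R ad o))
       (@Config _ TM (Some (inl q')) (cf_input c)
          (tapes_upd (tapes_upd (cf_tapes c) (r.+1, id, fun=> MoveR)) (r'.+1, fun=> scell A
              x, fun=> MoveS)) (cf_output c)).
      eexists; first by split; first exact: rp2.
      apply: BStep sp st _; apply: BStep fit1 e1 _; apply: BRefl.
      exact: represents_space rp2.
    split=> //=; first by rewrite size_put.
      move=> r''; rewrite -/v ef nth_put ?sz // tapes_updE tapes_updE lift0 /= er eqSS.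
      case: eqP => [err|_]; last by apply: keep_stack; apply: keep_stack.
      by rewrite -err in fB *; apply: push_stack.
    rewrite tapes_updE tapes_updE /=; by apply: keep_addr; apply: keep_addr.
  + rewrite (minn_idPl il) in st; set c1 := Config _ _ _ _ in st.
    have rp2 := mk c1 (apply_op (Subst x) (nth [::] R r)) st.
    suff rp3 : represents (prim_sem blocks (Do r f) (State i R ad o)) c1.
      by exists c1 => //; apply: one st rp3.
    apply: rp2 => //=; [by rewrite ef|move=> r'|by rewrite tapes_updE /=; apply: keep_addr].
    rewrite tapes_updE lift0 /= eqSS; case: eqP => [<-|_].
      exact: subst_stack.
    exact: keep_stack.
- have rp2 : represents (prim_sem blocks (Advance A Sg) (State i R ad o))
     (@Config _ TM (Some (inl q')) (minn (cf_input c).+1 (size (flatten blocks)))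
         (tapes_upd (cf_tapes c) (idle A Sg)) (cf_output c)).
    split=> //=; split; first lia.
    rewrite ei; case: (leqP (cf_input c).+1 (size (flatten blocks))) => l.
      by rewrite (drop_nth None l).
    rewrite !drop_oversize //; lia.
  by eexists; last (apply: one; first exact: st); first split; first exact: rp2.
- have rp2 : represents (prim_sem blocks (Seek A Sg) (State i R ad o))
     (@Config _ TM (Some (inl q')) (size (flatten (take (address (cf_tapes c ord0).1) blocks)))
         (tapes_upd (cf_tapes c) (idle A Sg)) (cf_output c)).
    rewrite (address_num ta).
    have E : flatten blocks = flatten (take (num ad) blocks) ++ flatten (drop (num ad) blocks).
      by rewrite -flatten_cat cat_take_drop.
    by split=> //=; split; rewrite E ?size_cat ?leq_addr ?drop_size_cat.
  by eexists; last (apply: one; first exact: st); first split; first exact: rp2.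
- have rp2 : represents (prim_sem blocks (AddrPush f) (State i R ad o))
     (@Config _ TM (Some (inl q')) (cf_input c)
         (tapes_upd (cf_tapes c) (0, fun=> dcell A Sg (f (view_of (State i R ad o))), fun=>
             MoveR)) (cf_output c)).
    split=> //= [r|]; rewrite tapes_updE ?lift0 /=; first exact: keep_stack.
    exact: push_addr.
  rewrite /= (minn_idPl il) in st.
  by eexists; [split; [exact: rp2|]|apply: one st rp2].
- rewrite /= in st; set c1 := Config _ _ _ _ in st.
  have e1 := @step_finish c1 q' None erefl.
  rewrite {1}/c1 /= (minn_idPl il) in e1; have {}e1 := e1 il.
  have fit1 : space c1 <= space_bound.
    apply: space_fits => j; rewrite /= tapes_updE; case: (unliftP ord0 j) => [r|] ->.
      exact: stack_fits (keep_stack (ts r)).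
    have [/= aB _ hh bb] := keep_addr ta.
    by rewrite /tape_cells /= hh; rewrite hh in bb; lia.
  have rp2 : represents (prim_sem blocks (AddrPop A Sg) (State i R ad o))
     (@Config _ TM (Some (inl q')) (cf_input c)
        (tapes_upd (tapes_upd (cf_tapes c) (0, id, fun=> MoveL)) (0, fun=> None, fun=>
            MoveS)) (cf_output c)).
    split=> //= [r|]; rewrite 2!tapes_updE ?lift0 /=; last exact: pop_addr.
    by apply: keep_stack; apply: keep_stack.
  eexists; first by split; first exact: rp2.
  apply: BStep sp st _; apply: BStep fit1 e1 _; apply: BRefl.
  exact: represents_space rp2.
- have rp2 : represents (prim_sem blocks (Emit f) (State i R ad o))
     (@Config _ TM (Some (inl q')) (cf_input c)
         (tapes_upd (cf_tapes c) (idle A Sg)) (rcons (cf_output c) (f (view_of (State i R ad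
             o))))).
    by split=> //=; rewrite eo.
  rewrite /= (minn_idPl il) in st.
  by eexists; [split; [exact: rp2|]|apply: one st rp2].
Qed.

Lemma reach_correct s (c : config TM) q s' q' :
  reach blocks B q s q' s' -> represents s c -> cf_state c = Some (inl q) ->
  exists2 c', represents s' c' /\ cf_state c' = Some (inl q')
    & bsteps blocks space_bound c c'.
Proof.
move=> r; elim: r c => {q s q' s'} [q s c rp e|q s a q1 q2 s2 n sf _ IH c rp e].
  by exists c => //; apply: BRefl; apply: represents_space rp.
have [c1 [rp1 e1] b1] := step_correct rp e n sf.
have [c2 h2 b2] := IH _ rp1 e1.
by exists c2 => //; apply: bsteps_trans b1 b2.
Qed.

End MachineCorrect.

(** The first machine step writes the bottom marks; from then on the machine follows the compiled
    graph, and halts in a graph state without successor. *)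
Theorem tmachine_exec (A Sg : finType) (nreg : nat) (blocks : seq (seq (sym A)))
    (B : nat) (p : prog A Sg) (s' : state A Sg) :
  exec blocks B p (State (flatten blocks) (nseq nreg [::]) [::] [::]) s' ->
  space_within (tmachine nreg (compile p)) blocks [::] (nreg.+1 * B.+2) /\
  exists n, halts_with (tmachine nreg (compile p)) blocks [::] (outp s') n.
Proof.
move=> ex; have [q rq nq] := compileP ex.
set TM := tmachine _ _; pose c0 := init_config TM [::].
have e0 : exists2 c1, step blocks c0 = Some c1 &
    represents blocks B (State (flatten blocks) (nseq nreg [::]) [::] [::]) c1 /\
    cf_state c1 = Some (inl (gstart (compile p))).
  eexists; first by [].
  split=> //; split; rewrite /= ?size_nseq ?min0n ?drop0 //.
    by move=> r; rewrite !ffunE nth_nseq if_same; split; rewrite ?nth_nil // => -[|[|k]].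
  by rewrite !ffunE /=; split; rewrite ?nth_nil // => -[|[|k]].
have [c1 s1 [rp1 q1]] := e0.
have [c2 [rp2 q2] b2] := reach_correct rq rp1 q1.
have b : bsteps blocks (space_bound nreg B) c0 c2.
  apply: BStep s1 b2; apply: space_fits => i; rewrite ffunE.
  by rewrite nth_nil.
have h2 : step blocks c2 = None.
  by rewrite /step q2 /= (tview_represents rp2) nq.
have [_ _ _ _ <-] := rp2.
exact: bsteps_halts b h2.
Qed.

(** * Elementary programs *)

Fixpoint incr (s : seq bool) : seq bool :=
  match s with
  | [::] => [:: true]
  | true :: s' => false :: incr s'
  | false :: s' => true :: s'
  end.

Lemma size_incr s : size (incr s) <= (size s).+1.
Proof. by elim: s => [|[] s IH]. Qed.

Section Macros.
Variables (A Sg : finType) (sy : sym A -> Sg) (us : Sg -> sym A).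
Hypothesis syK : cancel sy us.

Notation prog := (prog A Sg).
Notation view := (view A Sg).

Definition top (v : view) (r : nat) : option Sg := nth None v.2 r.
Definition filled (r : nat) (v : view) : bool := top v r.
Definition in_word (v : view) : bool := if v.1 is Some (Some _) then true else false.

Definition pop r : prog := Prim (Do r (fun=> Pop Sg)).
Definition push r x : prog := Prim (Do r (fun=> Push x)).
Definition push_top (g : Sg -> Sg) a b : prog :=
  Prim (Do b (fun v => if top v a is Some x then Push (g x) else Keep Sg)).
Definition advance : prog := Prim (Advance A Sg).

Definition clear r : prog := While (filled r) (pop r).
(** Each pass reverses the word; [copy] and [relay] go through a scratch register so that two passes
    restore the order. *)
Definition transfer g a b : prog :=
  While (filled a) (Seq (push_top g a b) (pop a)).
Definition fork a b c : prog :=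
  While (filled a) (Seq (push_top id a b) (Seq (push_top id a c) (pop a))).
Definition copy a b t : prog := Seq (transfer id a t) (fork t a b).
Definition relay a b t : prog := Seq (transfer id a t) (transfer id t b).

Definition flag : Sg := sy sep.

(** The flag is popped at the first mismatch, later pops finding [f] empty; symbols left on [b]
    reveal that it held the longer word. *)
Definition eq_clear a b f : prog :=
  Seq (push f flag)
  (Seq (While (filled a)
     (Seq (Prim (Do f (fun v => if top v a == top v b then Keep Sg else Pop Sg)))
     (Seq (pop a) (pop b))))
  (Seq (Prim (Do f (fun v => if filled b v then Pop Sg else Keep Sg)))
  (clear b))).

Definition scan_word t : prog :=
  Seq (While in_word
    (Seq (Prim (Do t (fun v => if v.1 is Some x then Push (sy x) else Keep Sg)))
         advance))
  advance.
Definition read_word d t : prog := Seq (scan_word t) (transfer id t d).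
Definition skip_word : prog := Seq (While in_word advance) advance.

Definition bsy (b : bool) : Sg := sy (bitsym b).

(** The low-order ones become zeros parked on [t]; then the first zero, or a fresh digit past the
    end, becomes a one. *)
Definition increment r t : prog :=
  Seq (While (fun v => top v r == Some (bsy true))
         (Seq (push t (bsy false)) (pop r)))
  (Seq (Prim (Do r (fun v => if filled r v then Subst (bsy true)
                             else Push (bsy true))))
  (transfer id t r)).

(** [AddrPush] appends, so the digits arrive least significant first. [t2] receives one symbol per
    digit and so tells how many to delete afterwards. *)
Definition seek r t1 t2 : prog :=
  Seq (copy r t1 t2)
  (Seq (While (filled t1)
    (Seq (Prim (AddrPush (fun v => top v t1 == Some (bsy true))))
         (Seq (push_top id t1 t2) (pop t1))))
  (Seq (Prim (Seek A Sg))
  (While (filled t2) (Seq (Prim (AddrPop A Sg)) (pop t2))))).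

Definition emit r t1 t2 : prog :=
  Seq (copy r t1 t2)
  (Seq (While (filled t1)
    (Seq (Prim (Emit (fun v => if top v t1 is Some x then us x else sep)))
         (pop t1)))
  (Prim (Emit (fun=> sep)))).

Variables (blocks : seq (seq (sym A))) (B : nat).
Notation exec := (@exec A Sg blocks B).
Implicit Types (R : seq (seq Sg)) (i o : seq (sym A)) (ad : seq bool).

Lemma top_view i R ad o r :
  top (view_of (State i R ad o)) r = ohead (nth [::] R r).
Proof. by rewrite /top /view_of /=; elim: R r => [|x R IH] [|r] //=. Qed.

Lemma filled_view i R ad o r :
  filled r (view_of (State i R ad o)) = ~~ nilp (nth [::] R r).
Proof. by rewrite /filled top_view; case: nth. Qed.

Lemma exec_eq p s s1 s2 : exec p s s1 -> s1 = s2 -> exec p s s2.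
Proof. by move=> ? <-. Qed.

Lemma popP i R ad o r : r < size R ->
  exec (pop r) (State i R ad o) (State i (put R r (behead (nth [::] R r))) ad o).
Proof. by move=> rR; apply: ExecPrim; rewrite /= rR. Qed.

Lemma pushP i R ad o r x : r < size R -> size (nth [::] R r) < B ->
  exec (push r x) (State i R ad o) (State i (put R r (x :: nth [::] R r)) ad o).
Proof. by move=> rR sB; apply: ExecPrim; rewrite /= rR. Qed.

Lemma doP i R ad o r f : r < size R ->
  (if f (view_of (State i R ad o)) is Push _ then size (nth [::] R r) < B else true) ->
  exec (Prim (Do r f)) (State i R ad o)
    (State i (put R r (apply_op (f (view_of (State i R ad o))) (nth [::] R r))) ad o).
Proof. by move=> rR sB; apply: ExecPrim; rewrite /= rR. Qed.

Lemma push_topP i R ad o g a b x s : b < size R -> nth [::] R a = x :: s ->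
  size (nth [::] R b) < B ->
  exec (push_top g a b) (State i R ad o) (State i (put R b (g x :: nth [::] R b)) ad o).
Proof.
move=> bR e sB; by apply: exec_eq; [apply: doP => //; rewrite top_view e|rewrite /= top_view e].
Qed.

Lemma clearP i R ad o r : r < size R ->
  exec (clear r) (State i R ad o) (State i (put R r [::]) ad o).
Proof.
move=> rR; move e: (nth [::] R r) => s; elim: s R rR e => [|x s IH] R rR e.
  by rewrite -[in State i (put _ _ _)]e put_id; apply: ExecDone; rewrite filled_view e.
apply: ExecLoop; first by rewrite filled_view e.
  exact: popP.
by apply: exec_eq; first apply: IH; rewrite ?size_put ?nth_put ?eqxx ?e ?put_put.
Qed.

Lemma transferP g a b i R ad o : a != b -> a < size R -> b < size R ->
  size (nth [::] R a) + size (nth [::] R b) <= B ->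
  exec (transfer g a b) (State i R ad o)
    (State i (put (put R b (rev (map g (nth [::] R a)) ++ nth [::] R b)) a [::]) ad o).
Proof.
move=> ab aR bR; move e: (nth [::] R a) => s.
elim: s R aR bR e => [|x s IH] R aR bR e sB.
  rewrite /= put_id -[in State i (put _ _ _)]e put_id.
  by apply: ExecDone; rewrite filled_view e.
rewrite /= in sB; apply: ExecLoop; first by rewrite filled_view e.
  apply: ExecSeq; first by apply: push_topP e _ => //; lia.
  by apply: popP; rewrite size_put.
have ba : b != a by rewrite eq_sym.
apply: exec_eq; first apply: IH; rewrite ?size_put ?nth_put ?size_put ?eqxx ?e //= ?(negbTE
    ab) ?(negbTE ba) ?e //=.
  by lia.
congr State; rewrite rev_cons cat_rcons putC // put_put putC // put_put.
by rewrite putC // putC.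
Qed.

Lemma forkP a b c i R ad o : a != b -> a != c -> b != c ->
  a < size R -> b < size R -> c < size R ->
  size (nth [::] R a) + size (nth [::] R b) <= B ->
  size (nth [::] R a) + size (nth [::] R c) <= B ->
  exec (fork a b c) (State i R ad o)
    (State i (put (put (put R b (rev (nth [::] R a) ++ nth [::] R b))
                    c (rev (nth [::] R a) ++ nth [::] R c)) a [::]) ad o).
Proof.
move=> ab ac bc aR bR cR; move e: (nth [::] R a) => s.
elim: s R aR bR cR e => [|x s IH] R aR bR cR e sB sC.
  rewrite /= !put_id -[in State i (put _ _ _)]e put_id.
  by apply: ExecDone; rewrite filled_view e.
rewrite /= in sB sC; apply: ExecLoop; first by rewrite filled_view e.
  apply: ExecSeq; first by apply: push_topP e _ => //; lia.
  apply: ExecSeq.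
    apply: push_topP; rewrite ?size_put // nth_put //.
      by rewrite (negbTE ab) e.
    by rewrite eq_sym (negbTE bc); lia.
  by apply: popP; rewrite !size_put.
have ba : b != a by rewrite eq_sym. have ca : c != a by rewrite eq_sym.
have cb : c != b by rewrite eq_sym.
apply: exec_eq; first apply: IH;
  rewrite ?size_put ?nth_put ?size_put ?eqxx ?e //= ?(negbTE ab) ?(negbTE ba)
    ?(negbTE ac) ?(negbTE ca) ?(negbTE bc) ?(negbTE cb) ?e //=; try lia.
congr State; rewrite !rev_cons !cat_rcons.
apply: (@eq_from_nth _ [::]); rewrite ?size_put // => j _.
rewrite !nth_put ?size_put //.
by case: (j == a); case: (j == b); case: (j == c).
Qed.

Lemma copyP a b t i R ad o : a != b -> a != t -> b != t ->
  a < size R -> b < size R -> t < size R -> nth [::] R t = [::] ->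
  size (nth [::] R a) + size (nth [::] R b) <= B ->
  exec (copy a b t) (State i R ad o)
    (State i (put R b (nth [::] R a ++ nth [::] R b)) ad o).
Proof.
move=> ab at_ bt aR bR tR et sB.
have ta : t != a by rewrite eq_sym. have tb : t != b by rewrite eq_sym.
have ba : b != a by rewrite eq_sym.
apply: ExecSeq; first by apply: transferP => //; rewrite et /=; lia.
apply: exec_eq; first apply: forkP;
  rewrite ?size_put // ?nth_put ?size_put // ?eqxx ?(negbTE ta) ?(negbTE ba) ?(negbTE bt)
   ?et ?map_id ?cats0 ?size_rev ?addn0 //=; first by lia.
rewrite revK; congr State; apply: (@eq_from_nth _ [::]); rewrite ?size_put // => j _.
rewrite !nth_put ?size_put //.
have [ej|_] := eqVneq j t; first by rewrite ?ej (negbTE tb) et.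
by have [ej|_] := eqVneq j b; rewrite ?ej ?(negbTE ba) //; case: (j =P a) => [->|].
Qed.

Lemma relayP a b t i R ad o : a != b -> a != t -> b != t ->
  a < size R -> b < size R -> t < size R -> nth [::] R t = [::] ->
  size (nth [::] R a) + size (nth [::] R b) <= B ->
  exec (relay a b t) (State i R ad o)
    (State i (put (put R b (nth [::] R a ++ nth [::] R b)) a [::]) ad o).
Proof.
move=> ab at_ bt aR bR tR et sB.
have ta : t != a by rewrite eq_sym. have tb : t != b by rewrite eq_sym.
have ba : b != a by rewrite eq_sym.
apply: ExecSeq; first by apply: transferP => //; rewrite et /=; lia.
apply: exec_eq; first apply: transferP;
  rewrite ?size_put // ?nth_put ?size_put // ?eqxx ?(negbTE ta) ?(negbTE ba) ?(negbTE bt)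
   ?et ?map_id ?cats0 ?size_rev ?addn0 //=.
rewrite revK; congr State; apply: (@eq_from_nth _ [::]); rewrite ?size_put // => j _.
rewrite !nth_put ?size_put //.
have [ej|_] := eqVneq j t; first by rewrite ?ej (negbTE tb) et (negbTE ta).
by have [ej|_] := eqVneq j b; rewrite ?ej ?(negbTE ba).
Qed.

Lemma eq_clearP a b f i R ad o : a != b -> a != f -> b != f ->
  a < size R -> b < size R -> f < size R -> nth [::] R f = [::] -> 0 < B ->
  exec (eq_clear a b f) (State i R ad o)
    (State i (put (put (put R a [::]) b [::]) f
      (if nth [::] R a == nth [::] R b then [:: flag] else [::])) ad o).
Proof.
move=> ab af bf aR bR fR ef B0.
have fa : f != a by rewrite eq_sym. have fb : f != b by rewrite eq_sym.
have ba : b != a by rewrite eq_sym.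
apply: ExecSeq; first by apply: pushP => //; rewrite ef.
rewrite ef; pose fl (x : bool) := if x then [:: flag] else [::].
(* The loop preserves the conjunction of the flag still being up and the remaining words being
   equal. *)
have loop s1 : forall R1 ok, size R1 = size R -> nth [::] R1 a = s1 ->
    nth [::] R1 f = fl ok ->
    exists ok' s2, exec (While (filled a)
     (Seq (Prim (Do f (fun v => if top v a == top v b then Keep Sg else Pop Sg)))
     (Seq (pop a) (pop b)))) (State i R1 ad o)
      (State i (put (put (put R1 a [::]) b s2) f (fl ok')) ad o) /\
    (ok' && nilp s2) = ok && (s1 == nth [::] R1 b).
  elim: s1 => [|x s1 IH] R1 ok sz ea eo.
    exists ok, (nth [::] R1 b); split; last by case: nth.
    apply: exec_eq; first by apply: ExecDone; rewrite filled_view ea.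
    congr State; apply: (@eq_from_nth _ [::]); rewrite ?size_put // => j _.
    rewrite !nth_put ?size_put ?sz //.
    by case: (j =P f) => [->|_] //; case: (j =P b) => [->|_] //; case: (j =P a) => [->|_].
  set t := nth [::] R1 b.
  pose ok1 := ok && (Some x == ohead t).
  pose R2 := put (put (put R1 f (fl ok1)) a s1) b (behead t).
  have [||| ok' [s2 [ex e]]] := IH R2 ok1; rewrite ?size_put //.
  - by rewrite /R2 !nth_put ?size_put ?sz // (negbTE ab) eqxx.
  - by rewrite /R2 !nth_put ?size_put ?sz // (negbTE fb) (negbTE fa) eqxx.
  exists ok', s2; split; last first.
    rewrite e /R2 nth_put ?size_put ?sz // eqxx /ok1 -andbA; congr (_ && _).
    by case: (t) => [|y t2] //=; rewrite eqseq_cons.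
  apply: ExecLoop; first by rewrite filled_view ea.
    apply: ExecSeq.
      apply: doP; first by rewrite sz.
      by case: ifP.
    apply: ExecSeq; first by apply: popP; rewrite size_put sz.
    by apply: popP; rewrite !size_put sz.
  have E : put (put (put R1 f (apply_op (if top (view_of (State i R1 ad o)) a == top (view_of
      (State i R1 ad o)) b then Keep Sg else Pop Sg) (nth [::] R1 f))) a (behead (nth [::] R1
      a))) b (behead t) = R2.
    rewrite /R2 ea !top_view ea eo -/t /ok1 /=; congr (put (put (put _ _ _) _ _) _ _).
    by rewrite andbC; case: eqP => _; case: ok {IH eo ok1 R2 ex e}.
  rewrite !nth_put ?size_put ?sz // (negbTE af) (negbTE ba) (negbTE bf) E.
  apply: exec_eq ex _; congr State; apply: (@eq_from_nth _ [::]); rewrite ?size_put // => j _.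
  rewrite !nth_put ?size_put ?sz //.
  by case: (j == f); case: (j == b); case: (j == a).
have [||| ok' [s2 [ex e]]] := loop (nth [::] R a) (put R f [:: flag]) true; rewrite ?size_put
    //.
- by rewrite nth_put // (negbTE af).
- by rewrite nth_put // eqxx.
apply: ExecSeq; first exact: ex.
apply: ExecSeq.
  apply: doP; first by rewrite !size_put.
  by case: ifP.
apply: exec_eq; first by apply: clearP; rewrite !size_put.
rewrite filled_view !nth_put ?size_put // eqxx (negbTE bf) eqxx.
rewrite nth_put // (negbTE bf) in e; rewrite -[_ == _]e.
congr State; apply: (@eq_from_nth _ [::]); rewrite ?size_put // => j _.
rewrite !nth_put ?size_put //.
have [ej|_] := eqVneq j b; first by rewrite ?ej (negbTE bf).
have [_|_] := eqVneq j f; last by case: (j == a).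
by case: ok' s2 {ex e} => -[].
Qed.

Definition nosep (w : seq (sym A)) := all (fun x : sym A => isSome x) w.

Lemma scan_wordP t w i R ad o : t < size R -> nosep w ->
  size w + size (nth [::] R t) <= B ->
  exec (scan_word t) (State (w ++ sep :: i) R ad o)
    (State i (put R t (rev (map sy w) ++ nth [::] R t)) ad o).
Proof.
move=> tR ns sB; apply: (@ExecSeq _ _ _ _ _ _ _ (State (sep :: i) (put R t (rev (map sy w) ++
    nth [::] R t)) ad o)); last exact: ExecPrim.
elim: w R tR ns sB => [|x w IH] R tR /= ns sB.
  by rewrite put_id; apply: ExecDone.
case/andP: ns => xs ns.
apply: ExecLoop; first by case: x xs.
  apply: ExecSeq; first by apply: doP => //=; lia.
  exact: ExecPrim.
apply: exec_eq; first (apply: IH; rewrite ?size_put // nth_put // eqxx /=; lia).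
by rewrite /= nth_put // eqxx put_put rev_cons cat_rcons.
Qed.

Lemma read_wordP d t w i R ad o : d != t -> d < size R -> t < size R ->
  nth [::] R t = [::] -> nosep w -> size w + size (nth [::] R d) <= B ->
  exec (read_word d t) (State (w ++ sep :: i) R ad o)
    (State i (put R d (map sy w ++ nth [::] R d)) ad o).
Proof.
move=> dt dR tR et ns sB; have td : t != d by rewrite eq_sym.
apply: ExecSeq; first by apply: scan_wordP => //; rewrite et /=; lia.
apply: exec_eq; first apply: transferP; rewrite ?size_put // ?nth_put ?size_put // ?eqxx
  ?(negbTE dt) ?et ?cats0 ?size_rev ?size_map //.
rewrite map_id revK; congr State; apply: (@eq_from_nth _ [::]); rewrite ?size_put // => j _.
by rewrite !nth_put ?size_put //; case: (j =P t) => [->|_] //; rewrite (negbTE td).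
Qed.

Lemma skip_wordP w i R ad o : nosep w ->
  exec skip_word (State (w ++ sep :: i) R ad o) (State i R ad o).
Proof.
move=> ns; apply: (@ExecSeq _ _ _ _ _ _ _ (State (sep :: i) R ad o)); last exact: ExecPrim.
elim: w ns => [|x w IH] /= ns; first exact: ExecDone.
case/andP: ns => xs ns; apply: ExecLoop; first by case: x xs.
  exact: ExecPrim.
exact: IH.
Qed.

Lemma bsy_inj : injective bsy.
Proof. by apply: (inj_comp (can_inj syK)) => x y [->]. Qed.

Lemma incrementP r t s i R ad o : r != t -> r < size R -> t < size R ->
  nth [::] R t = [::] -> nth [::] R r = map bsy s -> size s < B ->
  exec (increment r t) (State i R ad o)
    (State i (put R r (map bsy (incr s))) ad o).
Proof.
move=> rt rR tR et er sB; have tr : t != r by rewrite eq_sym.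
pose fin k := if k is _ :: s' then true :: s' else [:: true].
(* [k] is the length of the carry chain; [s'] is empty or starts with a zero, and [fin s'] absorbs
   the carry. *)
have incrE : exists k s', [/\ s = nseq k true ++ s', nth false s' 0 = false &
    incr s = nseq k false ++ fin s'].
  elim: (s) => [|[] u [k [s' [eu h ei]]]]; first by exists 0, [::].
    by exists k.+1, s'; rewrite eu in ei *; rewrite /= ei.
  by exists 0, (false :: u).
have [k [s' [es hs ->]]] := incrE.
have loop : forall R1 j, size R1 = size R -> nth [::] R1 r = map bsy (nseq j true ++ s') ->
    size (nth [::] R1 t) + j <= B ->
    exec (While (fun v => top v r == Some (bsy true))
         (Seq (push t (bsy false)) (pop r))) (State i R1 ad o)
      (State i (put (put R1 r (map bsy s')) t (nseq j (bsy false) ++ nth [::] R1 t)) ad o).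
  move=> R1 j; elim: j R1 => [|j IH] R1 sz e1 sB1.
    rewrite -e1 /= put_id put_id; apply: ExecDone; rewrite top_view e1 /=.
    by case: s' hs {es e1} => //= x s' ->; rewrite (inj_eq (@Some_inj _)) (inj_eq bsy_inj).
  apply: ExecLoop; first by rewrite top_view e1 /= eqxx.
    apply: ExecSeq; first by apply: pushP; rewrite ?sz //; lia.
    by apply: popP; rewrite size_put sz.
  apply: exec_eq; first (apply: IH; rewrite ?size_put ?nth_put ?size_put ?sz // ?(negbTE tr)
      ?(negbTE rt) ?e1 ?eqxx //=; lia).
  rewrite !nth_put ?size_put ?sz // (negbTE tr) eqxx e1 /=; congr State.
  have ns x : nseq j (bsy false) ++ bsy false :: x = bsy false :: nseq j (bsy false) ++ x.
    by elim: j {IH sB1 e1} => //= j ->.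
  rewrite ns; apply: (@eq_from_nth _ [::]); rewrite ?size_put // => m _.
  rewrite !nth_put ?size_put ?sz //.
  by case: (m == t); case: (m == r).
rewrite es size_cat size_nseq in sB.
apply: ExecSeq.
  by apply: (loop R k); rewrite ?er ?es // et /=; lia.
apply: ExecSeq.
  apply: doP; rewrite ?size_put // filled_view nth_put ?size_put // (negbTE rt).
  by rewrite nth_put // eqxx size_map; case: ifP => //; lia.
cbv beta; rewrite filled_view !nth_put ?size_put // (negbTE rt) eqxx et cats0.
have sf : size (fin s') <= (size s').+1 by case: (s').
have -> : apply_op (if ~~ nilp (map bsy s') then Subst (bsy true) else Push (bsy true))
   (map bsy s') = map bsy (fin s') by case: (s').
apply: exec_eq; first (apply: transferP; rewrite ?size_put ?nth_put ?size_put // ?(negbTE tr)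
    ?(negbTE rt) ?eqxx ?size_nseq ?size_map //; lia).
rewrite !nth_put ?size_put // (negbTE tr) !eqxx map_id; congr State.
apply: (@eq_from_nth _ [::]); rewrite ?size_put // => j _; rewrite !nth_put ?size_put //.
have [ej|_] := eqVneq j t; first by rewrite ?ej (negbTE tr).
have [_|_] := eqVneq j r => //; rewrite map_cat; congr (_ ++ _).
by rewrite map_nseq; elim: (k) => //= n IH; rewrite rev_cons IH -cats1; elim: n {IH} => //= n
    ->.
Qed.

Lemma seekP r t1 t2 s i R o : r != t1 -> r != t2 -> t1 != t2 ->
  r < size R -> t1 < size R -> t2 < size R ->
  nth [::] R t1 = [::] -> nth [::] R t2 = [::] ->
  nth [::] R r = map bsy s -> size s <= B ->
  exec (seek r t1 t2) (State i R [::] o)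
    (State (flatten (drop (num s) blocks)) R [::] o).
Proof.
move=> r1 r2 t12 rR R1 R2 e1 e2 er sB; have t21 : t2 != t1 by rewrite eq_sym.
apply: ExecSeq; first by apply: copyP; rewrite // er e1 size_map /=; lia.
rewrite er e1 cats0.
have loop u : forall ad v, size ad + size u <= B -> size v + size u <= B ->
    exec (While (filled t1)
    (Seq (Prim (AddrPush (fun v => top v t1 == Some (bsy true))))
         (Seq (push_top id t1 t2) (pop t1))))
    (State i (put (put R t1 (map bsy u)) t2 v) ad o)
    (State i (put R t2 (rev (map bsy u) ++ v)) (ad ++ u) o).
  elim: u => [|x u IH] ad v sa sv.
    rewrite /= -e1 put_id cats0; apply: ExecDone.
    by rewrite filled_view nth_put // (negbTE t12) e1.
  apply: ExecLoop; first by rewrite filled_view !nth_put ?size_put // (negbTE t12) eqxx.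
    apply: ExecSeq; first by apply: ExecPrim => /=; rewrite /= in sa; lia.
    rewrite /prim_sem; apply: ExecSeq.
      apply: push_topP; rewrite ?size_put //.
        by rewrite !nth_put ?size_put // (negbTE t12) eqxx.
      by rewrite nth_put ?size_put // eqxx; rewrite /= in sv; lia.
    by apply: popP; rewrite !size_put.
  cbv beta; rewrite top_view !nth_put ?size_put // (negbTE t12) !eqxx /=.
  have -> : put (put (put (put R t1 (bsy x :: map bsy u)) t2 v) t2 (bsy x :: v)) t1
      (map bsy u) = put (put R t1 (map bsy u)) t2 (bsy x :: v).
    by rewrite put_put putC // put_put.
  rewrite (inj_eq (@Some_inj _)) (inj_eq bsy_inj) eqb_id /=.
  apply: exec_eq.
    by apply: IH; rewrite /= in sa sv *; rewrite ?size_rcons; lia.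
  by rewrite cat_rcons rev_cons cat_rcons.
have e0 x : put (put R t1 x) t2 [::] = put R t1 x.
  by rewrite -[in RHS](put_id (put R t1 x) t2) nth_put // (negbTE t21) e2.
have ex := loop s [::] [::] sB sB.
rewrite e0 cats0 in ex; apply: ExecSeq; first exact: ex.
apply: ExecSeq; first exact: ExecPrim.
rewrite /prim_sem cat0s; set i' := flatten _.
have undo v : forall ad, size ad = size v ->
    exec (While (filled t2) (Seq (Prim (AddrPop A Sg)) (pop t2)))
      (State i' (put R t2 v) ad o) (State i' R [::] o).
  elim: v => [|x v IH] ad.
    move/size0nil=> ->; rewrite -[in X in put _ _ X]e2 put_id.
    by apply: ExecDone; rewrite filled_view e2.
  move=> sz; apply: ExecLoop; first by rewrite filled_view nth_put // eqxx.
    apply: ExecSeq; first exact: ExecPrim.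
    by apply: popP; rewrite size_put.
  rewrite nth_put // eqxx put_put /=; apply: IH.
  by rewrite size_take sz /= ltnSn.
by apply: undo; rewrite size_rev size_map.
Qed.

Lemma emitP r t1 t2 w i R ad o : r != t1 -> r != t2 -> t1 != t2 ->
  r < size R -> t1 < size R -> t2 < size R ->
  nth [::] R t1 = [::] -> nth [::] R t2 = [::] ->
  nth [::] R r = map sy w -> size w <= B ->
  exec (emit r t1 t2) (State i R ad o) (State i R ad (o ++ w ++ [:: sep])).
Proof.
move=> r1 r2 t12 rR R1 R2 e1 e2 er sB.
apply: ExecSeq; first by apply: copyP; rewrite // er e1 size_map /=; lia.
rewrite er e1 cats0.
have loop u : forall o', exec (While (filled t1)
    (Seq (Prim (Emit (fun v => if top v t1 is Some x then us x else sep)))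
         (pop t1))) (State i (put R t1 (map sy u)) ad o') (State i R ad (o' ++ u)).
  elim: u => [|x u IH] o'.
    rewrite cats0 /= -[in X in put _ _ X]e1 put_id.
    by apply: ExecDone; rewrite filled_view e1.
  apply: ExecLoop; first by rewrite filled_view nth_put // eqxx.
    apply: ExecSeq; first exact: ExecPrim.
    by apply: popP; rewrite size_put.
  cbv beta; rewrite top_view nth_put // eqxx put_put /= syK -cat_rcons.
  exact: IH.
apply: ExecSeq; first exact: loop.
by apply: exec_eq; [apply: ExecPrim|rewrite /= -cats1 catA].
Qed.

End Macros.

(** * Simulation of a given machine *)

Lemma onth_nil (T : Type) n : onth (@nil T) n = None.
Proof. by case: n. Qed.

Section Simulation.
Variables (A Sg : finType) (sy : sym A -> Sg) (us : Sg -> sym A).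
Hypothesis syK : cancel sy us.
Variable N : machine A.

Notation ntape := (tm_aux N).+1.
Notation ncell := (cell A (tm_priv N)).
Notation decision := (tm_state N * {ffun 'I_ntape -> ncell})%type.

Variables (ec : ncell -> Sg) (dc : Sg -> ncell).
Variables (ed : decision -> Sg) (dd : Sg -> decision).
Hypotheses (ecK : cancel ec dc) (edK : cancel ed dd).

(* Tape [i] of [N] is kept on two stacks: [lreg i] holds the cells to the left
   of its head, [rreg i] the scanned cell and those to its right. [D] holds the
   state and the scanned cells of the step being simulated, [O] the output. *)
Variables (base D O : nat).
Hypotheses (DO : D != O) (Dbase : D < base) (Obase : O < base).

Definition lreg (i : nat) := base + i.
Definition rreg (i : nat) := base + ntape + i.

Notation prog := (prog A Sg).
Notation view := (view A Sg).

(** An exhausted right stack stands for the blank part of the tape. *)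
Definition scan (v : view) : {ffun 'I_ntape -> ncell} :=
  [ffun i : 'I_ntape => if top v (rreg i) is Some x then dc x else None].
Definition blank : {ffun 'I_ntape -> ncell} := [ffun=> None].
Definition current (v : view) : decision :=
  if top v D is Some x then dd x else (tm_start N, blank).
Definition decide (v : view) :=
  tm_delta (current v).1 None (current v).2.
Definition decided_act (v : view) (i : 'I_ntape) : ncell * move :=
  if decide v is Some (_, acts, _, _) then acts i else (None, MoveS).

(** The order matters: a left move reads the top of the left stack before popping it. At the left
    end that stack is empty and nothing moves, as for the head of [N]. *)
Definition tape_prog (i : 'I_ntape) : prog :=
  Seq (Prim (Do (rreg i) (fun v =>
    let w := ec (decided_act v i).1 in
    if filled (rreg i) v then Subst w else Push w)))
  (Seq (Prim (Do (lreg i) (fun v =>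
    if (decided_act v i).2 is MoveR then Push (ec (decided_act v i).1)
    else Keep Sg)))
  (Seq (Prim (Do (rreg i) (fun v => match (decided_act v i).2 with
    | MoveR => Pop Sg
    | MoveL => if top v (lreg i) is Some x then Push x else Keep Sg
    | MoveS => Keep Sg end)))
  (Prim (Do (lreg i) (fun v =>
    if (decided_act v i).2 is MoveL then Pop Sg else Keep Sg))))).

(** The tapes are updated one after the other, so the scanned cells change on the way; the snapshot
    in [D] makes every tape act on the same transition. The blank cells stored with the next state
    are a placeholder until the next snapshot. *)
Definition step_prog : prog :=
  Seq (Prim (Do D (fun v => Subst (ed ((current v).1, scan v)))))
  (Seq (foldr (fun i p => Seq (tape_prog i) p) (Prim (Skip A Sg)) (enum 'I_ntape))
  (Seq (Prim (Do O (fun v => if decide v is Some (_, _, _, Some a)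
                             then Push (sy a) else Keep Sg)))
  (Prim (Do D (fun v => if decide v is Some (q, _, _, _)
                        then Subst (ed (q, blank)) else Keep Sg))))).

Definition running (v : view) : bool := tm_delta (current v).1 None (scan v).

Definition clear_all (s : seq nat) : prog :=
  foldr (fun r p => Seq (clear A Sg r) p) (Prim (Skip A Sg)) s.

Definition simulate : prog :=
  Seq (push A D (ed (tm_start N, blank)))
  (Seq (While running step_prog)
  (Seq (pop A Sg D) (clear_all (iota base (ntape + ntape))))).

(** An argument beyond the last tape of [N] is discarded, as [init_config] ignores it too. *)
Definition load (k a t : nat) : prog :=
  if k < ntape then
    Seq (transfer A id a t)
        (transfer A (fun x => ec (Some (inl (us x)))) t (rreg k))
  else clear A Sg a.

Fixpoint loads (k : nat) (s : seq nat) (t : nat) : prog :=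
  if s is a :: s' then Seq (load k a t) (loads k.+1 s' t) else Prim (Skip A Sg).

Definition call (s : seq nat) (dest t : nat) : prog :=
  Seq (loads 0 s t) (Seq simulate (transfer A id O dest)).

Variables (blocks : seq (seq (sym A))) (B : nat).
Notation exec := (@exec A Sg blocks B).
Notation tape_t := (tape A (tm_priv N)).

(** The last clause turns the space bound of [N] into a bound on the two stacks. *)
Definition tape_split (tp : tape_t) (l r : seq Sg) :=
  exists lc rc, [/\ l = map ec lc, r = map ec rc, size lc = tp.2,
    forall j, nth None (rev lc ++ rc) j = nth None tp.1 j
    & size lc + size rc <= tape_cells tp].

Definition lmove (wm : ncell * move) (l : seq Sg) :=
  match wm.2 with
  | MoveL => behead l | MoveS => l | MoveR => ec wm.1 :: l
  end.

Definition rmove (wm : ncell * move) (l r : seq Sg) :=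
  match wm.2 with
  | MoveL => if l is x :: _ then [:: x, ec wm.1 & behead r] else ec wm.1 :: behead r
  | MoveS => ec wm.1 :: behead r
  | MoveR => behead r
  end.

Lemma scanned_split tp l r : tape_split tp l r ->
  (if ohead r is Some x then dc x else None) = scanned tp.
Proof.
case=> lc [rc [_ -> sl e _]]; rewrite /scanned -e nth_cat size_rev sl ltnn subnn.
by case: rc {e} => //= x rc; rewrite ecK.
Qed.

Lemma step_split tp l r wm : tape_split tp l r ->
  tape_split (tape_step tp wm) (lmove wm l) (rmove wm l r).
Proof.
case: tp wm => s h [w m] [lc [rc [-> -> /= sl e b]]].
have E j : nth None (rev lc ++ w :: behead rc) j = nth None (set_nth None s h w) j.
  rewrite nth_set_nth /= -e !nth_cat size_rev sl.
  case: (ltngtP j h) => jh //; last by rewrite jh subnn.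
  have -> : j - h = (j - h.+1).+1 by lia.
  by case: (rc) => //= ; rewrite !nth_nil.
have sb : size (behead rc) = (size rc).-1 by case: (rc).
rewrite /tape_cells /= in b.
case: m; rewrite /lmove /rmove /tape_split /tape_cells /= ?size_set_nth.
- case: lc sl {e} E b => [|x lc] /= sl E b.
    exists [::], (w :: behead rc); split=> //=; first by rewrite behead_map.
      by rewrite -sl.
    by rewrite sb; lia.
  exists lc, [:: x, w & behead rc]; split=> //=; first by rewrite behead_map.
  - by rewrite -sl.
  - by move=> j; rewrite -cat_rcons -rev_cons E -sl.
  - by rewrite sb; lia.
- by exists lc, (w :: behead rc); split=> //=; rewrite ?behead_map // sb; lia.
- exists (w :: lc), (behead rc); split=> //=; rewrite ?behead_map //; first by rewrite sl.
    by move=> j; rewrite rev_cons cat_rcons.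
  by rewrite sb; lia.
Qed.

Lemma current_view i R ad o d u : nth [::] R D = ed d :: u ->
  current (view_of (State i R ad o)) = d.
Proof. by move=> e; rewrite /current top_view e /= edK. Qed.

Lemma scan_view i R ad o (tps : {ffun 'I_ntape -> tape_t}) :
  (forall k : 'I_ntape, tape_split (tps k) (nth [::] R (lreg k)) (nth [::] R (rreg k))) ->
  scan (view_of (State i R ad o)) = [ffun k => scanned (tps k)].
Proof.
move=> ts; apply/ffunP => k; rewrite !ffunE top_view.
exact: scanned_split (ts k).
Qed.

Lemma tape_progP (k : 'I_ntape) i R ad o d u q acts im oo :
  base + ntape + ntape <= size R ->
  nth [::] R D = ed d :: u ->
  tm_delta d.1 None d.2 = Some (q, acts, im, oo) ->
  size (nth [::] R (lreg k)) + size (nth [::] R (rreg k)) + 2 <= B ->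
  exec (tape_prog k) (State i R ad o)
    (State i (put (put R (lreg k) (lmove (acts k) (nth [::] R (lreg k))))
                (rreg k) (rmove (acts k) (nth [::] R (lreg k)) (nth [::] R (rreg k)))) ad o).
Proof.
move=> sR eD ed' sB; have kn := ltn_ord k.
have lk : lreg k < size R by rewrite /lreg; lia.
have rk : rreg k < size R by rewrite /rreg; lia.
have lr : lreg k != rreg k by rewrite /lreg /rreg; lia.
have rl : rreg k != lreg k by rewrite eq_sym.
have Dl : D != lreg k by rewrite /lreg; lia.
have Dr : D != rreg k by rewrite /rreg; lia.
have act R' : nth [::] R' D = ed d :: u ->
    decided_act (view_of (State i R' ad o)) k = acts k.
  by move=> e; rewrite /decided_act /decide (current_view _ _ _ e) ed'.
move: (act) sB; case: (acts k) => w m {}act.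
set l := nth [::] R (lreg k); set r := nth [::] R (rreg k) => sB.
pose R1 := put R (rreg k) (ec w :: behead r).
have e1 : nth [::] R1 D = ed d :: u by rewrite nth_put // (negbTE Dr).
pose R2 := put R1 (lreg k) (if m is MoveR then ec w :: l else l).
have e2 : nth [::] R2 D = ed d :: u by rewrite nth_put ?size_put // (negbTE Dl).
pose R3 := put R2 (rreg k) (rmove (w, m) l r).
have e3 : nth [::] R3 D = ed d :: u by rewrite nth_put ?size_put // (negbTE Dr).
have n1r : nth [::] R1 (rreg k) = ec w :: behead r by rewrite nth_put // eqxx.
have n1l : nth [::] R1 (lreg k) = l by rewrite nth_put // (negbTE lr).
have n2r : nth [::] R2 (rreg k) = ec w :: behead r by rewrite nth_put ?size_put // (negbTE rl).
have n2l : nth [::] R2 (lreg k) = if m is MoveR then ec w :: l else l.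
  by rewrite nth_put ?size_put // eqxx.
have n3l : nth [::] R3 (lreg k) = if m is MoveR then ec w :: l else l.
  by rewrite nth_put ?size_put // (negbTE lr).
have sb : size (behead r) <= size r by case: (r).
apply: (@ExecSeq _ _ _ _ _ _ _ (State i R1 ad o)).
  apply: exec_eq; first apply: doP => //.
    by rewrite act // filled_view -/r; case: nilp => //=; lia.
  by cbv beta zeta; rewrite act // filled_view -/r /R1; case: (r).
apply: (@ExecSeq _ _ _ _ _ _ _ (State i R2 ad o)).
  apply: exec_eq; first apply: doP; rewrite ?size_put //.
    by rewrite act // n1l; case: (m) => //=; lia.
  by cbv beta; rewrite act // n1l /R2; case: (m).
apply: (@ExecSeq _ _ _ _ _ _ _ (State i R3 ad o)).
  apply: exec_eq; first apply: doP; rewrite ?size_put //.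
    rewrite act // top_view n2r n2l; case: (m) => //=; case: (l) => //= _ _; lia.
  by cbv beta; rewrite act // top_view n2r n2l /R3 /rmove; case: (m) => //=; case: (l).
apply: exec_eq; first apply: doP; rewrite ?size_put //.
  by rewrite act //; case: (m).
cbv beta; rewrite act // n3l /lmove; congr State.
apply: (@eq_from_nth _ [::]); rewrite ?size_put // => j _; rewrite !nth_put ?size_put //.
by have [ej|_] := eqVneq j (lreg k); rewrite ?ej ?(negbTE lr); case: (j == rreg k); case: (m).
Qed.

Lemma tapes_progP (s : seq 'I_ntape) i R ad o d u q acts im oo :
  uniq s -> base + ntape + ntape <= size R -> nth [::] R D = ed d :: u ->
  tm_delta d.1 None d.2 = Some (q, acts, im, oo) ->
  {in s, forall k : 'I_ntape,
     size (nth [::] R (lreg k)) + size (nth [::] R (rreg k)) + 2 <= B} ->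
  exists R', [/\ exec (foldr (fun i p => Seq (tape_prog i) p) (Prim (Skip A Sg)) s)
                   (State i R ad o) (State i R' ad o),
    size R' = size R,
    (forall k : 'I_ntape, k \in s ->
       nth [::] R' (lreg k) = lmove (acts k) (nth [::] R (lreg k)) /\
       nth [::] R' (rreg k) = rmove (acts k) (nth [::] R (lreg k)) (nth [::] R (rreg k))),
    (forall k : 'I_ntape, k \notin s ->
       nth [::] R' (lreg k) = nth [::] R (lreg k) /\
       nth [::] R' (rreg k) = nth [::] R (rreg k))
  & forall r, ~~ (base <= r < base + ntape + ntape) -> nth [::] R' r = nth [::] R r].
Proof.
move=> us_ sR eD ed' sB.
elim: s us_ R sR eD sB => [_|k s IH /= /andP[ks us_]] R sR eD sB.
  by exists R; split=> //; apply: ExecPrim.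
have kn := ltn_ord k.
have lk : lreg k < size R by rewrite /lreg; lia.
have rk : rreg k < size R by rewrite /rreg; lia.
pose l := nth [::] R (lreg k); pose r := nth [::] R (rreg k).
pose R1 := put (put R (lreg k) (lmove (acts k) l)) (rreg k) (rmove (acts k) l r).
have n1 j : nth [::] R1 j = if j == rreg k then rmove (acts k) l r
     else if j == lreg k then lmove (acts k) l else nth [::] R j.
  by rewrite !nth_put ?size_put.
have other (k' : 'I_ntape) : k' != k ->
    nth [::] R1 (lreg k') = nth [::] R (lreg k') /\ nth [::] R1 (rreg k') = nth [::] R (rreg
        k').
  rewrite -val_eqE /= => kk; rewrite !n1 /lreg /rreg; have := ltn_ord k'.
  by split; do 2 (case: eqP; first lia).
have sR1 : base + ntape + ntape <= size R1 by rewrite !size_put.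
have eD1 : nth [::] R1 D = ed d :: u.
  by rewrite n1 /lreg /rreg; do 2 (case: eqP; first lia).
have sB1 : {in s, forall k' : 'I_ntape,
    size (nth [::] R1 (lreg k')) + size (nth [::] R1 (rreg k')) + 2 <= B}.
  move=> k' k's; have [|-> ->] := other k'; first by apply: contraNneq ks => <-.
  by apply: sB; rewrite in_cons k's orbT.
have [R' [ex sz new old oth]] := IH us_ R1 sR1 eD1 sB1.
have R1l : nth [::] R1 (lreg k) = lmove (acts k) l.
  by rewrite n1 eqxx /lreg /rreg; case: eqP => //; lia.
have R1r : nth [::] R1 (rreg k) = rmove (acts k) l r by rewrite n1 eqxx.
exists R'; split.
- apply: ExecSeq ex; apply: tape_progP eD ed' _ => //.
  by apply: sB; rewrite mem_head.
- by rewrite sz !size_put.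
- move=> k'; rewrite in_cons => /predU1P[->|k's].
    by have [-> ->] := old _ ks.
  have [-> ->] := new _ k's.
  by have [|-> ->] := other k'; first by apply: contraNneq ks => <-.
- move=> k'; rewrite in_cons negb_or => /andP[k'k k's].
  by have [-> ->] := old _ k's; apply: other.
- move=> j jn; rewrite oth // n1 /lreg /rreg; do 2 (case: eqP; first lia).
  by [].
Qed.

Section Run.
Variables (R0 : seq (seq Sg)) (b : nat).
(** [b] will bound the time and space of [N]; the surplus 2 leaves room for symbols that [tape_prog]
    pushes before it pops others. *)
Hypotheses (R0size : base + ntape + ntape <= size R0) (bB : b + 2 <= B).

(** The cells [f] stored in [D] are left open because they are stale between two steps. *)
Definition simulates (c : config N) (R : seq (seq Sg)) :=
  [/\ size R = size R0,
      exists f, nth [::] R D = [:: ed (cf_state c, f)],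
      nth [::] R O = rev (map sy (cf_output c)),
      forall k : 'I_ntape,
        tape_split (cf_tapes c k) (nth [::] R (lreg k)) (nth [::] R (rreg k))
    & forall r, r != D -> r != O -> ~~ (base <= r < base + ntape + ntape) ->
        nth [::] R r = nth [::] R0 r].

Lemma tape_cells_space (c : config N) k : tape_cells (cf_tapes c k) <= space c.
Proof. by rewrite /space (bigD1 k) //= leq_addr. Qed.

Lemma step_progP i R ad o c c' : simulates c R -> step [::] c = Some c' ->
  space c <= b -> size (cf_output c') <= b ->
  exists2 R', exec step_prog (State i R ad o) (State i R' ad o) & simulates c' R'.
Proof.
move=> [sR [f eD] eO ts oth] st sb ob.
have DR : D < size R by lia. have OR : O < size R by lia.
have OD : O != D by rewrite eq_sym.
have ns k : D != lreg k /\ D != rreg k by rewrite /lreg /rreg; lia.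
have nO k : O != lreg k /\ O != rreg k by rewrite /lreg /rreg; lia.
move: st; rewrite /step onth_nil; set sc := [ffun k => _].
case ed' : tm_delta => [[[[q acts] im] oo]|] // [ecc]; rewrite -{}ecc /= in ob *.
pose d : decision := (cf_state c, sc).
pose R1 := put R D [:: ed d].
have n1 j : nth [::] R1 j = if j == D then [:: ed d] else nth [::] R j by rewrite nth_put.
have l1 k : nth [::] R1 (lreg k) = nth [::] R (lreg k).
  by rewrite n1 eq_sym; case: (ns k) => /negbTE-> _.
have r1 k : nth [::] R1 (rreg k) = nth [::] R (rreg k).
  by rewrite n1 eq_sym; case: (ns k) => _ /negbTE->.
have [||||R2 [ex2 s2 new2 _ oth2]] := @tapes_progP (enum 'I_ntape) i R1 ad o d [::] q acts im
    oo (enum_uniq _).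
- by rewrite size_put; lia.
- by rewrite n1 eqxx.
- exact: ed'.
- move=> k _; rewrite l1 r1; have [lc [rc [-> -> _ _ ss]]] := ts k.
  by rewrite !size_map; have := tape_cells_space c k; lia.
have D2 : nth [::] R2 D = [:: ed d] by rewrite oth2 ?n1 ?eqxx //; lia.
have O2 : nth [::] R2 O = rev (map sy (cf_output c)).
  by rewrite oth2 ?n1 ?(negbTE OD) //; lia.
set out' := (if oo is Some a then _ else _) in ob *.
pose R3 := put R2 O (rev (map sy out')).
have D3 : nth [::] R3 D = [:: ed d] by rewrite nth_put ?s2 ?size_put // (negbTE DO).
pose R4 := put R3 D [:: ed (q, blank)].
have dec R' : nth [::] R' D = [:: ed d] -> decide (view_of (State i R' ad o)) = Some (q,
    acts, im, oo).
  by move=> e; rewrite /decide (current_view _ _ _ e).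
exists R4.
  apply: (@ExecSeq _ _ _ _ _ _ _ (State i R1 ad o)).
    apply: exec_eq; first by apply: doP.
    by cbv beta; rewrite (current_view _ _ _ eD) (scan_view _ _ _ ts) eD.
  apply: ExecSeq; first exact: ex2.
  apply: (@ExecSeq _ _ _ _ _ _ _ (State i R3 ad o)).
    apply: exec_eq; first apply: doP; rewrite ?s2 ?size_put //.
      rewrite dec //; move: ob; rewrite /out'; case: (oo) => //= a; rewrite size_rcons O2
          size_rev size_map; lia.
    cbv beta; rewrite dec // O2 /R3 /out'; case: (oo) => //= a.
    by rewrite map_rcons rev_rcons.
  apply: exec_eq; first apply: doP; rewrite ?size_put ?s2 ?size_put //.
    by rewrite dec.
  by cbv beta; rewrite dec // D3.
have n4 j : nth [::] R4 j = if j == D then [:: ed (q, blank)] else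
    if j == O then rev (map sy out') else nth [::] R2 j.
  by rewrite !nth_put ?size_put ?s2 ?size_put.
split=> /=.
- by rewrite !size_put s2 size_put.
- by exists blank; rewrite n4 eqxx.
- by rewrite n4 (negbTE OD) eqxx.
- move=> k; rewrite ffunE !n4.
  case: (ns k) (nO k) => n1_ n2_ [n3_ n4_].
  rewrite ![_ == D]eq_sym ![_ == O]eq_sym (negbTE n1_) (negbTE n2_) (negbTE n3_) (negbTE n4_).
  have [|-> ->] := new2 k; first by rewrite mem_enum.
  by rewrite l1 r1; apply: step_split.
- move=> r rD rO rb; rewrite n4 (negbTE rD) (negbTE rO) oth2 // n1 (negbTE rD).
  exact: oth.
Qed.

(** At most one symbol is output per step. As output does not count in the space of [N], it is the
    time bound of [N] that keeps the register [O] small. *)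
Lemma output_mono (bl : seq (seq (sym A))) n (c : config N) :
  size (cf_output c) <= size (cf_output (run bl n c)) <= size (cf_output c) + n.
Proof.
elim: n c => [|n IH] c /=; first lia.
case st: (step bl c) => [c'|]; last lia.
have := IH c'; suff : size (cf_output c) <= size (cf_output c') <= (size (cf_output c)).+1 by
    lia.
move: st; rewrite /step; case: tm_delta => [[[[q acts] im] [a|]]|] // [<-] /=.
  by rewrite size_rcons; lia.
lia.
Qed.

Lemma run_progP n i R ad o c : simulates c R -> step [::] (run [::] n c) = None ->
  (forall k, space (run [::] k c) <= b) -> size (cf_output (run [::] n c)) <= b ->
  exists2 R', exec (While running step_prog) (State i R ad o) (State i R' ad o)
    & simulates (run [::] n c) R'.
Proof.
elim: n c R => [|n IH] c R sm st sp ob /=.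
(* The loop test computes the same transition as [step] on the represented configuration, so the
   loop stops exactly when [N] halts. *)
all: have rn : running (view_of (State i R ad o)) = (step [::] c) :> bool.
all: try by case: sm => _ [f eD] _ ts _; rewrite /running (current_view _ _ _ eD) (scan_view
    _ _ _ ts) /step onth_nil; case: tm_delta => [[[[? ?] ?] ?]|].
  by exists R => //; apply: ExecDone; rewrite rn st.
case e: (step [::] c) => [c'|]; last first.
  by exists R => //; apply: ExecDone; rewrite rn e.
rewrite /= e in st ob.
have [||R1 ex1 sm1] := step_progP i ad o sm e; first exact: (sp 0).
  by have := output_mono [::] n c'; lia.
have [|R2 ex2 sm2] := IH c' R1 sm1 st _ ob.
  by move=> k; have := sp k.+1; rewrite /= e.
exists R2 => //; apply: ExecLoop ex1 ex2.
by rewrite rn e.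
Qed.

Lemma clear_allP s i R ad o : all (fun r => r < size R) s ->
  exists R', [/\ exec (clear_all s) (State i R ad o) (State i R' ad o),
    size R' = size R
    & forall r, nth [::] R' r = if r \in s then [::] else nth [::] R r].
Proof.
elim: s R => [|a s IH] R /=; first by exists R; split=> //; apply: ExecPrim.
case/andP=> aR sR; have [|R' [ex sz e]] := IH (put R a [::]).
  by rewrite size_put.
exists R'; split; first by apply: ExecSeq ex; apply: clearP.
  by rewrite sz size_put.
by move=> r; rewrite e nth_put // in_cons; case: eqP => //= _; case: ifP.
Qed.

Lemma simulateP args out i ad o R1 : evaluates N args out b ->
  nth [::] R0 D = [::] -> nth [::] R0 O = [::] ->
  (forall k : 'I_ntape, nth [::] R0 (lreg k) = [::]) ->
  (forall k : 'I_ntape, nth [::] R0 (rreg k) =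
     [seq ec (Some (inl a)) | a <- nth [::] args k]) ->
  size R1 = size R0 ->
  (forall r, nth [::] R1 r = if base <= r < base + ntape + ntape then [::]
     else if r == O then rev (map sy out) else nth [::] R0 r) ->
  exec simulate (State i R0 ad o) (State i R1 ad o) /\ size out <= b.
Proof.
case=> -[n nb [st eo]] sp eD eO el er s1 e1.
have OD : O != D by rewrite eq_sym.
have sm : simulates (init_config N args) (put R0 D [:: ed (tm_start N, blank)]).
  split.
  - by rewrite size_put.
  - by exists blank; rewrite nth_put ?eqxx; last lia.
  - by rewrite nth_put ?(negbTE OD) ?eO; last lia.
  - move=> k; rewrite !nth_put; try lia.
    have -> : lreg k == D = false by rewrite /lreg; lia.
    have -> : rreg k == D = false by rewrite /rreg; lia.
    rewrite el er ffunE.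
    exists [::], [seq Some (inl a) | a <- nth [::] args k]; split=> //.
      by rewrite -map_comp.
    by rewrite /tape_cells /=; lia.
  - by move=> r rD _ _; rewrite nth_put ?(negbTE rD); last lia.
have ob : size (cf_output (run [::] n (init_config N args))) <= b.
  by have := output_mono [::] n (init_config N args); rewrite /=; lia.
have [R2 ex2 [s2 [f D2] O2 ts2 oth2]] := run_progP i ad o sm st sp ob.
have [|R3 [ex3 s3 e3]] := @clear_allP (iota base (ntape + ntape)) i (put R2 D [::]) ad o.
  by apply/allP => r; rewrite mem_iota size_put s2; lia.
rewrite eo in O2 ob; split=> //.
apply: ExecSeq; first by apply: pushP; rewrite ?eD /=; lia.
rewrite eD; apply: ExecSeq; first exact: ex2.
apply: ExecSeq; first by apply: popP; lia.
rewrite D2 /=; apply: exec_eq ex3 _; congr State.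
apply: (@eq_from_nth _ [::]); first by rewrite s3 size_put s1.
move=> r _; rewrite e3 e1 mem_iota addnA; case: ifP => // rb; rewrite nth_put; last lia.
have [->|rD] := eqVneq r D; first by rewrite (negbTE DO).
have [->|rO] := eqVneq r O; first by [].
by rewrite oth2 // rb.
Qed.

End Run.

Lemma loadsP s ws k t i R ad o :
  uniq (t :: s) -> all (fun a => a < base) (t :: s) -> base + ntape + ntape <= size R ->
  nth [::] R t = [::] -> [seq nth [::] R a | a <- s] = map (map sy) ws ->
  all (fun w => size w <= B) ws ->
  (forall r, base + ntape + k <= r < base + ntape + ntape -> nth [::] R r = [::]) ->
  exists R', [/\ exec (loads k s t) (State i R ad o) (State i R' ad o),
    size R' = size R
    & forall r, nth [::] R' r = if r \in s then [::]
        else if base + ntape + k <= r < base + ntape + ntape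
        then [seq ec (Some (inl x)) | x <- nth [::] ws (r - (base + ntape + k))]
        else nth [::] R r].
Proof.
elim: s ws k R => [|a s IH] [|w ws] k R //= us_ ab sR et.
  move=> _ _ er; exists R; split=> // [|r]; first exact: ExecPrim.
  by rewrite nth_nil; case: ifP => // /er.
case=> ea es /andP[wB wsB] er.
move: us_; rewrite in_cons negb_or -andbA => /and4P[ta ts a_s us_].
case/and3P: ab => tb ab sb.
have at_ : a != t by rewrite eq_sym.
have aR : a < size R by lia. have tR : t < size R by lia.
pose g (x : Sg) : Sg := ec (Some (inl (us x))).
pose R1 := if k < ntape then put (put R a [::]) (rreg k) (map (fun x => ec (Some (inl x))) w)
           else put R a [::].
have n1 r : nth [::] R1 r = if r == a then [::] else
   if (k < ntape) && (r == rreg k) then map (fun x => ec (Some (inl x))) w else nth [::] R r.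
  rewrite /R1; case: ifP => kn /=; rewrite !nth_put ?size_put //; last by rewrite /rreg; lia.
  by have [->|_] := eqVneq r a => //; case: eqP => //; rewrite /rreg; lia.
have s1 : size R1 = size R by rewrite /R1; case: ifP; rewrite !size_put.
have ex1 : exec (load k a t) (State i R ad o) (State i R1 ad o).
  rewrite /load /R1; case: ifP => kn; last exact: clearP.
  have rk : rreg k < size R by rewrite /rreg; lia.
  have tr : t != rreg k by rewrite /rreg; lia.
  have rt : rreg k != t by rewrite eq_sym.
  have ra : rreg k != a by rewrite /rreg; lia.
  have er0 : nth [::] R (rreg k) = [::] by apply: er; rewrite /rreg; lia.
  apply: ExecSeq; first by apply: transferP; rewrite // ea et size_map addn0.
  rewrite ea et cats0 map_id.
  apply: exec_eq; first apply: transferP; rewrite ?size_put // ?nth_put ?size_put //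
     ?(negbTE ra) ?(negbTE rt) ?er0 ?(negbTE ta) ?eqxx ?size_rev ?size_map ?addn0 //.
  congr State; rewrite cats0 map_rev revK -map_comp.
  have -> : [seq ((fun x => ec (Some (inl (us x)))) \o sy) x | x <- w] =
            [seq ec (Some (inl x)) | x <- w] by apply: eq_map => x /=; rewrite syK.
  apply: (@eq_from_nth _ [::]); rewrite ?size_put // => j _; rewrite !nth_put ?size_put //.
  have [ej|_] := eqVneq j t; last by case: (j == rreg k); case: (j == a).
  by rewrite ej (negbTE tr) (negbTE ta) et.
have [|||||||R' [ex s' e']] := IH ws k.+1 R1; rewrite ?s1 //.
- by rewrite /= ts.
- by rewrite /= tb.
- by rewrite n1 (negbTE ta) /rreg; case: eqP => //; [lia|rewrite andbF].
- rewrite -es; apply/eq_in_map => r rs; rewrite n1.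
  have rb : r < base by exact: (allP sb).
  have [ra|_] := eqVneq r a; first by rewrite ra (negbTE a_s) in rs.
  by rewrite /rreg; case: eqP; [lia|rewrite andbF].
- move=> r rr; rewrite n1; case: eqP => // _.
  by rewrite /rreg; case: eqP; [lia|rewrite andbF => _; apply: er; lia].
exists R'; split; [by apply: ExecSeq ex1 ex|by rewrite s' s1|].
move=> r; rewrite e' in_cons n1; have [rea|ra] := eqVneq r a => /=.
  case: ifP => //; case: ifP => // rr; lia.
case: ifP => // _; have [rk|rk] := eqVneq r (rreg k).
  rewrite andbT rk /rreg; have -> : base + ntape + k.+1 <= base + ntape + k = false by lia.
  rewrite subnn /=; case: ifP => kn.
    by rewrite leqnn /= ltn_add2l kn.
  by rewrite leqnn /= ltn_add2l kn.
rewrite andbF; rewrite /rreg in rk.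
have [rl|rl] := leqP (base + ntape + k.+1) r.
  have -> : base + ntape + k <= r by lia.
  by case: ifP => //= _; have -> : r - (base + ntape + k) = (r - (base + ntape + k.+1)).+1 by
      lia.
by have -> : base + ntape + k <= r = false by lia.
Qed.

Definition wipe (R : seq (seq Sg)) (s : seq nat) :=
  foldr (fun a R => put R a [::]) R s.

Lemma size_wipe R s : size (wipe R s) = size R.
Proof. by elim: s => //= a s; rewrite size_put. Qed.

Lemma nth_wipe R s r : all (fun a => a < size R) s ->
  nth [::] (wipe R s) r = if r \in s then [::] else nth [::] R r.
Proof.
elim: s => //= a s IH /andP[aR sR]; rewrite nth_put ?size_wipe // in_cons IH //.
by case: eqP.
Qed.

(** The registers from [base] on are empty again after a call, so successive calls of different
    machines can share them. *)
Lemma callP s ws dest t out b i R ad o :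
  evaluates N ws out b -> b + 2 <= B -> all (fun w => size w <= B) ws ->
  uniq [:: dest, t, D, O & s] -> all (fun a => a < base) [:: dest, t & s] ->
  base + ntape + ntape <= size R -> all (@nilp _) (drop base R) ->
  [seq nth [::] R a | a <- [:: dest; t; D; O]] = nseq 4 [::] ->
  [seq nth [::] R a | a <- s] = map (map sy) ws ->
  exec (call s dest t) (State i R ad o)
    (State i (put (wipe R s) dest (map sy out)) ad o).
Proof.
move=> ev bB wB us_ ab sR tl [edst et eD eO] es.
have tail r : base <= r -> nth [::] R r = [::].
  move=> br; rewrite -(subnKC br) -nth_drop; apply/nilP.
  have [l|l] := ltnP (r - base) (size (drop base R)); first exact: all_nthP.
  by rewrite nth_default.
move: us_; rewrite /= !in_cons !negb_or -!andbA => /and5P[dt dD dO ds /and5P[tD tO ts _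
    /and3P[Ds Os us_]]].
case/and3P: ab => db tb sb.
have sR' : all (fun a => a < size R) s by apply: sub_all sb => a; lia.
have [|||||||R' [ex s' e']] := @loadsP s ws 0 t i R ad o; rewrite //= ?ts ?tb //.
  by move=> r rr; apply: tail; lia.
pose R1 := put (wipe R s) O (rev (map sy out)).
have [|||||||ex1 ob] := @simulateP R' b _ bB ws out i ad o R1 ev; rewrite ?s' //.
- by rewrite e' (negbTE Ds) eD; case: ifP => //; lia.
- by rewrite e' (negbTE Os) eO; case: ifP => //; lia.
- move=> k; rewrite e' tail /lreg; last lia.
  by case: ifP => // _; case: ifP => //; have := ltn_ord k; lia.
- move=> k; rewrite e' /rreg; have := ltn_ord k => kn.
  have -> : base + ntape + k \in s = false.
    by apply/negP => /(allP sb); lia.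
  by rewrite ifT; [rewrite addn0 addKn|lia].
- by rewrite size_put size_wipe.
- move=> r; rewrite nth_put ?size_wipe ?nth_wipe ?e' //; last lia.
  have [rb|rb] := boolP (base <= r < base + ntape + ntape).
    have -> : r == O = false by lia.
    by case: ifP => // _; rewrite tail //; lia.
  have -> : base + ntape + 0 <= r < base + ntape + ntape = false by lia.
  by case: (r == O); case: (r \in s).
apply: ExecSeq; first exact: ex.
apply: ExecSeq; first exact: ex1.
have Od : O != dest by rewrite eq_sym.
have dR : dest < size R by lia. have OR : O < size R by lia.
apply: exec_eq; first apply: transferP; rewrite ?size_put ?size_wipe // ?nth_put ?size_wipe
    ?eqxx //
  ?(negbTE dO) ?nth_wipe ?(negbTE ds) ?edst ?size_rev ?size_map ?addn0 //.
  by lia.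
rewrite map_id revK cats0; congr State.
apply: (@eq_from_nth _ [::]); rewrite ?size_put // => j _.
rewrite !nth_put ?size_put ?size_wipe // nth_wipe //.
have [ej|_] := eqVneq j O; last by case: (j == dest).
by rewrite ej (negbTE Od) (negbTE Os) eO.
Qed.

End Simulation.

(** * The traceback program *)

Lemma lg_half n : 1 < n -> lg n = (lg n./2).+1.
Proof.
move=> n1; rewrite /lg; congr _.+1.
have n0 : 0 < n by lia. have h0 : 0 < n./2 by rewrite half_gt0.
have [a b] := andP (trunc_log_bounds (ltnSn 1) h0).
apply: trunc_log_eq => //; rewrite !expnS; rewrite expnS in b.
have := odd_double_half n; lia.
Qed.

Lemma size_bits n : size (bits n) = lg n.
Proof. exact: size_mkseq. Qed.

(** Turns the positional definition into a recursion on the lowest digit, the form followed by [num]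
    and [incr]. *)
Lemma bits_half n : 1 < n -> bits n = odd n :: bits n./2.
Proof.
move=> n1; apply: (@eq_from_nth _ false) => [|i].
  by rewrite -cat1s size_cat !size_bits lg_half.
rewrite size_bits => il; rewrite nth_mkseq //; case: i il => [|i] il /=.
  by rewrite expn0 divn1.
by rewrite nth_mkseq ?expnS ?divnMA ?divn2 //; rewrite lg_half in il.
Qed.

Lemma num_bits n : num (bits n) = n.
Proof.
elim/ltn_ind: n => -[|[|n]] // IH; rewrite bits_half //.
rewrite -[LHS]/(odd n.+2 + (num (bits n.+2./2)).*2) IH ?odd_double_half //.
by rewrite ltn_half_double; lia.
Qed.

Lemma bits_inj : injective bits.
Proof. exact: can_inj num_bits. Qed.

(** Holds from [bits 0 = [:: false]] on, so a counter started at that numeral runs through exactly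
    the numerals used in the input, and numbers can be compared symbol by symbol. *)
Lemma bitsS n : bits n.+1 = incr (bits n).
Proof.
elim/ltn_ind: n => -[|[|n]] // IH; rewrite bits_half // [in RHS]bits_half //.
have -> : n.+3./2 = odd n.+2 + n.+2./2 by rewrite -uphalf_half.
rewrite oddS; case: (odd n.+2) => //=; rewrite add1n IH //.
lia.
Qed.

Lemma leq_lg m n : m <= n -> lg m <= lg n.
Proof. by move=> mn; rewrite ltnS leq_trunc_log. Qed.

Section TakeWord.
Variables (A Sg : finType) (sy : sym A -> Sg) (us : Sg -> sym A).
Hypothesis syK : cancel sy us.

(** Counterpart of [read_word] for a word stored in a register and ended by a flag. *)
Definition take_word a d t : prog A Sg :=
  Seq (While (fun v => top v a != Some (flag sy))
         (Seq (push_top A id a t) (pop A Sg a)))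
  (Seq (pop A Sg a) (transfer A id t d)).

Lemma take_wordP blocks B a d t w s i R ad o :
  a != d -> a != t -> d != t -> a < size R -> d < size R -> t < size R ->
  nth [::] R t = [::] -> nth [::] R a = map sy w ++ flag sy :: s -> nosep w ->
  size w + size (nth [::] R d) <= B ->
  exec blocks B (take_word a d t) (State i R ad o)
    (State i (put (put R a s) d (map sy w ++ nth [::] R d)) ad o).
Proof.
move=> an at_ dt aR dR tR et ea ns sB.
have ta : t != a by rewrite eq_sym. have da : d != a by rewrite eq_sym.
have loop u v R1 : size R1 = size R -> nth [::] R1 a = map sy u ++ flag sy :: s ->
    nth [::] R1 t = v -> nosep u -> size u + size v <= B ->
    exec blocks B (While (fun v => top v a != Some (flag sy))
         (Seq (push_top A id a t) (pop A Sg a))) (State i R1 ad o)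
      (State i (put (put R1 a (flag sy :: s)) t (rev (map sy u) ++ v)) ad o).
  elim: u v R1 => [|x u IH] v R1 sz e1 e2 /= nu sv.
    rewrite /= in e1 *; rewrite -e1 -e2 put_id put_id; apply: ExecDone.
    by rewrite top_view e1 /= eqxx.
  case/andP: nu => xs nu; apply: ExecLoop.
  - rewrite top_view e1 /=; apply/eqP => -[] /(can_inj syK) ex.
    by rewrite ex in xs.
  - apply: ExecSeq; first by apply: push_topP e1 _; rewrite ?sz // e2; lia.
    by apply: popP; rewrite size_put sz.
  apply: exec_eq; first apply: (IH (sy x :: v)); rewrite ?size_put //.
  - by rewrite !nth_put ?size_put ?sz // eqxx (negbTE at_) e1.
  - by rewrite !nth_put ?size_put ?sz // (negbTE ta) eqxx e2.
  - by rewrite /=; lia.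
  congr State; rewrite rev_cons cat_rcons; apply: (@eq_from_nth _ [::]);
    rewrite ?size_put // => j _; rewrite !nth_put ?size_put ?sz //.
  by case: (j == t); case: (j == a).
apply: ExecSeq; first by apply: loop ea et ns _ => //=; lia.
apply: ExecSeq; first by apply: popP; rewrite !size_put.
rewrite !nth_put ?size_put // (negbTE at_) eqxx cats0 /=.
apply: exec_eq; first apply: transferP; rewrite ?size_put // 1?eq_sym // ?nth_put ?size_put
    // ?(negbTE da) ?(negbTE dt) ?(negbTE ta) ?eqxx ?size_rev ?size_map //.
rewrite map_id revK; congr State; apply: (@eq_from_nth _ [::]);
  rewrite ?size_put // => j _; rewrite !nth_put ?size_put //.
have [ej|_] := eqVneq j t; last by case: (j == d); case: (j == a).
by rewrite ej [t == d]eq_sym (negbTE dt) (negbTE ta) et.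
Qed.

End TakeWord.

(** * Alphabet, register layout and program text *)

Section Program.
Variables (A : finType) (ops : word_ops A).

(* Cells of the tapes of [N], and entries of the register that drives the
   simulation of [N]. *)
Definition op_sym (N : machine A) : finType :=
  (cell A (tm_priv N) +
   tm_state N * {ffun 'I_(tm_aux N).+1 -> cell A (tm_priv N)})%type.

Definition prog_sym : finType :=
  (sym A + (op_sym (wo_zero ops) + (op_sym (wo_le ops) + op_sym (wo_mul ops))))%type.

Notation Sg := prog_sym.

Definition sy (a : sym A) : Sg := inl a.
Definition us (x : Sg) : sym A := if x is inl a then a else sep.
Lemma syK : cancel sy us. Proof. by []. Qed.

Section OpSymbols.
Variables (N : machine A) (emb : op_sym N -> Sg) (prj : Sg -> option (op_sym N)).
Hypothesis embK : pcancel emb prj.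

Definition ecell (x : cell A (tm_priv N)) : Sg := emb (inl x).
Definition decode_cell (s : Sg) : cell A (tm_priv N) :=
  if prj s is Some (inl x) then x else None.
Definition edec (d : tm_state N * {ffun 'I_(tm_aux N).+1 -> cell A (tm_priv N)}) : Sg :=
  emb (inr d).
Definition ddec (s : Sg) : tm_state N * {ffun 'I_(tm_aux N).+1 -> cell A (tm_priv N)} :=
  if prj s is Some (inr d) then d else (tm_start N, blank N).

Lemma ecellK : cancel ecell decode_cell.
Proof. by move=> x; rewrite /decode_cell embK. Qed.

Lemma edecK : cancel edec ddec.
Proof. by move=> x; rewrite /ddec embK. Qed.
End OpSymbols.

Definition zero_emb (x : op_sym (wo_zero ops)) : Sg := inr (inl x).
Definition zero_prj (s : Sg) := if s is inr (inl x) then Some x else None.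
Definition le_emb (x : op_sym (wo_le ops)) : Sg := inr (inr (inl x)).
Definition le_prj (s : Sg) := if s is inr (inr (inl x)) then Some x else None.
Definition mul_emb (x : op_sym (wo_mul ops)) : Sg := inr (inr (inr x)).
Definition mul_prj (s : Sg) := if s is inr (inr (inr x)) then Some x else None.

Notation nbase := 25.
Notation rD := 23.
Notation rO := 24.

Definition call_op (N : machine A) (emb : op_sym N -> Sg) (prj : Sg -> option (op_sym N)) :=
  call sy us (ecell emb) (decode_cell prj) (edec emb) (ddec prj) nbase rD rO.

(** All three simulations use the registers from 25 on; the sum of their needs, two stacks per tape,
    is a common upper bound. *)
Definition ntapes : nat :=
  ((tm_aux (wo_zero ops)).+1 + (tm_aux (wo_le ops)).+1 + (tm_aux (wo_mul ops)).+1).*2.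

Definition nreg : nat := nbase + ntapes.

(** [rEll] is the vertex reached by the sweep and [rNext] its successor. [rVal] and [rBest] hold the
    largest product so far and the in-neighbour that gives it. [rU], [rW], [rX], [rP] are an
    in-neighbour, the edge weight, the value of the in-neighbour and the product. [rKey] and [rWord]
    hold the table entry in hand, [rPassed] the entries already passed, reversed; [rF] is the result
    of a test. *)
Notation rT := 0.
Notation rTarget := 1.
Notation rCur := 2.
Notation rLast := 3.
Notation rRun := 4.
Notation rEll := 5.
Notation rSweep := 6.
Notation rTable := 7.
Notation rVal := 8.
Notation rBest := 9.
Notation rSrc := 10.
Notation rU := 11.
Notation rW := 12.
Notation rX := 13.
Notation rP := 14.
Notation rF := 15.
Notation rPassed := 16.
Notation rNext := 17.
Notation rKey := 18.
Notation rWord := 19.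
Notation t1 := 20.
Notation t2 := 21.
Notation t3 := 22.

Notation prog := (prog A Sg).
Notation "p ;; q" := (Seq p q) (at level 61, right associativity).
Notation fl := (flag sy).
Notation copy := (copy A Sg).
Notation relay := (relay A Sg).
Notation clear := (clear A Sg).
Notation pop := (pop A Sg).
Notation push := (push A).
Notation move := (transfer A (@id Sg)).
Notation skip := (Prim (Skip A Sg)).

(** A call empties its operand registers, hence the copy of [rT]. *)
Definition zero_prog : prog :=
  copy rT t2 t1 ;; call_op zero_emb zero_prj [:: t2] rVal t1.

Definition mul_prog : prog :=
  copy rT t2 t1 ;; call_op mul_emb mul_prj [:: t2; rX; rW] rP t1.

Definition le_prog : prog :=
  copy rT t2 t1 ;; copy rP rKey t1 ;; copy rVal rWord t1 ;;
  call_op le_emb le_prj [:: t2; rKey; rWord] rF t1.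

Definition read_entry : prog :=
  take_word sy rTable rKey t1 ;; take_word sy rTable rWord t1.

(** Key and value are pushed reversed, each followed by its flag, so [rPassed] is exactly a reversed
    table and a single [move] restores the order. *)
Definition write_entry : prog :=
  move rKey rPassed ;; push rPassed fl ;; move rWord rPassed ;; push rPassed fl.

Definition same_words a b f : prog :=
  copy a t2 t1 ;; copy b t3 t1 ;; eq_clear sy t2 t3 f.

Definition lookup_entry : prog :=
  read_entry ;; same_words rKey rU rF ;;
  If (@filled A Sg rF) (pop rF ;; copy rWord rX t1) skip ;; write_entry.

Definition lookup : prog :=
  While (@filled A Sg rTable) lookup_entry ;; move rPassed rTable.

Definition scan_edge : prog :=
  read_word sy t2 t1 ;; skip_word A Sg ;; copy rKey t3 t1 ;; eq_clear sy t2 t3 rX ;;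
  If (@filled A Sg rX)
    (pop rX ;; Prim (Do rF (fun v => if filled rF v then Keep Sg else Push fl))) skip.

Definition scan_vertex : prog :=
  advance A Sg ;; advance A Sg ;; skip_word A Sg ;;
  While (@in_word A Sg) scan_edge ;; advance A Sg.

Definition scan_vertices : prog :=
  While (fun v => isSome v.1) scan_vertex.

Definition prune_entry : prog :=
  read_entry ;; seek sy rNext t1 t2 ;; scan_vertices ;;
  If (@filled A Sg rF) (pop rF ;; write_entry) (clear rKey ;; clear rWord).

Definition prune : prog :=
  copy rEll rNext t1 ;; increment sy rNext t1 ;;
  While (@filled A Sg rTable) prune_entry ;;
  clear rNext ;; move rPassed rTable.

(* The first product is not compared with zero, whose encoding need not be a
   machine word. *)
Definition edge_prog : prog :=
  read_word sy rU t1 ;; read_word sy rW t1 ;; lookup ;; mul_prog ;;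
  If (@filled A Sg rBest) le_prog skip ;;
  If (fun v => top v rF == Some (bsy sy true))
    (pop rF ;; clear rP ;; clear rU)
    (clear rF ;; clear rVal ;; clear rBest ;; relay rP rVal t1 ;; relay rU rBest t1).

(** The block of a non-source has an empty word in the place of the source value, so [rVal] starts
    empty there; [zero_prog] serves a non-source without in-edges. *)
Definition vertex_prog : prog :=
  If (fun v => v.1 == Some (bitsym true)) (push rSrc fl) skip ;;
  advance A Sg ;; advance A Sg ;; read_word sy rVal t1 ;;
  While (@in_word A Sg) edge_prog ;;
  If (fun v => filled rBest v || filled rSrc v) skip zero_prog.

Definition insert_entry : prog :=
  push rTable fl ;; relay rVal rTable t1 ;; push rTable fl ;; copy rEll rTable t1.

Definition sweep_body : prog :=
  increment sy rEll t1 ;; seek sy rEll t1 t2 ;; vertex_prog ;; same_words rEll rCur rF ;;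
  If (@filled A Sg rF)
    (pop rF ;; pop rSweep ;; clear rEll ;; clear rTable ;; clear rVal)
    (insert_entry ;; clear rBest ;; clear rSrc ;; prune).

Definition sweep : prog :=
  push rSweep fl ;; push rEll (bsy sy false) ;; While (@filled A Sg rSweep) sweep_body.

Definition output_cur : prog :=
  clear rBest ;; emit us rCur t1 t2 ;; clear rLast ;; copy rCur rLast t1 ;;
  same_words rCur rTarget rF ;;
  If (@filled A Sg rF) (pop rF ;; pop rRun) (clear rCur ;; copy rTarget rCur t1).

(* [rBest] is empty when [rCur] has no witness predecessor: it is then a source
   (flagged in [rSrc]), or there is no traceback and the program stops. *)
Definition main_body : prog :=
  sweep ;;
  If (fun v => filled rBest v || filled rSrc v)
    (clear rSrc ;; same_words rBest rLast rF ;;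
     If (@filled A Sg rF) (pop rF ;; output_cur) (clear rCur ;; relay rBest rCur t1))
    (pop rRun).

Definition traceback_prog : prog :=
  read_word sy rT t1 ;; read_word sy rTarget t1 ;; copy rTarget rCur t1 ;;
  push rRun fl ;; While (@filled A Sg rRun) main_body.

End Program.

(** * Correctness of the traceback program *)

Section Correctness.
Variables (A : finType) (ops : word_ops A) (cw c e : nat).
Variables (disp : Order.disp_t) (S : max_semiring disp) (enc : S -> seq A).
Variables (T : nat) (I : dp_instance S T) (t : 'I_T).
Hypothesis impl : implements ops enc cw c e T.
Hypothesis words : words_ok I enc cw.
Variable B : nat.
Hypotheses (hL : lg T + 2 <= B) (hW : cw * lg T <= B) (hb : c * lg T ^ e + 2 <= B).
(** One entry more than the frontier width, because a vertex is inserted before the table is pruned;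
    an entry is a number, a value and two flags. *)
Hypothesis hT : (frontier_width I).+1 * (lg T + cw * lg T + 2) <= B.

Notation Sg := (prog_sym ops).
Notation sy := (@sy A ops).
Notation us := (@us A ops).
Notation syK := (@syK A ops).
Notation fl := (flag sy).
Notation blocks := (encode_instance I enc t).
Notation exec := (@exec A Sg blocks B).
Notation x_ := (dp_val I).

Implicit Types (i o : seq (sym A)) (u v w k : 'I_T) (s : seq 'I_T).

Definition numw (n : nat) : seq Sg := map sy (symbits A n).
Definition wd (a : S) : seq Sg := map sy (map charsym (enc a)).
Definition entry v : seq Sg := numw v.+1 ++ fl :: wd (x_ v) ++ [:: fl].
Definition table s : seq Sg := flatten [seq entry v | v <- s].

(* Registers 20 to 24 and those of the simulated tapes are empty between the
   steps of the program. *)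
Definition st i o (r0 r1 r2 r3 r4 r5 r6 r7 r8 r9 r10 r11 r12 r13 r14 r15 r16 r17 r18
    r19 : seq Sg) : state A Sg :=
  State i [:: r0, r1, r2, r3, r4, r5, r6, r7, r8, r9, r10, r11, r12, r13, r14, r15,
    r16, r17, r18, r19, [::], [::], [::], [::], [::] & nseq (ntapes ops) [::]] [::] o.

Lemma numw_def n : numw n = map sy (symbits A n).
Proof. by []. Qed.

Lemma wd_def a : wd a = map sy (map charsym (enc a)).
Proof. by []. Qed.

Lemma table_cons v s : table (v :: s) = entry v ++ table s.
Proof. by []. Qed.

Lemma numwE n : numw n = map (bsy sy) (bits n).
Proof. by rewrite /numw /symbits -map_comp. Qed.

Lemma size_symbits n : size (symbits A n) = lg n.
Proof. by rewrite size_map size_bits. Qed.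

Lemma symbits_cons n : exists x l, symbits A n = Some x :: l.
Proof. by do 2!eexists. Qed.

Lemma numw0 : numw 0 = [:: bsy sy false].
Proof. by []. Qed.

Lemma nregE : nseq (nreg ops) (@nil Sg) = nseq 25 [::] ++ nseq (ntapes ops) [::].
Proof. by []. Qed.

Lemma ntapes_ge : [/\ (tm_aux (wo_zero ops)).+1.*2 <= ntapes ops,
  (tm_aux (wo_le ops)).+1.*2 <= ntapes ops & (tm_aux (wo_mul ops)).+1.*2 <= ntapes ops].
Proof. by rewrite /ntapes; split; lia. Qed.

Lemma numw_inj : injective numw.
Proof.
move=> m n; rewrite !numwE => /inj_map e_; apply: bits_inj; apply: e_.
exact: (bsy_inj syK).
Qed.

Lemma eq_numw u v : (numw u.+1 == numw v.+1) = (u == v).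
Proof. by rewrite (inj_eq numw_inj) eqSS. Qed.

Lemma size_numw n : size (numw n) = lg n.
Proof. by rewrite numwE size_map size_bits. Qed.

Lemma size_vertex v : lg v.+1 <= lg T.
Proof. by apply: leq_lg; apply: ltn_ord. Qed.

Lemma size_wd a : is_word enc cw T a -> size (wd a) <= cw * lg T.
Proof. by rewrite /wd !size_map. Qed.

Lemma nosep_bits n : nosep (symbits A n).
Proof. by rewrite /nosep /symbits all_map; apply/allP. Qed.

Lemma nosep_enc a : nosep (map (@charsym A) (enc a)).
Proof. by rewrite /nosep all_map; apply/allP. Qed.

Lemma word_val v : is_word enc cw T (x_ v).
Proof. by case: words. Qed.

Lemma size_val v : size (wd (x_ v)) <= cw * lg T.
Proof. exact: size_wd (word_val v). Qed.

Lemma size_table s : size (table s) <= size s * (lg T + cw * lg T + 2).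
Proof.
elim: s => // v s IH; rewrite table_cons size_cat mulSn leq_add //.
rewrite size_cat -cat1s !size_cat size_numw !addn1 add1n.
have := size_vertex v; have := size_val v; lia.
Qed.

Lemma call_opP (N : machine A) (emb : op_sym N -> Sg) (prj : Sg -> option (op_sym N))
    (rs : seq nat) ws (dest tt : nat) out b i R ad o :
  pcancel emb prj -> evaluates N ws out b -> b + 2 <= B ->
  all (fun z : seq (sym A) => size z <= B) ws ->
  uniq [:: dest, tt, 23, 24 & rs] -> all (fun a => a < 25) [:: dest, tt & rs] ->
  25 + (tm_aux N).+1.*2 <= size R -> all (@nilp _) (drop 25 R) ->
  [seq nth [::] R a | a <- [:: dest; tt; 23; 24]] = nseq 4 [::] ->
  [seq nth [::] R a | a <- rs] = map (map sy) ws ->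
  exec (call_op emb prj rs dest tt) (State i R ad o)
    (State i (put (wipe R rs) dest (map sy out)) ad o).
Proof.
move=> eK ev bB wB us_ ab sR tl e1 e2.
apply: (callP syK (ecellK eK) (edecK eK) (isT : 23 != 24) (isT : 23 < 25) (isT : 24 < 25) _ _
    _ _ ev bB) => //.
by rewrite -addnA addnn.
Qed.

#[local] Opaque numw wd entry table lg flag bsy ntapes prog_sym symbits.

Lemma same_wordsP a b f i R ad o :
  uniq [:: a; b; f; 20; 21; 22] -> all (fun r => r < size R) [:: a; b; f; 20; 21; 22] ->
  [seq nth [::] R r | r <- [:: f; 20; 21; 22]] = nseq 4 [::] ->
  size (nth [::] R a) <= B -> size (nth [::] R b) <= B ->
  exec (same_words ops a b f) (State i R ad o)
    (State i (put R f (if nth [::] R a == nth [::] R b then [:: fl] else [::])) ad o).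
Proof.
rewrite /= !in_cons !negb_or !in_nil /= !andbT.
move=> /and3P[/and5P[ab af a1 a2 a3] /and4P[bf b1 b2 b3] /and3P[f1 f2 f3]].
move=> /and5P[aR bR fR R1 /andP[R2 R3]] [ef e1 e2 e3] sa sb.
have sym (x y : nat) : x != y -> y != x by rewrite eq_sym.
apply: ExecSeq; first by apply: copyP; rewrite // e2 addn0.
rewrite e2 cats0.
apply: ExecSeq.
  by apply: copyP; rewrite ?size_put // !nth_put // ?e1 ?e3 /= ?(negbTE b2) ?addn0.
rewrite !nth_put // (negbTE b2) /= e3 cats0.
apply: exec_eq.
  apply: eq_clearP; rewrite ?size_put //; try by rewrite sym.
    by rewrite !nth_put ?size_put // (negbTE f2) (negbTE f3).
  by lia.
rewrite !nth_put ?size_put //=; congr State.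
apply: (@eq_from_nth _ [::]); rewrite ?size_put // => j _; rewrite !nth_put ?size_put //.
case: eqP => // _; case: (j =P 22) => [->|_] //.
by case: (j =P 21) => [->|_].
Qed.

Ltac side := rewrite /= ?size_nseq ?cats0 ?addn0; try done; try lia.
(** Executes one instruction on an explicit register list, where [put] and [nth] reduce by
    computation; the words themselves are opaque and stay untouched. *)
Ltac run L := apply: ExecSeq; [eapply L; side|rewrite /= ?cats0].

(** * Calls of the semiring machines *)

Lemma mul_progP i o r0 r1 r2 r3 r4 r5 r6 r7 r8 r9 r10 r11 r15 r16 r17 r18 r19 a b :
  r0 = numw T -> is_word enc cw T a -> is_word enc cw T b ->
  exec (mul_prog ops)
   (st i o r0 r1 r2 r3 r4 r5 r6 r7 r8 r9 r10 r11 (wd b) (wd a) [::] r15 r16 r17 r18 r19)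
   (st i o r0 r1 r2 r3 r4 r5 r6 r7 r8 r9 r10 r11 [::] [::] (wd (ms_mul a b)) r15 r16 r17 r18
       r19).
Proof.
move=> e0 wa wb; have [_ _ /(_ a b wa wb) ev] := impl; rewrite /st.
have s0 : size r0 <= lg T by rewrite e0 size_numw.
have sa := size_wd wa. have sb := size_wd wb.
run copyP.
apply: exec_eq; first eapply (call_opP (b := c * lg T ^ e)); try exact: ev; side.
- by rewrite !wd_def !size_map in sa sb; rewrite size_symbits !size_map; lia.
- by case: ntapes_ge; lia.
- by rewrite ?drop0 all_nseq orbT.
- by rewrite e0 numw_def !wd_def.
Qed.

Lemma zero_progP i o r0 r1 r2 r3 r4 r5 r6 r7 r9 r10 r11 r12 r13 r14 r15 r16 r17 r18 r19 :
  r0 = numw T ->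
  exec (zero_prog ops)
   (st i o r0 r1 r2 r3 r4 r5 r6 r7 [::] r9 r10 r11 r12 r13 r14 r15 r16 r17 r18 r19)
   (st i o r0 r1 r2 r3 r4 r5 r6 r7 (wd (ms_zero S)) r9 r10 r11 r12 r13 r14 r15 r16 r17 r18 r19).
Proof.
move=> e0; have [ev _ _] := impl; rewrite /st.
have s0 : size r0 <= lg T by rewrite e0 size_numw.
run copyP.
apply: exec_eq; first eapply (call_opP (b := c * lg T ^ e)); try exact: ev; side.
- by rewrite size_symbits; lia.
- by case: ntapes_ge; lia.
- by rewrite ?drop0 all_nseq orbT.
- by rewrite e0 numw_def.
Qed.

Lemma le_progP i o r0 r1 r2 r3 r4 r5 r6 r7 r9 r10 r11 r12 r13 r16 r17 a b :
  r0 = numw T -> is_word enc cw T a -> is_word enc cw T b ->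
  exec (le_prog ops)
   (st i o r0 r1 r2 r3 r4 r5 r6 r7 (wd b) r9 r10 r11 r12 r13 (wd a) [::] r16 r17 [::] [::])
   (st i o r0 r1 r2 r3 r4 r5 r6 r7 (wd b) r9 r10 r11 r12 r13 (wd a) [:: bsy sy (a <= b)%O]
      r16 r17 [::] [::]).
Proof.
move=> e0 wa wb; have [_ /(_ a b wa wb) ev _] := impl; rewrite /st.
have s0 : size r0 <= lg T by rewrite e0 size_numw.
have sa := size_wd wa. have sb := size_wd wb.
run copyP. run copyP. run copyP.
apply: exec_eq; first eapply (call_opP (b := c * lg T ^ e)); try exact: ev; side.
- by rewrite !wd_def !size_map in sa sb; rewrite size_symbits !size_map; lia.
- by case: ntapes_ge; lia.
- by rewrite ?drop0 all_nseq orbT.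
- by rewrite e0 numw_def !wd_def.
Qed.

(** * Table lookup and pruning *)

Lemma entry_def v : entry v = map sy (symbits A v.+1) ++ fl ::
  map sy (map charsym (enc (x_ v))) ++ [:: fl].
Proof. by []. Qed.

Lemma read_entryP i o r0 r1 r2 r3 r4 r5 r6 tb r8 r9 r10 r11 r12 r13 r14 r15 r16 r17 v :
  exec (read_entry ops)
   (st i o r0 r1 r2 r3 r4 r5 r6 (entry v ++ tb) r8 r9 r10 r11 r12 r13 r14 r15 r16 r17 [::] [::])
   (st i o r0 r1 r2 r3 r4 r5 r6 tb r8 r9 r10 r11 r12 r13 r14 r15 r16 r17
      (numw v.+1) (wd (x_ v))).
Proof.
have sv := size_vertex v; have sx := size_val v; rewrite /st.
rewrite entry_def -catA cat_cons -catA.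
rewrite wd_def !size_map in sx.
apply: ExecSeq.
  eapply (@take_wordP _ _ _ _ syK blocks B _ _ _ (symbits A v.+1)); side; first exact:
      nosep_bits.
  by rewrite size_symbits; lia.
rewrite /= cats0 numw_def.
apply: exec_eq.
  eapply (@take_wordP _ _ _ _ syK blocks B _ _ _ (map charsym (enc (x_ v))) tb); side; first
      exact: nosep_enc.
  by rewrite size_map; lia.
by rewrite /= cats0 wd_def.
Qed.

Lemma write_entryP i o r0 r1 r2 r3 r4 r5 r6 tb r8 r9 r10 r11 r12 r13 r14 r15 r16 r17 v :
  size r16 + size (entry v) <= B ->
  exec (write_entry ops)
   (st i o r0 r1 r2 r3 r4 r5 r6 tb r8 r9 r10 r11 r12 r13 r14 r15 r16 r17
      (numw v.+1) (wd (x_ v)))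
   (st i o r0 r1 r2 r3 r4 r5 r6 tb r8 r9 r10 r11 r12 r13 r14 r15 (rev (entry v) ++ r16) r17
      [::] [::]).
Proof.
rewrite entry_def -numw_def -wd_def size_cat /= size_cat /= => sB; rewrite /st.
run transferP. rewrite map_id.
run pushP.
  by rewrite size_cat size_rev; lia.
run transferP.
  by rewrite size_cat size_rev; lia.
rewrite map_id; apply: exec_eq.
  by eapply pushP; side; rewrite !size_cat /= !size_cat !size_rev; lia.
by rewrite /= rev_cat rev_cons rev_cat /= -cats1 -!catA.
Qed.

Lemma lookup_entryP i o r0 r1 r2 r3 r4 r5 r6 tb r8 r9 r10 r12 X r14 r16 r17 u v :
  size r16 + size (entry v) <= B -> (v = u -> X = [::]) ->
  exec (lookup_entry ops)
   (st i o r0 r1 r2 r3 r4 r5 r6 (entry v ++ tb) r8 r9 r10 (numw u.+1) r12 X r14 [::] r16 r17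
     [::] [::])
   (st i o r0 r1 r2 r3 r4 r5 r6 tb r8 r9 r10 (numw u.+1) r12
     (if v == u then wd (x_ u) else X) r14 [::] (rev (entry v) ++ r16) r17 [::] [::]).
Proof.
move=> sB eX; have sv := size_vertex v; have su := size_vertex u; have sx := size_val v.
apply: ExecSeq; first exact: read_entryP.
rewrite /st; run same_wordsP; [by rewrite size_numw; lia|by rewrite size_numw; lia|].
rewrite eq_numw; case: eqP => [vu|_].
  apply: (@ExecSeq _ _ _ _ _ _ _ (st i o r0 r1 r2 r3 r4 r5 r6 tb r8 r9 r10 (numw u.+1) r12
     (wd (x_ u)) r14 [::] r16 r17 (numw v.+1) (wd (x_ v)))); last exact: write_entryP.
  apply: ExecIf; rewrite filled_view /= (eX vu).
  run popP.
  apply: exec_eq; first by eapply copyP; side.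
  by rewrite /= cats0 vu.
apply: (@ExecSeq _ _ _ _ _ _ _ (st i o r0 r1 r2 r3 r4 r5 r6 tb r8 r9 r10 (numw u.+1) r12
     X r14 [::] r16 r17 (numw v.+1) (wd (x_ v)))); last exact: write_entryP.
apply: ExecIf; rewrite filled_view /=; exact: ExecPrim.
Qed.

(** The scan goes on after a hit; as the keys are distinct, [rX] is filled only once. *)
Lemma lookupP i o r0 r1 r2 r3 r4 r5 r6 r8 r9 r10 r12 r14 r17 s u :
  uniq s -> u \in s -> size (table s) <= B ->
  exec (lookup ops)
   (st i o r0 r1 r2 r3 r4 r5 r6 (table s) r8 r9 r10 (numw u.+1) r12 [::] r14 [::] [::] r17
     [::] [::])
   (st i o r0 r1 r2 r3 r4 r5 r6 (table s) r8 r9 r10 (numw u.+1) r12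
     (wd (x_ u)) r14 [::] [::] r17 [::] [::]).
Proof.
move=> us_ u_s sB.
have loop s' : forall X tb2, uniq s' -> (u \in s' -> X = [::]) -> size tb2 + size (table s')
    <= B ->
  exec (While (@filled A Sg 7) (lookup_entry ops))
   (st i o r0 r1 r2 r3 r4 r5 r6 (table s') r8 r9 r10 (numw u.+1) r12 X r14 [::] tb2 r17
     [::] [::])
   (st i o r0 r1 r2 r3 r4 r5 r6 [::] r8 r9 r10 (numw u.+1) r12
     (if u \in s' then wd (x_ u) else X) r14 [::] (rev (table s') ++ tb2) r17 [::] [::]).
  elim: s' => [|v s' IH] X tb2 /=; first by move=> _ _ _; apply: ExecDone; rewrite filled_view.
  case/andP=> vs us' eX; rewrite table_cons size_cat => sB'.
  apply: ExecLoop.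
  - by rewrite filled_view /= entry_def; case: (symbits _ _).
  - apply: lookup_entryP; first lia.
    by move=> vu; apply: eX; rewrite vu mem_head.
  apply: exec_eq; first apply: IH => //.
  - case: eqP => [<-|_ us'']; first by rewrite (negbTE vs).
    by apply: eX; rewrite in_cons us'' orbT.
  - by rewrite size_cat size_rev; lia.
  rewrite in_cons [u == v]eq_sym rev_cat catA; case: eqP => //= <-.
  by rewrite (negbTE vs).
apply: ExecSeq; first by apply: loop.
rewrite u_s cats0 /st.
apply: exec_eq; first by eapply transferP; side; rewrite size_rev.
by rewrite /= map_id revK cats0.
Qed.

Definition bfl (b : bool) : seq Sg := if b then [:: fl] else [::].

Lemma scan_edgeP i o r0 r1 r2 r3 r4 r5 r6 r7 r8 r9 r10 r11 r12 r14 b r16 r17 r19 k u v :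
  dd_edge I u v ->
  exec (scan_edge ops)
   (st (encode_edge I enc v u ++ i) o r0 r1 r2 r3 r4 r5 r6 r7 r8 r9 r10 r11 r12 [::] r14 (bfl b)
      r16 r17 (numw k.+1) r19)
   (st i o r0 r1 r2 r3 r4 r5 r6 r7 r8 r9 r10 r11 r12 [::] r14 (bfl (b || (u == k)))
      r16 r17 (numw k.+1) r19).
Proof.
move=> uv; have su := size_vertex u; have sk := size_vertex k.
have ww : is_word enc cw T (di_weight I u v) by case: words => _ _ + _; apply.
rewrite /is_word in ww; rewrite /st /encode_edge -catA cat_cons -catA.
run read_wordP.
- exact: nosep_bits.
- by rewrite size_symbits; lia.
run skip_wordP; first exact: nosep_enc.
rewrite -numw_def; have := size_numw k.+1 => sz.
run copyP.
run eq_clearP.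
rewrite eq_numw; case: eqP => _.
  apply: ExecIf; rewrite filled_view /=; run popP.
  apply: exec_eq; first by eapply doP; side; rewrite filled_view /=; case: (b) => //=; lia.
  by cbv beta; rewrite filled_view orbT; case: b.
by rewrite orbF; apply: ExecIf; rewrite filled_view /=; apply: ExecPrim.
Qed.

Lemma mem_adj u v : (u \in adj I v) = dd_edge I u v.
Proof. by rewrite mem_sort mem_enum. Qed.

Lemma scan_vertexP i o r0 r1 r2 r3 r4 r5 r6 r7 r8 r9 r10 r11 r12 r14 b r16 r17 r19 k v :
  exec (scan_vertex ops)
   (st (encode_vertex I enc v ++ i) o r0 r1 r2 r3 r4 r5 r6 r7 r8 r9 r10 r11 r12 [::] r14 (bfl b)
      r16 r17 (numw k.+1) r19)
   (st i o r0 r1 r2 r3 r4 r5 r6 r7 r8 r9 r10 r11 r12 [::] r14 (bfl (b || dd_edge I k v))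
      r16 r17 (numw k.+1) r19).
Proof.
rewrite /encode_vertex -!catA !cat_cons -!catA.
apply: ExecSeq; first exact: ExecPrim.
apply: ExecSeq; first exact: ExecPrim.
apply: ExecSeq; first (apply: skip_wordP; case: ifP => // _; exact: nosep_enc).
have loop l : forall b', all (fun u => dd_edge I u v) l ->
  exec (While (@in_word A Sg) (scan_edge ops))
   (st (flatten [seq encode_edge I enc v u | u <- l] ++ sep :: i) o r0 r1 r2 r3 r4 r5 r6 r7
       r8 r9
      r10 r11 r12 [::] r14 (bfl b') r16 r17 (numw k.+1) r19)
   (st (sep :: i) o r0 r1 r2 r3 r4 r5 r6 r7 r8 r9
      r10 r11 r12 [::] r14 (bfl (b' || (k \in l))) r16 r17 (numw k.+1) r19).
  elim: l => [|u l IH] b'; first by move=> _; rewrite in_nil orbF; apply: ExecDone.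
  rewrite -[flatten _]/(encode_edge I enc v u ++ flatten [seq encode_edge I enc v u | u <- l]).
  rewrite -catA => /andP[uv lv]; apply: ExecLoop.
  - by rewrite /encode_edge; have [x [w' ->]] := symbits_cons u.+1.
  - exact: scan_edgeP.
  apply: exec_eq; first exact: IH.
  by rewrite in_cons [k == u]eq_sym orbA.
apply: ExecSeq.
  by apply: loop; apply/allP => u; rewrite mem_adj.
by rewrite mem_adj; apply: ExecPrim.
Qed.

Lemma scan_verticesP o r0 r1 r2 r3 r4 r5 r6 r7 r8 r9 r10 r11 r12 r14 b r16 r17 r19 k s :
  exec (scan_vertices ops)
   (st (flatten [seq encode_vertex I enc v | v <- s]) o r0 r1 r2 r3 r4 r5 r6 r7 r8 r9 r10 r11
       r12
      [::] r14 (bfl b) r16 r17 (numw k.+1) r19)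
   (st [::] o r0 r1 r2 r3 r4 r5 r6 r7 r8 r9 r10 r11 r12 [::] r14 (bfl (b || has (dd_edge I k)
       s))
      r16 r17 (numw k.+1) r19).
Proof.
elim: s b => [|v s IH] b; first by rewrite orbF; apply: ExecDone.
apply: ExecLoop; first by [].
  exact: scan_vertexP.
by apply: exec_eq; [exact: IH|rewrite /= orbA].
Qed.

Definition live v k := has (dd_edge I k) (drop v.+1 (enum 'I_T)).

Lemma prune_entryP i o r0 r1 r2 r3 r4 r5 r6 tb r8 r9 r10 r11 r12 r14 r16 k v :
  size r16 + size (entry k) <= B ->
  exec (prune_entry ops)
   (st i o r0 r1 r2 r3 r4 r5 r6 (entry k ++ tb) r8 r9 r10 r11 r12
      [::] r14 [::] r16 (numw v.+2) [::] [::])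
   (st [::] o r0 r1 r2 r3 r4 r5 r6 tb r8 r9 r10 r11 r12 [::] r14 [::]
      (if live v k then rev (entry k) ++ r16 else r16) (numw v.+2) [::] [::]).
Proof.
move=> sB; apply: ExecSeq; first exact: read_entryP.
rewrite /st; apply: ExecSeq.
  eapply (@seekP A Sg sy us syK blocks B _ _ _ (bits v.+2)); side; first by rewrite numwE.
  have := size_vertex v; have := size_incr (bits v.+1).
  by rewrite -bitsS !size_bits; lia.
(* Block 0 is the header and the vertex of index [v] is block [v.+1], so dropping [v.+2] blocks
   leaves the vertices of index above [v], as in [live]. *)
rewrite num_bits /= -map_drop.
apply: ExecSeq; first exact: (scan_verticesP _ _ _ _ _ _ _ _ _ _ _ _ _ _ _ false).
rewrite /= -/(live v k); case: ifP => _; apply: ExecIf; rewrite filled_view /=.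
  by run popP; apply: write_entryP.
by run clearP; apply: exec_eq; first by eapply clearP; side.
Qed.

(** In use the table contains at least the vertex just inserted; being nonempty makes the final
    input position definite, as each entry is checked by a scan to the end of the input. *)
Lemma pruneP i o r0 r1 r2 r3 r4 r6 r8 r9 r10 r11 r12 r14 s v :
  s != [::] -> size (table s) <= B ->
  exec (prune ops)
   (st i o r0 r1 r2 r3 r4 (numw v.+1) r6 (table s) r8 r9 r10 r11 r12
      [::] r14 [::] [::] [::] [::] [::])
   (st [::] o r0 r1 r2 r3 r4 (numw v.+1) r6 (table [seq k <- s | live v k]) r8 r9 r10 r11 r12
      [::] r14 [::] [::] [::] [::] [::]).
Proof.
move=> s0 sB; have sv := size_vertex v; have sz := size_numw v.+1.
rewrite /st; run copyP.
apply: ExecSeq.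
  eapply (@incrementP A Sg sy us syK blocks B _ _ (bits v.+1)); side; first by rewrite numwE.
  by rewrite size_bits; lia.
rewrite -bitsS -numwE /=.
have loop s' : forall i' tb2, size tb2 + size (table s') <= B ->
  exec (While (@filled A Sg 7) (prune_entry ops))
   (st i' o r0 r1 r2 r3 r4 (numw v.+1) r6 (table s') r8 r9 r10 r11 r12
      [::] r14 [::] tb2 (numw v.+2) [::] [::])
   (st (if s' is [::] then i' else [::]) o r0 r1 r2 r3 r4 (numw v.+1) r6 [::] r8 r9 r10 r11 r12
      [::] r14 [::] (rev (table [seq k <- s' | live v k]) ++ tb2) (numw v.+2) [::] [::]).
  elim: s' => [|k s' IH] i' tb2; first by move=> _; apply: ExecDone; rewrite filled_view.
  rewrite table_cons size_cat => sB'; apply: ExecLoop.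
  - by rewrite filled_view /= entry_def; case: (symbits _ _).
  - by apply: prune_entryP; lia.
  apply: exec_eq; first apply: IH.
    by case: ifP => _; rewrite ?size_cat ?size_rev; lia.
  rewrite /=; case: ifP => lk; last by case: (s').
  by rewrite table_cons rev_cat -catA; case: (s').
have st_ : size (table [seq k <- s | live v k]) <= B.
  apply: leq_trans sB; elim: (s) => // k s' IH /=; case: ifP => _; rewrite !table_cons
      !size_cat; lia.
apply: ExecSeq; first exact: loop.
rewrite /st; run clearP.
case: (s) s0 st_ => //= k s' _ st_.
apply: exec_eq; first by eapply transferP; side; rewrite size_rev; lia.
by rewrite /= ?cats0 map_id revK ?cats0.
Qed.

(** * Maximum over the in-neighbours, and the witness *)

Definition prod_ v u : S := ms_mul (x_ u) (di_weight I u v).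

(** A tie keeps the older candidate, which is the earlier edge in the tie-breaking order because
    [adj] is sorted. *)
Definition better v (acc : option ('I_T * S)) u : option ('I_T * S) :=
  if acc is Some (b, x) then
    if (prod_ v u <= x)%O then Some (b, x) else Some (u, prod_ v u)
  else Some (u, prod_ v u).

Definition acc_val (acc : option ('I_T * S)) : seq Sg :=
  if acc is Some (_, x) then wd x else [::].
Definition acc_best (acc : option ('I_T * S)) : seq Sg :=
  if acc is Some (b, _) then numw b.+1 else [::].

Lemma bsy_true (b : bool) : (Some (bsy sy b) == Some (bsy sy true)) = b.
Proof. by rewrite (inj_eq (@Some_inj _)) (inj_eq (bsy_inj syK)); case: b. Qed.

Lemma nilp_numw n : nilp (numw n) = false.
Proof. by rewrite numw_def; have [x [l ->]] := symbits_cons n. Qed.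

Lemma edge_progP i o r0 r1 r2 r3 r4 r5 r6 r10 s u v acc :
  r0 = numw T -> uniq s -> u \in s -> size (table s) <= B -> dd_edge I u v ->
  (if acc is Some (_, x) then is_word enc cw T x else true) ->
  exec (edge_prog ops)
   (st (encode_edge I enc v u ++ i) o r0 r1 r2 r3 r4 r5 r6 (table s) (acc_val acc) (acc_best
       acc)
      r10 [::] [::] [::] [::] [::] [::] [::] [::] [::])
   (st i o r0 r1 r2 r3 r4 r5 r6 (table s) (acc_val (better v acc u)) (acc_best (better v acc u))
      r10 [::] [::] [::] [::] [::] [::] [::] [::] [::]).
Proof.
move=> e0 us_ u_s sB uv wacc; have su := size_vertex u.
have [_ _ /(_ _ _ uv) ww /(_ _ _ uv) wp] := words.
have sw := size_wd ww; have sp := size_wd wp; have szu := size_numw u.+1.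
rewrite /st /encode_edge -catA cat_cons -catA.
run read_wordP; [exact: nosep_bits|by rewrite size_symbits; lia|].
rewrite -numw_def.
run read_wordP; [exact: nosep_enc|by rewrite wd_def size_map in sw; lia|].
rewrite -wd_def.
apply: ExecSeq; first exact: lookupP.
apply: ExecSeq; first exact: mul_progP (word_val u) ww.
rewrite -/(prod_ v u) in wp sp *.
(* The replacing branch, common to the first product, where [rF] is empty, and to a negative
   comparison. *)
have upd f : size f <= 1 -> (f == [:: bsy sy true] = false) ->
   exec (If (fun z : view A Sg => top z 15 == Some (bsy sy true))
    (Seq (pop A Sg 15) (Seq (clear A Sg 14) (clear A Sg 11)))
    (Seq (clear A Sg 15) (Seq (clear A Sg 8) (Seq (clear A Sg 9)
       (Seq (relay A Sg 14 8 20) (relay A Sg 11 9 20))))))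
    (st i o r0 r1 r2 r3 r4 r5 r6 (table s) (acc_val acc) (acc_best acc)
      r10 (numw u.+1) [::] [::] (wd (prod_ v u)) f [::] [::] [::] [::])
    (st i o r0 r1 r2 r3 r4 r5 r6 (table s) (wd (prod_ v u)) (numw u.+1)
      r10 [::] [::] [::] [::] [::] [::] [::] [::] [::]).
  move=> f1 ft; apply: ExecIf; rewrite /st top_view /=.
  have -> : (ohead f == Some (bsy sy true)) = false.
    by case: f f1 ft => [|x [|]] //= _ <-; rewrite eqseq_cons andbT.
  run clearP. run clearP. run clearP. run relayP.
  by apply: exec_eq; [eapply relayP; side|rewrite /= cats0].
case: acc wacc upd => [[b x]|] wacc upd /=.
  have wx := size_wd wacc.
  apply: ExecSeq.
    apply: ExecIf; rewrite filled_view /=.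
    rewrite nilp_numw /=; exact: le_progP.
  case: ifP => px; last by apply: upd => //; rewrite eqseq_cons (inj_eq (bsy_inj syK)).
  apply: ExecIf; rewrite /st top_view /= bsy_true.
  run popP. run clearP.
  by apply: exec_eq; [eapply clearP; side|].
apply: ExecSeq; last by apply: (upd [::]).
by apply: ExecIf; rewrite filled_view /=; apply: ExecPrim.
Qed.

Section Fold.
Variable v : 'I_T.

(** The fold retains the leftmost maximum, whence the strict inequality before it and the weak one
    after it; this asymmetry is what the tie-break uses. *)
Lemma betterP u l : exists b l1 l2, [/\ foldl (better v) None (u :: l) = Some (b, prod_ v b),
  u :: l = l1 ++ b :: l2, {in l1, forall w, (prod_ v w < prod_ v b)%O} &
  {in l2, forall w, (prod_ v w <= prod_ v b)%O}].
Proof.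
elim/last_ind: l => [|l w [b [l1 [l2 [e1 e2 h1 h2]]]]].
  by exists u, [::], [::]; split.
have E : u :: rcons l w = rcons (l1 ++ b :: l2) w by rewrite -e2.
have F : foldl (better v) None (u :: rcons l w) = better v (Some (b, prod_ v b)) w.
  by rewrite -e1 -foldl_rcons.
rewrite F E /better; case: leP => wb.
  exists b, l1, (rcons l2 w); split=> //; first by rewrite rcons_cat.
  by move=> z; rewrite mem_rcons in_cons => /predU1P[->|/h2].
exists w, (l1 ++ b :: l2), [::]; split=> //; first by rewrite cats1.
move=> z; rewrite mem_cat in_cons => /or3P[/h1 zb|/eqP-> //|/h2 zb].
  exact: lt_trans zb wb.
exact: le_lt_trans zb wb.
Qed.

Lemma adj_nil : (adj I v == [::]) = ~~ [exists u, dd_edge I u v].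
Proof.
apply/eqP/idP => [e_|/existsPn h].
  by apply/existsPn => u; rewrite -mem_adj e_.
by case E: (adj I v) => [|u l] //; have := h u; rewrite -mem_adj E mem_head.
Qed.

(** The leftmost maximal product belongs to the tight edge that comes first in the sorted adjacency
    list, hence to the witness. *)
Lemma fold_better : v \notin dd_src I -> adj I v != [::] ->
  exists2 b, foldl (better v) None (adj I v) = Some (b, x_ v) & witness I v = Some b.
Proof.
move=> vs; rewrite adj_nil negbK => /existsP[u0 e0].
have [u wu] := witness_exists vs e0.
have : u0 \in adj I v by rewrite mem_adj.
case E: (adj I v) => [|u1 l] // _.
have [b [l1 [l2 [-> e2 h1 h2]]]] := betterP u1 l.
rewrite -E in e2.
have be : dd_edge I b v by rewrite -mem_adj e2 mem_cat mem_head orbT.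
have all_le w : dd_edge I w v -> (prod_ v w <= prod_ v b)%O.
  rewrite -mem_adj e2 mem_cat in_cons => /or3P[/h1/ltW|/eqP->|/h2] //.
(* The big maximum is attained at some in-neighbour [j], since there is one, and the product at [j]
   is at most that at [b]. *)
have xb : prod_ v b = x_ v.
  rewrite dp_valE /dp_rhs (negbTE vs).
  have [j je ej] := bigmax_attained (fun u => prod_ v u) (P := dd_edge I ^~ v) be.
  apply: le_anti; rewrite -[X in _ && (X <= _)%O]ej all_le // andbT.
  exact: (@le_bigmax_cond _ _ _ (ms_zero S) b (dd_edge I ^~ v) (prod_ v)).
exists b; first by rewrite xb.
move: wu; rewrite /witness (negbTE vs); case: pickP => // w /andP[tw /forallP wmin] _.
congr Some; have [we /eqP wx] := andP tw.
have tb : tight I b v by rewrite /tight be -/(prod_ v b) xb eqxx.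
have wb := implyP (wmin b) tb.
pose P := [pred u | dd_edge I u v]; pose le_ u u' := di_ord I (u, v) (u', v).
have aP : all P (adj I v) by apply/allP => z; rewrite mem_adj.
have pw : pairwise le_ (adj I v).
  rewrite -(sorted_pairwise_in (P := P)) //; last first.
    by move=> x y z Px Py Pz; apply: (di_ord_trans (d := I)).
  apply: (sort_sorted_in (P := P)); last by apply/allP => z; rewrite mem_enum.
  by move=> x y Px Py; apply: (di_ord_total (d := I)).
have : w \in adj I v by rewrite mem_adj.
(* The witness [w] cannot precede [b], where products are strictly below [x_ v]. If it followed [b],
   sortedness and minimality would order the two edges both ways, and antisymmetry would identify
   them. *)
rewrite e2 mem_cat in_cons => /or3P[/h1|/eqP//|wl].
  by rewrite -[prod_ v w]/(ms_mul _ _) wx xb ltxx.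
move: pw; rewrite e2 pairwise_cat /= => /and3P[_ _ /andP[/allP/(_ w wl) bw _]].
have := @di_ord_anti _ _ _ I (w, v) (b, v) we be.
by rewrite wb -/(le_ b w) bw => /(_ isT) [].
Qed.

End Fold.

Lemma vertex_progP i o r0 r1 r2 r3 r4 r5 r6 s v :
  r0 = numw T -> uniq s -> size (table s) <= B -> (forall u, dd_edge I u v -> u \in s) ->
  exec (vertex_prog ops)
   (st (encode_vertex I enc v ++ i) o r0 r1 r2 r3 r4 r5 r6 (table s) [::] [::] [::]
      [::] [::] [::] [::] [::] [::] [::] [::] [::])
   (st (sep :: i) o r0 r1 r2 r3 r4 r5 r6 (table s) (wd (x_ v))
      (if witness I v is Some u then numw u.+1 else [::]) (bfl (v \in dd_src I))
      [::] [::] [::] [::] [::] [::] [::] [::] [::]).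
Proof.
move=> e0 us_ sB es.
rewrite /encode_vertex -!catA !cat_cons -!catA /st.
set i0 := (X in exec _ (State X _ _ _) _).
apply: (@ExecSeq _ _ _ _ _ _ _ (st i0 o r0 r1 r2 r3 r4 r5 r6 (table s) [::] [::]
  (bfl (v \in dd_src I)) [::] [::] [::] [::] [::] [::] [::] [::] [::])).
  apply: ExecIf; set cnd := (X in if X then _ else _).
  have -> : cnd = (v \in dd_src I) by rewrite /cnd /i0 /=; case: (v \in dd_src I).
  case: ifP => vs; last exact: ExecPrim.
  by apply: exec_eq; [eapply pushP; side|].
rewrite /i0.
apply: ExecSeq; first exact: ExecPrim.
apply: ExecSeq; first exact: ExecPrim.
rewrite /=.
have loop l : forall acc, all (fun u => dd_edge I u v) l ->
  (if acc is Some (_, x) then is_word enc cw T x else true) ->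
  exec (While (@in_word A Sg) (edge_prog ops))
   (st (flatten [seq encode_edge I enc v u | u <- l] ++ sep :: i) o r0 r1 r2 r3 r4 r5 r6
       (table s)
     (acc_val acc) (acc_best acc) (bfl (v \in dd_src I))
      [::] [::] [::] [::] [::] [::] [::] [::] [::])
   (st (sep :: i) o r0 r1 r2 r3 r4 r5 r6 (table s)
     (acc_val (foldl (better v) acc l)) (acc_best (foldl (better v) acc l)) (bfl (v \in
         dd_src I))
      [::] [::] [::] [::] [::] [::] [::] [::] [::]).
  elim: l => [|u l IH] acc; first by move=> _ _; apply: ExecDone.
  rewrite -[flatten _]/(encode_edge I enc v u ++ flatten [seq encode_edge I enc v u | u <- l]).
  rewrite -catA => /andP[uv lv] wacc; apply: ExecLoop.
  - by rewrite /encode_edge; have [x [w' ->]] := symbits_cons u.+1.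
  - by apply: edge_progP => //; apply: es.
  apply: IH => //; have [_ _ _ /(_ _ _ uv) wp] := words.
  by case: acc wacc => [[b x]|] wx //=; case: ifP.
have adjP : all (fun u => dd_edge I u v) (adj I v) by apply/allP => u; rewrite mem_adj.
case: (boolP (v \in dd_src I)) loop => vs loop.
  have an : adj I v = [::].
    by apply/eqP; rewrite adj_nil; apply/existsPn => u; apply: dd_src_indeg0.
  have [/(_ v vs) wv _ _ _] := words.
  rewrite an; run read_wordP; [exact: nosep_enc|by rewrite size_map; rewrite /is_word in wv;
      lia|].
  apply: ExecSeq; first exact: ExecDone.
  apply: ExecIf; rewrite !filled_view /=.
  rewrite /witness vs dp_valE /dp_rhs vs -wd_def; exact: ExecPrim.
apply: ExecSeq; first by apply: read_wordP => //=; lia.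
rewrite /=; apply: ExecSeq; first exact: (loop _ None).
have [an|an] := eqVneq (adj I v) [::].
  have ne u : dd_edge I u v = false by rewrite -mem_adj an.
  apply: ExecIf; rewrite /st !filled_view an /=.
  have -> : witness I v = None.
    by rewrite /witness (negbTE vs); case: pickP => // w /andP[/andP[]]; rewrite ne.
  have -> : x_ v = ms_zero S.
    by rewrite dp_valE /dp_rhs (negbTE vs) big_pred0.
  exact: zero_progP.
have [b -> ->] := fold_better vs an.
apply: ExecIf; rewrite /st !filled_view /=.
rewrite nilp_numw /=; exact: ExecPrim.
Qed.

(** * Frontiers and the forward sweep *)

Lemma drop_enum v : drop v (enum 'I_T) = v :: drop v.+1 (enum 'I_T).
Proof. by rewrite (drop_nth v) ?size_enum_ord // nth_ord_enum. Qed.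

Lemma mem_drop_enum (n : nat) w : (w \in drop n (enum 'I_T)) = (n <= w).
Proof.
rewrite -(mem_map val_inj) map_drop val_enum_ord drop_iota mem_iota /= add0n.
by have := ltn_ord w; lia.
Qed.

Lemma liveP v k : reflect (exists2 w : 'I_T, v < w & dd_edge I k w) (live v k).
Proof.
apply: (iffP hasP) => -[w]; first by rewrite mem_drop_enum => vw kw; exists w.
by move=> vw kw; exists w; rewrite // mem_drop_enum.
Qed.

Definition frontier (n : nat) s := uniq s /\ s =i front I n.

Lemma frontP (n : nat) u :
  reflect (u < n /\ exists2 w : 'I_T, n <= w & dd_edge I u w) (u \in front I n).
Proof.
rewrite inE; apply: (iffP andP) => -[un].
  by case/existsP=> w /andP[nw uw]; split=> //; exists w.
by case=> w nw uw; split=> //; apply/existsP; exists w; apply/andP.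
Qed.

Lemma frontier_size (n : nat) s : n <= T -> frontier n s -> size s <= frontier_width I.
Proof.
move=> nT [us_ es]; rewrite -(card_uniqP us_) (eq_card es).
exact: (leq_bigmax (Ordinal (nT : n < T.+1))).
Qed.

Lemma frontier0 : frontier 0 [::].
Proof. by split=> // u; apply/esym/frontP => -[]. Qed.

Lemma frontier_notin v s : frontier v s -> v \notin s.
Proof. by case=> _ es; rewrite es; apply/frontP => -[]; rewrite ltnn. Qed.

(** An older vertex with an edge beyond [v] already had an edge across the previous cut, so the new
    frontier is contained in the old one together with [v]. *)
Lemma frontierS v s : frontier v s -> frontier v.+1 [seq k <- v :: s | live v k].
Proof.
move=> fr; have vs := frontier_notin fr; case: fr => us_ es.
split; first by rewrite filter_uniq //= vs.
move=> u; rewrite mem_filter in_cons es; apply/andP/frontP.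
  case=> /liveP[w vw uw] uvs; split; last by exists w.
  by case/predU1P: uvs => [->|/frontP[uv _]]; rewrite ?ltnS // ltnW.
case; rewrite ltnS leq_eqVlt => uv [w vw uw]; split; first by apply/liveP; exists w.
case/orP: uv => [/eqP/val_inj->|uv]; first by rewrite eqxx.
by apply/orP; right; apply/frontP; split=> //; exists w; rewrite // ltnW.
Qed.

Definition best_word v : seq Sg := if witness I v is Some u then numw u.+1 else [::].

Lemma sweep_bodyP i o r0 r1 r3 r4 s k v :
  r0 = numw T -> frontier v s ->
  exec (sweep_body ops)
   (st i o r0 r1 (numw k.+1) r3 r4 (numw v) [:: fl] (table s) [::] [::] [::]
      [::] [::] [::] [::] [::] [::] [::] [::] [::])
   (if v == k then
     st (sep :: flatten [seq encode_vertex I enc w | w <- drop v.+1 (enum 'I_T)])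
      o r0 r1 (numw k.+1) r3 r4 [::] [::] [::] [::] (best_word v) (bfl (v \in dd_src I))
      [::] [::] [::] [::] [::] [::] [::] [::] [::]
    else
     st [::] o r0 r1 (numw k.+1) r3 r4 (numw v.+1) [:: fl] (table [seq u <- v :: s | live v u])
      [::] [::] [::] [::] [::] [::] [::] [::] [::] [::] [::] [::]).
Proof.
move=> e0 fr; have sv := size_vertex v; have sk := size_vertex k.
have szv := size_numw v.+1; have szk := size_numw k.+1; have sx := size_val v.
have sT : size (table (v :: s)) <= B.
  apply: leq_trans hT; apply: leq_trans (size_table _) _; rewrite leq_mul2r ltnS.
  by rewrite (frontier_size _ fr) ?orbT // ltnW.
have sE := sT; rewrite table_cons size_cat in sE.
rewrite /st; apply: ExecSeq.
  eapply (@incrementP A Sg sy us syK blocks B _ _ (bits v)); side; first by rewrite numwE.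
  by have := leq_lg (ltnW (ltn_ord v)); rewrite size_bits; lia.
rewrite -bitsS -numwE /=; apply: ExecSeq.
  eapply (@seekP A Sg sy us syK blocks B _ _ _ (bits v.+1)); side; first by rewrite numwE.
  by rewrite size_bits; lia.
rewrite num_bits /= -map_drop drop_enum.
apply: ExecSeq.
  apply: vertex_progP => //; [by case: fr|lia|].
  (* The edge into [v] itself crosses the cut just before [v], which puts every in-neighbour in the
     frontier. *)
  move=> u uv; case: fr => _ ->; apply/frontP; split; first exact: dd_edge_lt uv.
  by exists v.
rewrite -/(best_word v) /st; run same_wordsP; rewrite eq_numw; case: eqP => vk.
  apply: ExecIf; rewrite filled_view /=.
  run popP. run popP. run clearP. run clearP.
  by apply: exec_eq; [eapply clearP; side|].
apply: ExecIf; rewrite filled_view /=.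
apply: (@ExecSeq _ _ _ _ _ _ _ (st (sep :: flatten [seq encode_vertex I enc w | w <- drop
    v.+1 (enum 'I_T)])
      o r0 r1 (numw k.+1) r3 r4 (numw v.+1) [:: fl] (table (v :: s)) [::] (best_word v)
      (bfl (v \in dd_src I)) [::] [::] [::] [::] [::] [::] [::] [::] [::])).
  rewrite entry_def -wd_def -numw_def size_cat /= size_cat /= in sE.
  run pushP.
  run relayP.
  run pushP; first by rewrite size_cat /=; lia.
  apply: exec_eq; first by eapply copyP; side; rewrite size_cat /=; lia.
  by rewrite /= table_cons entry_def -wd_def -numw_def -!catA /= -catA.
rewrite /st; run clearP. run clearP.
exact: pruneP.
Qed.

Lemma sweepP i o r0 r1 r3 r4 k :
  r0 = numw T -> exists i',
  exec (sweep ops)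
   (st i o r0 r1 (numw k.+1) r3 r4 [::] [::] [::] [::] [::] [::]
      [::] [::] [::] [::] [::] [::] [::] [::] [::])
   (st i' o r0 r1 (numw k.+1) r3 r4 [::] [::] [::] [::] (best_word k) (bfl (k \in dd_src I))
      [::] [::] [::] [::] [::] [::] [::] [::] [::]).
Proof.
move=> e0.
have loop n : forall i s v, k - v = n -> v <= k -> frontier v s -> exists i',
  exec (While (@filled A Sg 6) (sweep_body ops))
   (st i o r0 r1 (numw k.+1) r3 r4 (numw v) [:: fl] (table s) [::] [::] [::]
      [::] [::] [::] [::] [::] [::] [::] [::] [::])
   (st i' o r0 r1 (numw k.+1) r3 r4 [::] [::] [::] [::] (best_word k) (bfl (k \in dd_src I))
      [::] [::] [::] [::] [::] [::] [::] [::] [::]).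
  elim: n => [|n IH] i1 s v kv vk fr; have := sweep_bodyP i1 o r1 r3 r4 k e0 fr.
    have -> : v = k by apply: val_inj => /=; lia.
    rewrite eqxx => ex; eexists; apply: ExecLoop ex _; first by rewrite filled_view.
    by apply: ExecDone; rewrite filled_view.
  have vk' : v < k by lia.
  rewrite -val_eqE /= (ltn_eqF vk') => ex.
  pose v' := Ordinal (leq_ltn_trans vk' (ltn_ord k)).
  have [|||i' ex'] := IH [::] [seq u <- v :: s | live v u] v'.
  - by rewrite /=; lia.
  - by [].
  - exact: frontierS.
  exists i'; apply: ExecLoop ex _; first by rewrite filled_view.
  exact: ex'.
(* Index 0, in range because [k] is. The counter starts at the numeral 0, since the body increments
   it before reading a vertex. *)
pose v0 := Ordinal (leq_ltn_trans (leq0n k) (ltn_ord k)).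
have [|||i' ex] := loop (k - v0) i [::] v0 => //; first exact: frontier0.
exists i'; rewrite /st; run pushP. run pushP.
by rewrite -numw0; apply: ex.
Qed.

(** * Walking back from the target, and the output *)

Definition lastw (lo : option 'I_T) : seq Sg := if lo is Some u then numw u.+1 else [::].

(** Absence is the empty word in both registers, so one comparison serves for the source before any
    output and for every later vertex. *)
Lemma eq_lastw lo lo' : (lastw lo == lastw lo') = (lo == lo').
Proof.
by case: lo lo' => [u|] [v|] //; apply: eq_numw.
Qed.

Lemma size_lastw lo : size (lastw lo) <= lg T.
Proof. by case: lo => //= u; rewrite size_numw size_vertex. Qed.

Definition main_st i o u lo (run : bool) :=
  st i o (numw T) (numw t.+1) (numw u.+1) (lastw lo) (bfl run)
    [::] [::] [::] [::] [::] [::] [::] [::] [::] [::] [::] [::] [::] [::] [::].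

Lemma main_stuck i o u lo : witness I u = None -> u \notin dd_src I ->
  exists i', exec (main_body ops) (main_st i o u lo true) (main_st i' o u lo false).
Proof.
move=> wu us_; have [i' ex] := sweepP i o (numw t.+1) (lastw lo) [:: fl] u erefl.
exists i'; apply: ExecSeq; first exact: ex.
rewrite /best_word wu (negbTE us_) /st; apply: ExecIf; rewrite !filled_view /=.
by apply: exec_eq; [eapply popP; side|].
Qed.

Lemma main_back i o u v lo : witness I u = Some v -> lo != Some v ->
  exists i', exec (main_body ops) (main_st i o u lo true) (main_st i' o v lo true).
Proof.
move=> wu lv; have [i' ex] := sweepP i o (numw t.+1) (lastw lo) [:: fl] u erefl.
have slo := size_lastw lo; have sv := size_vertex v; have szv := size_numw v.+1.
exists i'; apply: ExecSeq; first exact: ex.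
rewrite /best_word wu /st; apply: ExecIf; rewrite !filled_view /= nilp_numw /=.
run clearP. run same_wordsP.
have -> : (numw v.+1 == lastw lo) = false.
  by rewrite -[numw v.+1]/(lastw (Some v)) eq_lastw eq_sym (negbTE lv).
apply: ExecIf; rewrite filled_view /=.
run clearP.
by apply: exec_eq; [eapply relayP; side|rewrite /= cats0].
Qed.

(** After an output the walk restarts at [t]; the output of [t] itself ends the program. *)
Lemma main_output i o u lo : witness I u = lo -> (u \in dd_src I) || isSome lo ->
  exists i', exec (main_body ops) (main_st i o u lo true)
    (main_st i' (o ++ symbits A u.+1 ++ [:: sep]) t (Some u) (u != t)).
Proof.
move=> wu ul; have [i' ex] := sweepP i o (numw t.+1) (lastw lo) [:: fl] u erefl.
have slo := size_lastw lo; have su := size_vertex u; have szu := size_numw u.+1.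
have st_ := size_vertex t; have szt := size_numw t.+1.
exists i'; apply: ExecSeq; first exact: ex.
rewrite /best_word wu -/(lastw lo) /st; apply: ExecIf; rewrite !filled_view /=.
have -> : ~~ nilp (lastw lo) || ~~ nilp (bfl (u \in dd_src I)).
  by case: (lo) ul => [v|] /=; rewrite ?nilp_numw // orbF => ->.
run clearP. run same_wordsP.
rewrite eqxx; apply: ExecIf; rewrite filled_view /=.
run popP. run clearP.
apply: ExecSeq.
  eapply (@emitP A Sg sy us syK blocks B _ _ _ (symbits A u.+1)); side.
  by rewrite size_symbits; lia.
run clearP. run copyP. run same_wordsP.
rewrite eq_numw; case: eqP => [ut|_]; apply: ExecIf; rewrite filled_view /=.
  run popP.
  by apply: exec_eq; [eapply popP; side|rewrite /= ut].
run clearP.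
by apply: exec_eq; [eapply copyP; side|rewrite /= cats0].
Qed.

Notation pred_rel := (fun u v => witness I v == Some u).

Lemma witness_edge u v : witness I v = Some u -> dd_edge I u v.
Proof.
rewrite /witness; case: ifP => // _; case: pickP => // z /andP[/andP[zv _] _] [<-].
exact: zv.
Qed.

(** Witness edges strictly increase the index. *)
Lemma pred_sorted s : sorted pred_rel s -> uniq s.
Proof.
move=> ss; apply: (@sorted_uniq _ (fun u v : 'I_T => u < v)).
- by move=> x y z; apply: ltn_trans.
- by move=> x; apply: ltnn.
by apply: sub_sorted ss => x y /eqP/witness_edge/dd_edge_lt.
Qed.

Notation main_loop := (While (@filled A Sg 4) (main_body ops)).

Lemma encode_rcons s u :
  encode_path A (rcons s u) = encode_path A s ++ symbits A u.+1 ++ [:: sep].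
Proof. by rewrite /encode_path map_rcons flatten_rcons. Qed.

Definition outputs (x : state A Sg) (o : seq (sym A)) :=
  exists2 y, exec main_loop x y & outp y = o.

Lemma outputs_step i o u lo x o' :
  exec (main_body ops) (main_st i o u lo true) x -> outputs x o' ->
  outputs (main_st i o u lo true) o'.
Proof. by move=> ex [y ey <-]; exists y => //; apply: ExecLoop ex ey; rewrite filled_view. Qed.

Lemma outputs_stop i o u lo : outputs (main_st i o u lo false) o.
Proof. by exists (main_st i o u lo false) => //; apply: ExecDone; rewrite filled_view. Qed.

(* [pre] has been output, the walk back from [t] has reached [u], and [mid] is
   what it still has to cross before it meets the last output vertex. *)
Lemma walk_back pre mid u post v0 s :
  v0 :: s = pre ++ mid ++ u :: post -> path pred_rel v0 s -> v0 \in dd_src I ->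
  last v0 s = t ->
  let lo := ohead (rev pre) in
  forall i, exists i',
  exec (main_body ops) (main_st i (encode_path A pre) u lo true)
    (if mid is z :: mid' then main_st i' (encode_path A pre) (last z mid') lo true
     else main_st i' (encode_path A (rcons pre u)) t (Some u) (u != t)).
Proof.
move=> ep pp v0s lt lo i.
have up : uniq (v0 :: s) by apply: pred_sorted.
have srt : sorted pred_rel (v0 :: s) by [].
case: mid ep => [|z mid'] ep.
  rewrite encode_rcons; apply: main_output.
    case/lastP: pre ep @lo => [|pre z] ep /=.
      by case: ep => <- _; rewrite /witness v0s.
    rewrite rev_rcons /=; apply/eqP.
    move: srt; rewrite ep cat_rcons /=; case: pre {ep} => [|y pre] /=; first by case/andP.
    by rewrite cat_path /= => /and3P[_ _ /andP[]].
  case/lastP: pre ep @lo => [|pre z] ep /=; first by case: ep => <- _; rewrite v0s.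
  by rewrite rev_rcons orbT.
apply: main_back.
  apply/eqP; move: srt; rewrite ep /=.
  have -> : pre ++ z :: mid' ++ u :: post = (pre ++ belast z mid') ++ last z mid' :: u :: post.
    by rewrite -catA -(cat_rcons (last z mid')) -lastI.
  case: (pre ++ belast z mid') => [|y q] /=; first by case/andP.
  by rewrite cat_path /= => /and3P[_ _ /andP[]].
(* The walk cannot stop too early: the last output vertex lies in [pre], the predecessor just found
   lies in [mid], and the path has no repetition. *)
rewrite /lo; case/lastP: pre ep {lo} => [|pre y] ep; first by [].
rewrite rev_rcons /= (inj_eq (@Some_inj _)); apply: contraTneq up => yz.
rewrite ep cat_uniq; apply/nandP; right; apply/nandP; left; rewrite negbK.
apply/hasP; exists y; last by rewrite mem_rcons mem_head.
by rewrite yz mem_cat mem_last.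
Qed.

(** Each round shortens [mid] by its last vertex, so the vertex finally output is the first one
    after [pre]. *)
Lemma walk_to_output pre mid u post v0 s :
  v0 :: s = pre ++ mid ++ u :: post -> path pred_rel v0 s -> v0 \in dd_src I ->
  last v0 s = t ->
  let y := head u mid in
  forall i o', (forall i', outputs
    (main_st i' (encode_path A (rcons pre y)) t (Some y) (y != t)) o') ->
  outputs (main_st i (encode_path A pre) u (ohead (rev pre)) true) o'.
Proof.
move=> + pp v0s lt; have [n] := ubnP (size mid).
elim: n mid u post => // n IH mid u post sn ep /= i o' fin.
have [i' ex] := walk_back ep pp v0s lt i.
case: mid sn ep fin ex => [|z mid'] /= sn ep fin ex.
  by apply: outputs_step ex _; apply: fin.
apply: outputs_step ex _.
apply: (IH (belast z mid') (last z mid') (u :: post)).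
- by rewrite size_belast.
- by rewrite ep -(cat_rcons (last z mid')) -lastI.
- by have -> : head (last z mid') (belast z mid') = z by case: (mid').
Qed.

Lemma outputs_rest pre y post v0 s i :
  path pred_rel v0 s -> v0 \in dd_src I -> last v0 s = t -> v0 :: s = pre ++ y :: post ->
  outputs (main_st i (encode_path A pre) t (ohead (rev pre)) true) (encode_path A (v0 :: s)).
Proof.
move=> pp v0s lt; have up : uniq (v0 :: s) by apply: pred_sorted.
elim: post pre y i => [|z post IH] pre y i ep.
  have yt : y = t by rewrite -lt -[last v0 s]/(last v0 (v0 :: s)) ep last_cat.
  apply: (@walk_to_output pre [::] t [::] v0 s) => //=; first by rewrite -yt.
  by move=> i'; rewrite eqxx ep yt cats1; apply: outputs_stop.
have lz : last z post = t by rewrite -lt -[last v0 s]/(last v0 (v0 :: s)) ep last_cat.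
(* Restarting at [t], the walk has to cross everything from [y] to the vertex before [t]. *)
apply: (@walk_to_output pre (y :: belast z post) t [::] v0 s) => //=.
  by rewrite ep -lz cats1 -lastI.
move=> i'; have yt : y != t.
  move: up; rewrite ep cat_uniq /= => /and3P[_ _ /andP[yp _]].
  by apply: contraNneq yp => ->; rewrite -lz mem_last.
rewrite yt -[Some y]/(ohead (y :: rev pre)) -rev_rcons.
by apply: (IH _ z); rewrite cat_rcons.
Qed.

Lemma mem_path_witness v0 s v : path pred_rel v0 s -> v \in s -> witness I v != None.
Proof.
elim: s v0 => //= w s IH v0 /andP[/eqP wv ps]; rewrite in_cons => /predU1P[->|].
  by rewrite wv.
exact: IH ps.
Qed.

(** Predecessors are unique, so the two paths agree backwards from their common end; the second can
    only run out at its source, and there the first one ends as well. *)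
Lemma mem_traceback u l v0 s : path pred_rel u l -> path pred_rel v0 s ->
  v0 \in dd_src I -> last u l = last v0 s -> u \in v0 :: s.
Proof.
move=> + + v0s; elim/last_ind: l s => [|l x IH] s /=; first by move=> _ _ ->; apply: mem_last.
rewrite rcons_path last_rcons => /andP[pl /eqP wx].
case/lastP: s => [_ /= xv|s y]; first by move: wx; rewrite xv /witness v0s.
rewrite rcons_path last_rcons => /andP[ps /eqP wy] xy.
move: wy; rewrite -xy wx => -[e_]; have := IH s pl ps e_.
by rewrite !in_cons mem_rcons in_cons => /orP[->|->]; rewrite ?orbT.
Qed.

(** The first walk, during which no traceback may be assumed. The index decreases, so it ends at a
    source, which gives the traceback, or at a non-source without witness, which excludes one. *)
Lemma outputs_any u l i : path pred_rel u l -> last u l = t ->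
  exists2 o, outputs (main_st i [::] u None true) o &
    forall p, is_traceback I t p -> o = encode_path A p.
Proof.
have [n] := ubnP (u : nat); elim: n u l i => // n IH u l i; rewrite ltnS => un pl lt.
case wu: (witness I u) => [v|].
  have [i' ex] := @main_back i [::] u v None wu isT.
  have [|||o ov op] := IH v (u :: l) i' => //=.
  - exact: leq_trans (dd_edge_lt (witness_edge wu)) un.
  - by rewrite wu eqxx.
  by exists o => //; apply: outputs_step ex ov.
have [us_|us_] := boolP (u \in dd_src I).
  exists (encode_path A (u :: l)); last first.
    by move=> p tp; congr encode_path; apply: traceback_unique tp; exists u, l.
  apply: (@walk_to_output [::] [::] u l u l) => //= i'.
  case: l pl lt => [_ /= ->|z l pl lt]; first by rewrite eqxx; apply: outputs_stop.
  have -> : u != t.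
    have /= /andP[ul _] := @pred_sorted (u :: z :: l) pl.
    by apply: contraNneq ul => ->; rewrite -lt /= mem_last.
  exact: (@outputs_rest [:: u] z l u (z :: l)).
have [i' ex] := @main_stuck i [::] u None wu us_.
exists [::]; first by apply: outputs_step ex _; apply: outputs_stop.
(* A traceback would have to contain [u], but each of its vertices is its source or has a
   witness. *)
move=> p [v0 [s [_ ls v0s ps]]].
have := mem_traceback pl ps v0s; rewrite lt ls => /(_ erefl).
rewrite in_cons => /predU1P[uv|us']; first by rewrite uv v0s in us_.
by have := mem_path_witness ps us'; rewrite wu.
Qed.

Lemma traceback_progP : exists o x,
  [/\ exec (traceback_prog ops) (State (flatten blocks) (nseq (nreg ops) [::]) [::] [::]) x,
    outp x = o & forall p, is_traceback I t p -> o = encode_path A p].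
Proof.
have st_ := size_vertex t; have szt := size_numw t.+1.
pose i0 := flatten [seq encode_vertex I enc v | v <- enum 'I_T].
have [o [x ex ox] op] := @outputs_any t [::] i0 isT erefl.
exists o, x; split=> //.
rewrite nregE /= -!catA cat_cons -!catA.
run read_wordP; [exact: nosep_bits|by rewrite size_symbits; lia|].
run read_wordP; [exact: nosep_bits|by rewrite size_symbits; lia|].
rewrite -!numw_def.
run copyP. run pushP.
exact: ex.
Qed.
End Correctness.

(** As [L] and [E] are positive, every summand can be charged to [w * L] or to [L * E]. The latter
    receives [2 * cw + c] from the words and the semiring machines and [10 = 1 + 2 + 1 + 4 + 2] from
    the other summands; [w * L] receives only [cw + 3]. *)
Lemma space_estimate (w cw c L E : nat) : 0 < L -> 0 < E ->
  (w.+1 * (L + cw * L + 2) + c * E + cw * L + L + 4).+2 <=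
  (2 * cw + c + 10) * (w * L + L * E).
Proof.
move=> L0 E0.
have h1 : L <= L * E by rewrite leq_pmulr.
have h2 : E <= L * E by rewrite leq_pmull.
have h3 : cw * L <= cw * (L * E) by rewrite leq_mul2l h1 orbT.
have h4 : c * E <= c * (L * E) by rewrite leq_mul2l h2 orbT.
have h5 : w * 2 <= 2 * (w * L) by rewrite mulnC leq_mul2l leq_pmulr.
have h6 : 0 < L * E by rewrite muln_gt0 L0.
have -> : w.+1 * (L + cw * L + 2) = L + cw * L + 2 + (w * L + cw * (w * L) + w * 2).
  by rewrite mulSn !mulnDr [w * (cw * _)]mulnCA.
move: (L * E) (w * L) (w * 2) h1 h2 h3 h4 h5 h6 => P Q x3 h1 h2 h3 h4 h5 h6.
move: (cw * L) (c * E) h3 h4 => x1 x2 h3 h4; rewrite !mulnDl !mulnDr ?mulnDl -?mulnA.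
move: (cw * P) (c * P) (cw * Q) (c * Q) h3 h4 => *; lia.
Qed.

Theorem mainTheorem1 (A : finType) (ops : word_ops A) (Delta cw c e : nat) :
  exists (M : machine A) (C d : nat),
    forall (disp : Order.disp_t) (S : max_semiring disp) (enc : S -> seq A)
           (T : nat) (I : dp_instance S T) (t : 'I_T),
      injective enc ->
      implements ops enc cw c e T ->
      indegree_le I Delta ->
      words_ok I enc cw ->
      t \in dd_sink I ->
      space_within M (encode_instance I enc t) [::]
        (C * (frontier_width I * lg T + lg T ^ d)) /\
      exists (n : nat) (out : seq (sym A)),
        halts_with M (encode_instance I enc t) [::] out n /\
        (forall p : seq 'I_T, is_traceback I t p -> out = encode_path A p).
Proof.
exists (tmachine (nreg ops) (compile (traceback_prog ops))).
(* The first factor counts the tapes, the second comes from [space_estimate]. The exponent [e.+1]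
   lets one power dominate both [lg T ^ e] and words of length proportional to [lg T], even when [e]
   or the width is 0. *)
exists ((nreg ops).+1 * (2 * cw + c + 10)), e.+1.
move=> disp S enc T I t _ impl _ words _.
pose L := lg T; pose w := frontier_width I.
(* The sum of what the registers must hold: the table, the data of a simulated machine, a value and
   a number; 4 covers the additive surpluses. *)
pose B := w.+1 * (L + cw * L + 2) + c * L ^ e + cw * L + L + 4.
have [||||o [x [ex <- op]]] := @traceback_progP A ops cw c e disp S enc T I t impl words B;
  try by rewrite /B -/L -/w; lia.
have [sp [n hn]] := tmachine_exec ex; split; last by exists n, (outp x).
move=> k; apply: leq_trans (sp k) _; rewrite -mulnA leq_mul2l; apply/orP; right.
rewrite -/L -/w expnS; apply: space_estimate => //.
by rewrite expn_gt0.
Qed.
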